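(* Let $p \in (0, \infty]$ and $q \in (0, \infty)$, and let $\boldsymbol{\sigma} = ((\sigma_{n, i})_{i=1}^n)_{n \in \mathbb{N}} \in \prod_{n \in \mathbb{N}} (0, \infty)^n$ be a triangular array of positive reals. Assume that the limit $$F_{q, \boldsymbol{\sigma}} := \lim_{n \to \infty}\biggl[ \biggl( \prod_{i = 1}^n \sigma_{n, i} \biggr)^{\frac{1}{n}} \biggl( \frac{1}{n} \sum_{i = 1}^n \sigma_{n, i}^{-q} \biggr)^{\frac{1}{q}} \biggr]$$ exists in $[0, \infty]$, that $$\lim_{n \to \infty} \biggl[ \biggl( \prod_{i = 1}^n \sigma_{n, i} \biggr)^{\frac{2 q}{n}} \frac{1}{n^2} \sum_{i = 1}^n \sigma_{n, i}^{-2 q} \biggr] = 0,$$ that Noether's condition $$\lim_{n \to \infty} \frac{\max_{1 \leq i \leq n} \sigma_{n, i}^{-2 q}}{\sum_{i = 1}^n \sigma_{n, i}^{-2 q}} = 0$$ holds, and, in the case $p < \infty$, that the following limit exists: $$G_{q, \boldsymbol{\sigma}} := \lim_{n \to \infty} \frac{\sum_{i = 1}^n \sigma_{n, i}^{-q}}{\sqrt{n} \bigl( \sum_{i = 1}^n \sigma_{n, i}^{-2 q} \bigr)^{1/2}}.$$ For each $n\in\mathbb{N}$, let $Z_n$ be a random vector uniformly distributed on $\mathbb{B}_p^n$ and let $\Sigma_n := \operatorname{diag}(\sigma_{n,1},\dots,\sigma_{n,n})$. If $p \neq q$ or $G_{q, \boldsymbol{\sigma}} < 1$, then, as $n\to\infty$,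 $$\frac{\sum_{i = 1}^n \sigma_{n, i}^{-q}}{\bigl( \sum_{i = 1}^n \sigma_{n, i}^{-2 q} \bigr)^{1/2}} \biggl( \frac{n^{1/p} \, \lVert \Sigma_n^{-1} Z_n \rVert_q}{M_p(q)^{1/q} \, (\sum_{i = 1}^n \sigma_{n, i}^{-q})^{1/q}} - 1 \biggr) \longrightarrow \mathcal{N}(0, s^2)\quad\text{in distribution,}$$ where $$s^2 := \frac{V_p(q)}{q^2 M_p(q)^2} - \frac{2 C_p(p, q) G_{q, \boldsymbol{\sigma}}^2}{p q M_p(q)} + \frac{G_{q, \boldsymbol{\sigma}}^2}{p}.$$
   Context: For $0<p\le\infty$ and $x\in\mathbb{R}^n$: $\lVert x\rVert_p := (\sum_{i=1}^n |x_i|^p)^{1/p}$ if $p<\infty$, $\lVert x\rVert_\infty := \max_i |x_i|$; $\mathbb{B}_p^n := \{x\in\mathbb{R}^n : \lVert x\rVert_p\le 1\}$. The $p$-Gaussian distribution $\gamma_p$ on $\mathbb{R}$ has density $\frac{1}{2p^{1/p}\Gamma(\frac1p+1)}e^{-|x|^p/p}$ if $p<\infty$, and $\frac12 1_{[-1,1]}(x)$ if $p=\infty$. For $X\sim\gamma_p$: $M_p(q) := \mathbb{E}[|X|^q]$, $V_p(q) := \operatorname{Var}[|X|^q]$, $C_p(q,r) := \operatorname{Cov}[|X|^q,|X|^r]$, with the convention $C_\infty(\infty,q):=0$. Convention: $1/\infty=0$; thus for $p=\infty$ one has $n^{1/p}=1$ and $s^2=\frac{V_\infty(q)}{q^2M_\infty(q)^2}$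 (the terms involving $G_{q,\boldsymbol{\sigma}}$ vanish, whether or not that limit exists). $\mathcal{N}(\mu,v)$ denotes the normal distribution with mean $\mu$ and variance $v$. *)

(* Defs.v *)
From HB Require Import structures.
From mathcomp Require Import all_boot all_order all_algebra.
From mathcomp Require Import all_classical all_reals all_analysis.
From mathcomp Require Import measurable_realfun ring lra.

Set Implicit Arguments.
Unset Strict Implicit.
Unset Printing Implicit Defensive.

Import Order.TTheory GRing.Theory Num.Theory.
Import numFieldNormedType.Exports.

Local Open Scope classical_set_scope.
Local Open Scope ring_scope.

Section lebesgue_cons.
Context {R : realType} (n : nat).
Variable mu : {sigma_finite_measure set (n.-tuple R) -> \bar R}.

Definition tuple_cons (x : R * n.-tuple R) : n.+1.-tuple R :=
  [tuple of x.1 :: x.2].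

Definition tuple_uncons (t : n.+1.-tuple R) : R * n.-tuple R :=
  (thead t, [tuple of behead t]).

Lemma tuple_consK : cancel tuple_cons tuple_uncons.
Proof.
move=> [x t]; rewrite /tuple_uncons theadE; congr pair.
exact: val_inj.
Qed.

Lemma tuple_unconsK : cancel tuple_uncons tuple_cons.
Proof. by move=> t; rewrite [RHS]tuple_eta. Qed.

Lemma measurable_tuple_cons : measurable_fun [set: _] tuple_cons.
Proof. exact: measurable_cons. Qed.

Lemma measurable_tuple_uncons : measurable_fun [set: _] tuple_uncons.
Proof.
apply: measurable_fun_pair; first exact: measurable_tnth.
exact: measurable_behead.
Qed.

Definition lebesgue_cons : set (n.+1.-tuple R) -> \bar R :=
  pushforward (@lebesgue_measure R \x mu)%E tuple_cons.

Let mcons A : measurable A -> measurable (tuple_cons @^-1` A).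
Proof.
by move=> mA; rewrite -[X in measurable X]setTI; exact: measurable_tuple_cons.
Qed.

Let lebesgue_cons0 : lebesgue_cons set0 = 0%E.
Proof. by rewrite /lebesgue_cons /pushforward preimage_set0 measure0. Qed.

Let lebesgue_cons_ge0 A : (0 <= lebesgue_cons A)%E.
Proof. by rewrite /lebesgue_cons /pushforward; exact: measure_ge0. Qed.

Let lebesgue_cons_sigma_additive : semi_sigma_additive lebesgue_cons.
Proof.
move=> F mF tF mUF; rewrite /lebesgue_cons /pushforward preimage_bigcup.
apply: measure_semi_sigma_additive.
- by move=> k; exact: mcons.
- apply/trivIsetP => /= i j _ _ ij; rewrite -preimage_setI.
  by move/trivIsetP : tF => /(_ _ _ _ _ ij) ->//; rewrite preimage_set0.
- by rewrite -preimage_bigcup; exact: mcons.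
Qed.

HB.instance Definition _ := isMeasure.Build _ _ _ lebesgue_cons
  lebesgue_cons0 lebesgue_cons_ge0 lebesgue_cons_sigma_additive.

Let lebesgue_cons_sigma_finite : sigma_finite setT lebesgue_cons.
Proof.
have /sigma_finiteP[F [UF ndF Foo]] := sigma_finiteT (@lebesgue_measure R).
have /sigma_finiteP[G [UG ndG Goo]] := sigma_finiteT mu.
exists (fun k => tuple_uncons @^-1` (F k `*` G k)).
  rewrite -preimage_bigcup -(preimage_setT tuple_uncons); congr (_ @^-1` _).
  rewrite -setXTT UF UG predeqE => -[x y]; split.
    move=> [/= [i _ Fix] [j _ Gjy]]; exists (maxn i j) => //; split.
    - by move: x Fix; exact/subsetPset/ndF/leq_maxl.
    - by move: y Gjy; exact/subsetPset/ndG/leq_maxr.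
  by move=> [i _ []/= ? ?]; split; exists i.
move=> k; have [mF Fk] := Foo k; have [mG Gk] := Goo k; split.
  rewrite -[X in measurable X]setTI; apply: measurable_tuple_uncons => //.
  exact: measurableX.
rewrite /lebesgue_cons /pushforward (_ : _ @^-1` _ = F k `*` G k); last first.
  by apply/funext => x; exact: (congr1 (F k `*` G k) (tuple_consK x)).
by rewrite product_measure1E// lte_mul_pinfty// ge0_fin_numE.
Qed.

HB.instance Definition _ := Measure_isSigmaFinite.Build _ _ _ lebesgue_cons
  lebesgue_cons_sigma_finite.

End lebesgue_cons.

(* Lebesgue measure on R^n, R^n being n.-tuple R with its product
   sigma-algebra; lebesgue_tuple_box is the usual characterization. *)
Fixpoint lebesgue_tuple (R : realType) (n : nat) :
    {sigma_finite_measure set (n.-tuple R) -> \bar R} :=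
  if n is m.+1 then lebesgue_cons (lebesgue_tuple R m)
  else \d_([tuple] : 0.-tuple R).

Lemma lebesgue_tuple_box (R : realType) (n : nat) (A : 'I_n -> set R) :
  (forall i, measurable (A i)) ->
  lebesgue_tuple R n [set t | forall i, A i (tnth t i)] =
  (\prod_(i < n) lebesgue_measure (A i))%E.
Proof.
elim: n A => [|n IH] A mA.
  rewrite big_ord0 /= diracE mem_set// => -[]//.
rewrite big_ord_recl -IH//= /lebesgue_cons /pushforward.
rewrite -product_measure1E; last 2 first.
  exact: mA.
  rewrite (_ : [set _ | _] =
      \bigcap_(i in [set: 'I_n]) (@tnth n R ^~ i @^-1` A (lift ord0 i))); last first.
    by apply/seteqP; split => [t tA i _|t tA i] //=; exact: (tA i I).
  apply: fin_bigcap_measurable => // i _; rewrite -[X in measurable X]setTI.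
  exact: measurable_tnth.
congr (product_measure1 _ _ _); apply/seteqP; split => [[x t] xtA|[x t] [/= Ax tA] i].
  split=> [|i] /=; first by have := xtA ord0; rewrite (tnth_nth 0).
  by have := xtA (lift ord0 i); rewrite !(tnth_nth 0).
have [->|[j ->]] : i = ord0 \/ exists j, i = lift ord0 j.
  by case: (unliftP ord0 i) => [j ->|->]; [right; exists j|left].
- by rewrite (tnth_nth 0).
- by have := tA j; rewrite !(tnth_nth 0).
Qed.

Definition Gamma {R : realType} (s : R) : R :=
  \int[lebesgue_measure]_(t in `[0, +oo[) (t `^ (s - 1) * expR (- t)).

Section pgauss_normalization.
Context {R : realType}.
Local Notation mu := (@lebesgue_measure R).
Implicit Types (a r s t x : R).

Let tail a : (\int[mu]_(t in `[a, +oo[) (expR (- t))%:E = (expR (- a))%:E)%E.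
Proof.
have cE (z : R^o) : {for z, continuous (fun t : R^o => expR (- t))}.
  apply: continuous_comp; last exact: continuous_expR.
  by apply: (@continuousN _ R^o) => //; exact: cvg_id.
rewrite (@ge0_continuous_FTC2y _ _ (fun t => - expR (- t)) _ 0).
- by rewrite EFinN oppeK add0e.
- by move=> x _; exact: expR_ge0.
- by apply: continuous_subspaceT.
- by rewrite -oppr0; apply: cvgN; exact: cvgr_expR.
- by move=> x _; exact: ex_derive.
- by apply: cvg_at_right_filter; apply: cvgN; exact: cE.
- move=> x _; rewrite derive1N//.
  rewrite derive1_comp// derive1N// derive1_id derive1E.
  by have /funeqP -> := @derive_expR R; rewrite mulrN1 opprK.
Qed.

Let mGamma s : measurable_fun [set: R] (fun t => t `^ s * expR (- t)).
Proof.
apply: measurable_funM; first exact: measurable_powR.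
by apply: measurableT_comp => //; exact: measurable_funN.
Qed.

Let mpgauss r : measurable_fun [set: R] (fun x => expR (- (`|x| `^ r / r))).
Proof.
apply: measurableT_comp => //; apply: measurableT_comp => //.
apply: measurable_funM => //.
by apply: (measurableT_comp (measurable_powR _)).
Qed.

Let Gamma_fin s : 0 < s ->
  (\int[mu]_(t in `[0%R, +oo[) (t `^ s * expR (- t))%:E < +oo)%E.
Proof.
move=> s0; have h0 : (0 < 2^-1 :> R) by rewrite invr_gt0.
pose C := 2 * (2 * s) `^ s.
have C0 : 0 <= C by rewrite mulr_ge0 ?powR_ge0.
have le1 t : 0 <= t -> t `^ s * expR (- t) <= C * exponential_pdf 2^-1 t.
  move=> t0; rewrite exponential_pdfE//.
  have ts : t `^ s <= (2 * s) `^ s * expR (t / 2).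
    have tE : t = (2 * s) * (t / (2 * s)).
      by rewrite mulrCA divff ?mulr1// mulf_neq0// gt_eqF.
    rewrite [in leLHS]tE powRM ?divr_ge0 ?mulr_ge0 ?(ltW s0)//.
    apply: ler_wpM2l; first exact: powR_ge0.
    rewrite (_ : t / 2 = (t / (2 * s)) * s); last first.
      by rewrite invfM -!mulrA mulVf ?mulr1// gt_eqF.
    rewrite expRM; apply: ge0_ler_powR; rewrite ?nnegrE ?expR_ge0 ?(ltW s0)//.
      by rewrite divr_ge0 ?mulr_ge0 ?(ltW s0).
    by apply: le_trans (expR_ge1Dx _); rewrite lerDr.
  rewrite /C mulrACA divff// mul1r.
  apply: le_trans (ler_wpM2r (expR_ge0 _) ts) _.
  rewrite -mulrA -expRD; apply: ler_wpM2l; first exact: powR_ge0.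
  by rewrite ler_expR; lra.
have mE : measurable_fun [set: R] (EFin \o (exponential_pdf 2^-1 : R -> R)).
  by apply/measurable_EFinP; exact: measurable_exponential_pdf.
apply: (@le_lt_trans _ _ (\int[mu]_(t in `[0%R, +oo[)
    (C%:E * (exponential_pdf 2^-1 t)%:E))%E).
  apply: ge0_le_integral => //=.
  - by move=> t _; rewrite lee_fin mulr_ge0 ?powR_ge0 ?expR_ge0.
  - by apply/measurable_EFinP; exact: measurable_funTS (mGamma s).
  - by apply: measurable_funeM; exact: measurable_funTS.
  - by move=> t; rewrite in_itv/= andbT => t0; rewrite -EFinM lee_fin le1.
rewrite ge0_integralZl_EFin//=; last 2 first.
- by move=> t _; rewrite lee_fin exponential_pdf_ge0// ltW.
- exact: measurable_funTS.
apply: (@le_lt_trans _ _ (C%:E * 1)%E); last by rewrite mule1 ltry.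
rewrite lee_wpmul2l// -(integral_exponential_pdf h0).
apply: ge0_subset_integral => // t _.
by rewrite lee_fin exponential_pdf_ge0// ltW.
Qed.

Let GammaE s : 0 < s ->
  (\int[mu]_(t in `[0%R, +oo[) (t `^ s * expR (- t))%:E = (Gamma (s + 1))%:E)%E.
Proof.
move=> s0; rewrite /Gamma /Rintegral addrK fineK// ge0_fin_numE ?Gamma_fin//.
by apply: integral_ge0 => t _; rewrite lee_fin mulr_ge0 ?powR_ge0 ?expR_ge0.
Qed.

Let ball1 r y : 0 < r -> 0 <= y ->
  [set x : R | `|x| `^ r / r <= y] =
  `[- ((r * y) `^ r^-1), (r * y) `^ r^-1]%classic.
Proof.
move=> r0 y0; apply/seteqP; split => x /=; rewrite in_itv/= -ler_norml.
  rewrite ler_pdivrMr// mulrC => h.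
  have -> : `|x| = (`|x| `^ r) `^ r^-1.
    by rewrite -powRrM divff ?gt_eqF// powRr1.
  apply: ge0_ler_powR => //; rewrite ?nnegrE ?powR_ge0 ?invr_ge0 ?mulr_ge0 ?(ltW r0)//.
move=> h; rewrite ler_pdivrMr// mulrC.
have -> : r * y = ((r * y) `^ r^-1) `^ r.
  by rewrite -powRrM mulVf ?gt_eqF// powRr1// mulr_ge0 ?(ltW r0).
by apply: ge0_ler_powR => //; rewrite ?nnegrE ?powR_ge0 ?(ltW r0).
Qed.

Lemma integral_pgauss r : 0 < r ->
  (\int[mu]_x (expR (- (`|x| `^ r / r)))%:E =
   (2 * r `^ r^-1 * Gamma (r^-1 + 1))%:E)%E.
Proof.
move=> r0; have ri0 : 0 < r^-1 by rewrite invr_gt0.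
pose A : set (R * R) := (fun z => z.2 - `|z.1| `^ r / r) @^-1` `[0, +oo[.
have mA : measurable A.
  rewrite -[A]setTI; apply: (_ : measurable_fun setT (fun z : R * R => _)) => //.
  apply: measurable_funB => //; apply: measurable_funM => //.
  apply: (measurableT_comp (measurable_powR _)).
  exact: measurableT_comp.
have AE x y : (x, y) \in A = (`|x| `^ r / r <= y).
  by rewrite -subr_ge0; apply/idP/idP; rewrite inE /A/= in_itv/= andbT.
pose f (z : R * R) := (\1_A z * expR (- z.2))%:E.
have f0 z : (0 <= f z)%E by rewrite lee_fin mulr_ge0 ?expR_ge0.
have mf : measurable_fun [set: R * R] f.
  apply/measurable_EFinP; apply: measurable_funM => //.
  apply: measurableT_comp => //; apply: measurable_funN => //.
transitivity (\int[mu]_x \int[mu]_y f (x, y))%E.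
  apply: eq_integral => x _; rewrite -tail integral_mkcond.
  apply: eq_integral => y _; rewrite patchE /f indicE AE/= mem_setE in_itv/= andbT.
  by case: ifP => _; rewrite ?mul1r ?mul0r.
rewrite fubini_tonelli//.
have K0 : 0 <= 2 * r `^ r^-1 by rewrite mulr_ge0 ?powR_ge0.
rewrite EFinM -GammaE// -ge0_integralZl_EFin//=; last 2 first.
- by move=> t _; rewrite lee_fin mulr_ge0 ?powR_ge0 ?expR_ge0.
- by apply/measurable_EFinP; exact: measurable_funTS (mGamma _).
rewrite [RHS]integral_mkcond; apply: eq_integral => y _.
rewrite patchE mem_setE in_itv/= andbT.
case: (leP 0 y) => y0; last first.
  rewrite integral0_eq// => x _; rewrite /f indicE AE.
  rewrite leNgt (lt_le_trans y0) ?mul0r// divr_ge0 ?powR_ge0 ?(ltW r0)//.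
transitivity (\int[mu]_x ((expR (- y))%:E *
    (\1_`[- ((r * y) `^ r^-1), (r * y) `^ r^-1]%classic x)%:E))%E.
  apply: eq_integral => x _; rewrite -EFinM mulrC /f !indicE AE -ball1//.
  by congr ((_ : bool)%:R * _)%:E; apply/idP/idP; rewrite inE.
rewrite ge0_integralZl_EFin ?expR_ge0//=; last first.
  by apply/measurable_EFinP; exact: measurable_indic.
rewrite integral_indic// setIT /= lebesgue_measure_itv/= lte_fin.
have c0 : 0 <= (r * y) `^ r^-1 by exact: powR_ge0.
rewrite powRM ?(ltW r0)// in c0 *.
case: ifPn => [_|]; first by rewrite -EFinB -!EFinM; congr _%:E; ring.
rewrite -leNgt => c1; rewrite mule0 -EFinM; congr _%:E.
by rewrite -mulrA (mulrA (r `^ _)) (_ : r `^ r^-1 * y `^ r^-1 = 0) ?mul0r ?mulr0//; lra.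
Qed.

Lemma integral_pgauss_gt0 r : 0 < r -> 0 < 2 * r `^ r^-1 * Gamma (r^-1 + 1).
Proof.
move=> r0; rewrite -lte_fin -integral_pgauss//.
apply: (@lt_le_trans _ _ (\int[mu]_(x in `[0%R, 1%R]) (expR (- r^-1))%:E)%E).
  rewrite integral_cst//= lebesgue_measure_itv/= lte_fin ltr01.
  by rewrite -EFinB -EFinM lte_fin subr0 mulr1 expR_gt0.
apply: (@le_trans _ _ (\int[mu]_(x in `[0%R, 1%R]) (expR (- (`|x| `^ r / r)))%:E)%E).
  apply: ge0_le_integral => //=.
  - by apply/measurable_EFinP; exact: measurable_funTS (mpgauss _).
  - move=> x; rewrite in_itv/= => /andP[x0 x1].
    rewrite lee_fin ler_expR lerN2 -[leRHS]mul1r ler_wpM2r ?invr_ge0 ?(ltW r0)//.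
    have := @ge0_ler_powR _ _ (ltW r0) `|x| 1; rewrite powR1 ger0_norm//.
    by apply; rewrite ?nnegrE.
apply: ge0_subset_integral => //.
by apply/measurable_EFinP; exact: mpgauss.
Qed.

End pgauss_normalization.

(* The law gamma_p, for p in ]0, +oo]; the value for p <= 0 (the uniform law on
   [-1, 1]) is junk that keeps pgauss_prob p a probability for every p. *)
Definition pgauss_pdf {R : realType} (p : \bar R) (x : R) : R :=
  match p with
  | r%:E => if 0 < r
      then (2 * r `^ r^-1 * Gamma (r^-1 + 1))^-1 * expR (- (`|x| `^ r / r))
      else 2^-1 * \1_`[-1, 1] x
  | _ => 2^-1 * \1_`[-1, 1] x
  end.

Definition pgauss_prob {R : realType} (p : \bar R) : set R -> \bar R :=
  fun A => (\int[lebesgue_measure]_(x in A) (pgauss_pdf p x)%:E)%E.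

Section pgauss_prob.
Context {R : realType}.
Variable p : \bar R.
Local Notation mu := (@lebesgue_measure R).

Lemma pgauss_pdf_ge0 (x : R) : 0 <= pgauss_pdf p x.
Proof.
have i0 : 0 <= 2^-1 * \1_`[-1, 1] x :> R by rewrite mulr_ge0.
rewrite /pgauss_pdf; case: p => [r||]//; case: ifPn => // r0.
by rewrite mulr_ge0 ?expR_ge0// invr_ge0 ltW// integral_pgauss_gt0.
Qed.

Lemma measurable_pgauss_pdf : measurable_fun [set: R] (pgauss_pdf p).
Proof.
have mi : measurable_fun [set: R] (fun x => 2^-1 * \1_`[-1, 1] x : R).
  by apply: measurable_funM => //; exact: measurable_indic.
rewrite /pgauss_pdf; case: p => [r||]//; case: (ltP 0 r) => // r0.
apply: measurable_funM => //; apply: measurableT_comp => //.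
apply: measurable_funN; apply: measurable_funM => //.
exact: (measurableT_comp (measurable_powR _)).
Qed.

Lemma integral_pgauss_pdf : (\int[mu]_x (pgauss_pdf p x)%:E = 1)%E.
Proof.
have i1 : (\int[mu]_x (2^-1 * \1_`[(-1)%R, 1%R] x)%:E = 1)%E.
  under eq_integral do rewrite EFinM.
  rewrite ge0_integralZl_EFin//=; last first.
    by apply/measurable_EFinP; exact: measurable_indic.
  rewrite integral_indic// setIT /= lebesgue_measure_itv/= lte_fin.
  by rewrite ifT ?gtrN// -EFinB -EFinM opprK mulVf.
rewrite /pgauss_pdf; case: p => [r||]//; case: (ltP 0 r) => // r0.
under eq_integral do rewrite EFinM.
rewrite ge0_integralZl_EFin//=; last 2 first.
- apply/measurable_EFinP; apply: measurableT_comp => //.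
  apply: measurable_funN; apply: measurable_funM => //.
  exact: (measurableT_comp (measurable_powR _)).
- by rewrite invr_ge0 ltW// integral_pgauss_gt0.
by rewrite integral_pgauss// -EFinM mulVf// gt_eqF// integral_pgauss_gt0.
Qed.

Let pgauss0 : pgauss_prob p set0 = 0%E.
Proof. by rewrite /pgauss_prob integral_set0. Qed.

Let pgauss_ge0 A : (0 <= pgauss_prob p A)%E.
Proof.
by apply: integral_ge0 => x _; rewrite lee_fin pgauss_pdf_ge0.
Qed.

Let pgauss_sigma_additive : semi_sigma_additive (pgauss_prob p).
Proof.
move=> /= F mF tF mUF; rewrite /pgauss_prob; apply: cvg_toP.
  apply: ereal_nondecreasing_is_cvgn => m n mn.
  apply: lee_sum_nneg_natr => // k _ _; apply: integral_ge0 => /= x Fkx.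
  by rewrite lee_fin pgauss_pdf_ge0.
rewrite ge0_integral_bigcup//=.
- apply/measurable_funTS/measurableT_comp => //.
  exact: measurable_pgauss_pdf.
- by move=> x _; rewrite lee_fin pgauss_pdf_ge0.
Qed.

HB.instance Definition _ := isMeasure.Build _ _ _ (pgauss_prob p)
  pgauss0 pgauss_ge0 pgauss_sigma_additive.

Let pgauss_setT : pgauss_prob p [set: R] = 1%E.
Proof. exact: integral_pgauss_pdf. Qed.

HB.instance Definition _ :=
  @Measure_isProbability.Build _ _ R (pgauss_prob p) pgauss_setT.

End pgauss_prob.

Definition lpnorm {R : realType} (p : \bar R) (n : nat) (x : 'cV[R]_n) : R :=
  match p with
  | r%:E => (\sum_(i < n) `|x i 0| `^ r) `^ r^-1
  | +oo%E => \big[Num.max/0]_(i < n) `|x i 0|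
  | -oo%E => 0
  end.

Definition col_of_tuple {R : realType} (n : nat) (t : n.-tuple R) : 'cV[R]_n :=
  \col_i tnth t i.

Definition lpball {R : realType} (p : \bar R) (n : nat) : set (n.-tuple R) :=
  [set t | lpnorm p (col_of_tuple t) <= 1].
Arguments lpball {R} p n.

Definition uniform_on {R : realType} d (T : measurableType d)
    (P : probability T R) (n : nat) (Z : {RV P >-> n.-tuple R})
    (B : set (n.-tuple R)) : Prop :=
  forall A : set (n.-tuple R), measurable A ->
    distribution P Z A = (lebesgue_tuple R n (A `&` B) / lebesgue_tuple R n B)%E.

Definition pgauss_moment {R : realType} (p : \bar R) (q : R) : R :=
  fine ('E_(pgauss_prob p)[(fun x : R => `|x| `^ q)%R])%E.

Definition pgauss_var {R : realType} (p : \bar R) (q : R) : R :=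
  fine ('V_(pgauss_prob p)[(fun x : R => `|x| `^ q)%R])%E.

(* The first exponent may be infinite, for the convention C_oo(oo, r) = 0. *)
Definition pgauss_cov {R : realType} (p q : \bar R) (r : R) : R :=
  match q with
  | s%:E => fine (covariance (pgauss_prob p)
      (fun x : R => `|x| `^ s) (fun x : R => `|x| `^ r))
  | _ => 0
  end.

(* Weak convergence of laws, tested on bounded continuous functions; each Y n
   may live on its own probability space. *)
Definition cvg_in_distribution {R : realType} (d : nat -> measure_display)
    (T : forall n, measurableType (d n)) (P : forall n, probability (T n) R)
    (Y : forall n, T n -> R) (nu : probability (measurableTypeR R) R) : Prop :=
  (forall n, measurable_fun [set: T n] (Y n)) /\
  (forall f : R -> R, continuous f -> (exists M, forall x, `|f x| <= M) ->
    \int[P n]_w f (Y n w) @[n --> \oo] --> \int[nu]_x f x).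

(* Main.v *)
(* For p < oo, write exp (- u) as the integral of exp (- y) over y >= u: a function
   that is homogeneous of degree 0 then has the same mean under the uniform law
   on the l_p ball as under n independent p-Gaussians X_i. As P(|Z_n|_p <= c) = c^n,
   the radius of Z_n may be replaced by 1, and the normalized norm becomes
   (1 + A)^(1/q) (1 + B)^(-1/p), where A is the mean of |X_i|^q / M - 1 with weights
   proportional to sigma_i^(-q), and B the plain mean of |X_i|^p - 1. A Taylor
   expansion linearizes this expression. The weights sigma_i^(-q), normalized to
   unit l_2 norm, are uniformly small by Noether's condition, so Lindeberg's
   swapping argument applies to the linear part; its Gaussian is gamma_2, and weak
   convergence need only be tested on rescaled cubic splines. For p = oo the
   coordinates of Z_n are themselves independent and B = 0. *)
Require Import Defs.
From HB Require Import structures.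
From mathcomp Require Import all_boot all_order all_algebra.
From mathcomp Require Import all_classical all_reals all_analysis.
From mathcomp Require Import measurable_realfun ring lra.

Set Implicit Arguments.
Unset Strict Implicit.
Unset Printing Implicit Defensive.

Import Order.TTheory GRing.Theory Num.Theory.
Import numFieldNormedType.Exports.

Local Open Scope classical_set_scope.
Local Open Scope ring_scope.

(** * Lebesgue and product measures on tuples *)

(** All errors are measured by one small parameter [e], the square root of Noether's ratio, which
    bounds the normalized weights [a i]. As the squares [a i ^+ 2] sum to 1, the prefactor
    [rho = \sum_i a i] satisfies [1 <= e * rho], [rho ^+ 2 <= n] and [rho / n <= e]. The first and
    last make the Taylor remainder, of mean order [1 / rho ^+ 2 + 1 / n], negligible even after
    multiplication by [rho]. The last also allows the radius to be replaced by 1: its distance to 1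
    is of order [1 / n], and it too is multiplied by [rho]. The middle one is Cauchy-Schwarz and
    gives [G <= 1]. The target law is described by a density, so the limit variance has to be shown
    positive; this is where [p <> q] or [G < 1] enters. No value of the Gamma function and no volume
    of a ball is computed. Normalizing constants are identified by testing an identity on the
    constant 1, and the moments of the p-Gaussian law come from comparing two functions that
    touch. *)

Section lebesgue_affine.
Context {R : realType}.
Local Notation mu := (@lebesgue_measure R).
Local Open Scope ereal_scope.

Let aff (a b : R) : measurableTypeR R -> measurableTypeR R :=
  fun x => (a * x + b)%R.

Let measurable_aff a b : measurable_fun setT (aff a b).
Proof. by apply: measurable_funD => //; exact: measurable_funM. Qed.

(** Both sides are measures in [A], and uniqueness of Lebesgue measure reduces their equality to
    half-open intervals, where it is arithmetic. *)
Lemma lebesgue_measure_affine (a b : R) (A : set R) : (0 < a)%R ->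
  measurable A -> mu A = a%:E * mu ((fun x => a * x + b)%R @^-1` A).
Proof.
move=> a0 mA.
pose nu : {measure set (measurableTypeR R) -> \bar R} :=
  mscale (NngNum (ltW a0)) (pushforward mu (aff a b)).
rewrite (@lebesgue_measure_unique R (nu (measurable_aff a b)))//= => _ [[c d]] _ <-.
rewrite /nu /= /mscale /= /pushforward.
have -> : aff a b @^-1` `]c, d]%classic =
    `](c - b) / a, (d - b) / a]%classic%R.
  apply/seteqP; split => x /=; rewrite !in_itv/= /aff => /andP[h1 h2];
  by move: h1 h2; rewrite ltr_pdivrMr// ler_pdivlMr// => h1 h2; apply/andP; split; lra.
rewrite !lebesgue_measure_itv/= !lte_fin ltr_pM2r ?invr_gt0// ltrD2r.
case: ifP => _; last by rewrite mule0.
rewrite -!EFinB -EFinM; congr _%:E.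
by field; rewrite gt_eqF.
Qed.

Lemma ge0_integral_affine (a b : R) (f : R -> \bar R) : (0 < a)%R ->
  measurable_fun setT f -> (forall x, 0 <= f x) ->
  \int[mu]_x f x = a%:E * \int[mu]_x f (a * x + b)%R.
Proof.
move=> a0 mf f0.
pose nu : {measure set (measurableTypeR R) -> \bar R} :=
  mscale (NngNum (ltW a0)) (pushforward mu (aff a b)).
rewrite (eq_measure_integral (nu (measurable_aff a b))); last first.
  by move=> A mA _; exact: lebesgue_measure_affine.
rewrite ge0_integral_mscale//; congr *%E.
by rewrite ge0_integral_pushforward.
Qed.

End lebesgue_affine.

Section tuple_measure.
Context {R : realType}.
Local Open Scope ereal_scope.

Lemma ge0_integral_lebesgue_tupleS n (f : n.+1.-tuple R -> \bar R) :
  measurable_fun setT f -> (forall t, 0 <= f t) ->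
  \int[lebesgue_tuple R n.+1]_t f t =
  \int[@lebesgue_measure R]_x \int[lebesgue_tuple R n]_t f (tuple_cons (x, t)).
Proof.
move=> mf f0.
(* A conversion by the definition of [lebesgue_cons]; it exposes the pushforward of a product
   measure, to which Tonelli applies. *)
rewrite [LHS](_ : _ = \int[pushforward (@lebesgue_measure R \x lebesgue_tuple R n)
   (@tuple_cons R n)]_t f t) //.
rewrite ge0_integral_pushforward//=; last exact: measurable_tuple_cons.
rewrite preimage_setT.
have := @fubini_tonelli1 _ _ _ _ R (@lebesgue_measure R) (lebesgue_tuple R n)
  (f \o @tuple_cons R n) => /=; apply => //.
by apply: measurableT_comp => //; exact: measurable_tuple_cons.
Qed.

Lemma ge0_integral_lebesgue_tuple0 (f : 0.-tuple R -> \bar R) :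
  measurable_fun setT f -> (forall t, 0 <= f t) ->
  \int[lebesgue_tuple R 0]_t f t = f [tuple].
Proof. by move=> mf f0; rewrite integral_dirac//= diracT mul1e. Qed.

Definition tuple_scale n (c : R) (t : n.-tuple R) : n.-tuple R :=
  map_tuple ( *%R c) t.

Lemma tnth_tuple_scale n c (t : n.-tuple R) i :
  tnth (tuple_scale c t) i = (c * tnth t i)%R.
Proof. by rewrite tnth_map. Qed.

Lemma tuple_scale_cons n c x (t : n.-tuple R) :
  tuple_scale c (tuple_cons (x, t)) = tuple_cons ((c * x)%R, tuple_scale c t).
Proof. exact: val_inj. Qed.

Lemma measurable_tuple_scale n c :
  measurable_fun setT (@tuple_scale n c).
Proof.
apply/measurable_fun_tnthP => i.
rewrite (_ : _ \o _ = fun t => (c * tnth t i)%R); last first.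
  by apply/funext => t /=; rewrite tnth_map.
apply: measurable_funM => //; exact: measurable_tnth.
Qed.

Lemma measurable_tuple_consr n (x : R) :
  measurable_fun setT (fun t : n.-tuple R => tuple_cons (x, t)).
Proof.
apply: (measurableT_comp (@measurable_tuple_cons R n)).
exact: measurable_pair1.
Qed.

(** One affine substitution per coordinate, each contributing a factor [c]. *)
Lemma ge0_integral_lebesgue_tuple_scale n (c : R) (f : n.-tuple R -> \bar R) :
  (0 < c)%R -> measurable_fun setT f -> (forall t, 0 <= f t) ->
  \int[lebesgue_tuple R n]_t f t =
  (c ^+ n)%:E * \int[lebesgue_tuple R n]_t f (tuple_scale c t).
Proof.
move=> c0; elim: n f => [|n IH] f mf f0.
  rewrite expr0 mul1e !ge0_integral_lebesgue_tuple0//; last first.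
    by apply: measurableT_comp => //; exact: measurable_tuple_scale.
  by congr f; apply: val_inj.
have mfc x : measurable_fun setT (fun t => f (tuple_cons (x, t))).
  by apply: measurableT_comp => //; exact: measurable_tuple_consr.
rewrite !ge0_integral_lebesgue_tupleS//; last first.
  by apply: measurableT_comp => //; exact: measurable_tuple_scale.
rewrite (@ge0_integral_affine _ c 0)//; last 2 first.
- apply: (measurable_fun_fubini_tonelli_F (fun z => f (tuple_cons z))) => //=.
  by apply: measurableT_comp => //; exact: measurable_tuple_cons.
- by move=> x; apply: integral_ge0.
under eq_integral do rewrite addr0 IH//.
rewrite ge0_integralZl//=; last 3 first.
- apply: (measurable_fun_fubini_tonelli_F
    (fun z => f (tuple_cons ((c * z.1)%R, tuple_scale c z.2)))) => //=.
  apply: measurableT_comp => //.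
  apply: measurableT_comp; first exact: measurable_tuple_cons.
  apply: measurable_fun_pair => /=; first exact: measurable_funM.
  by apply: measurableT_comp => //; exact: measurable_tuple_scale.
- by move=> x _; apply: integral_ge0.
- by rewrite lee_fin exprn_ge0// ltW.
rewrite muleA -EFinM -exprS; congr *%E.
by apply: eq_integral => x _; apply: eq_integral => t _; rewrite tuple_scale_cons.
Qed.

End tuple_measure.

Section density.
Local Open Scope ereal_scope.
Context d (T : measurableType d) {R : realType}.
Variables (mu nu : {measure set T -> \bar R}) (g : T -> R).
Hypotheses (mg : measurable_fun setT g) (g0 : forall x, (0 <= g x)%R).
Hypothesis nuE : forall A, measurable A -> nu A = \int[mu]_(x in A) (g x)%:E.

Let mEg : measurable_fun setT (EFin \o g).
Proof. exact/measurable_EFinP. Qed.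

Let Eg0 x : 0 <= (g x)%:E. Proof. by rewrite lee_fin. Qed.

Import HBNNSimple.

Let density_indic E : measurable E ->
  \int[nu]_x (\1_E x)%:E = \int[mu]_x ((\1_E x)%:E * (g x)%:E).
Proof.
move=> mE; rewrite integral_indic//= setIT nuE// integral_mkcond.
apply: eq_integral => x _; rewrite patchE indicE.
by case: ifP => _; rewrite ?mul1e ?mul0e.
Qed.

Let density_nnsfun (f : {nnsfun T >-> R}) :
  \int[nu]_x (f x)%:E = \int[mu]_x ((f x)%:E * (g x)%:E).
Proof.
under [LHS]eq_integral do rewrite fimfunE -fsumEFin//.
rewrite ge0_integral_fsum//; last 2 first.
  - by move=> r; exact/measurable_EFinP/measurable_funM.
  - by move=> r x _; rewrite nnfun_muleindic_ge0.
under [RHS]eq_integral.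
  move=> x _; rewrite fimfunE -fsumEFin// muleC ge0_mule_fsumr; last first.
    by move=> r; rewrite nnfun_muleindic_ge0.
  over.
rewrite [RHS]ge0_integral_fsum//; last 2 first.
  - by move=> r; apply: emeasurable_funM => //; exact/measurable_EFinP/measurable_funM.
  - by move=> r x _; rewrite mule_ge0// nnfun_muleindic_ge0.
apply: eq_fsbigr => r _.
(* The constant [r] may leave the integral only if it is nonnegative; a negative [r] is not a value
   of [f], so its term vanishes. *)
have [r0|r0] := ltP r 0%R.
  have fr x : \1_(f @^-1` [set r]) x = 0%R :> R.
    rewrite indicE memNset//= => fxr.
    by have : (0 <= f x)%R by []; rewrite leNgt fxr r0.
  rewrite !integral0_eq// => x _; rewrite fr mulr0 ?mule0//.
under eq_integral do rewrite EFinM.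
rewrite ge0_integralZl//; last exact/measurable_EFinP.
rewrite density_indic// -ge0_integralZl//.
- by apply: eq_integral => x _; rewrite EFinM muleA muleC.
- by apply: emeasurable_funM => //; exact/measurable_EFinP.
- by move=> x _; rewrite mule_ge0// lee_fin.
Qed.

(** The usual ladder: indicators, nonnegative simple functions, then monotone limits along
    [nnsfun_approx]. *)
Lemma ge0_integral_density (f : T -> \bar R) :
  measurable_fun setT f -> (forall x, 0 <= f x) ->
  \int[nu]_x f x = \int[mu]_x (f x * (g x)%:E).
Proof.
move=> mf f0; pose f_ := nnsfun_approx measurableT mf.
transitivity (limn (fun n => \int[nu]_x (f_ n x)%:E)).
  rewrite -monotone_convergence//=.
  - apply: eq_integral => x _; apply/esym/cvg_lim => //=.
    exact: cvg_nnsfun_approx.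
  - by move=> n; exact/measurable_EFinP.
  - by move=> n x _; rewrite lee_fin.
  - by move=> x _ a b ab; rewrite lee_fin; exact/lefP/nd_nnsfun_approx.
transitivity (limn (fun n => \int[mu]_x ((f_ n x)%:E * (g x)%:E))).
  by congr (limn _); apply/funext => n; exact: density_nnsfun.
rewrite -monotone_convergence//=.
- apply: eq_integral => x _; apply/cvg_lim => //=.
  apply: cvgeZr => //.
  exact: cvg_nnsfun_approx.
- by move=> n; apply: emeasurable_funM => //; exact/measurable_EFinP.
- by move=> n x _; rewrite mule_ge0// lee_fin.
- move=> x _ a b ab; rewrite lee_wpmul2r// lee_fin; exact/lefP/nd_nnsfun_approx.
Qed.

End density.

(* [lebesgue_measure] lives on [measurableTypeR R], whose display is not the
   one of [R]; the identity transports it. *)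
Lemma ge0_integral_density_lebesgue {R : realType}
    (nu : {measure set R -> \bar R}) (g : R -> R) :
  measurable_fun setT g -> (forall x, 0 <= g x) ->
  (forall A, measurable A ->
    nu A = \int[@lebesgue_measure R]_(x in A) (g x)%:E)%E ->
  forall f : R -> \bar R, measurable_fun setT f -> (forall x, 0 <= f x)%E ->
  (\int[nu]_x f x = \int[@lebesgue_measure R]_x (f x * (g x)%:E))%E.
Proof.
move=> mg g0 nuE f mf f0.
have mid : measurable_fun [set: measurableTypeR R] (id : measurableTypeR R -> R).
  by move=> _ A mA; rewrite setTI.
pose lebR : {measure set R -> \bar R} :=
  pushforward (@lebesgue_measure R) (id : measurableTypeR R -> R).
have lebE (D : set R) h : measurable D -> measurable_fun D h ->
    (forall x, 0 <= h x)%E ->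
    (\int[lebR mid]_(x in D) h x = \int[@lebesgue_measure R]_(x in D) h x)%E.
  by move=> mD mh h0; rewrite ge0_integral_pushforward.
have mEg : measurable_fun setT (EFin \o g) by exact/measurable_EFinP.
rewrite (@ge0_integral_density _ _ _ (lebR mid) nu g)//.
  apply: lebE => //; first exact: emeasurable_funM.
  by move=> x; rewrite mule_ge0// lee_fin.
move=> A mA; rewrite nuE// lebE//; first exact: measurable_funTS.
Qed.

Section iid.
Local Open Scope ereal_scope.
Context {R : realType}.
Variable mu : probability R R.

Section iid_cons.
Variables (n : nat) (P : probability (n.-tuple R) R).

Definition iid_cons : set (n.+1.-tuple R) -> \bar R :=
  pushforward (mu \x P) (@tuple_cons R n).

Let m := @measurable_tuple_cons R n.

Let iid_cons0 : iid_cons set0 = 0.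
Proof.
pose nu : {measure set _ -> \bar R} := pushforward (mu \x P) (@tuple_cons R n).
exact: (measure0 (nu m)).
Qed.

Let iid_cons_ge0 A : 0 <= iid_cons A.
Proof. exact: measure_ge0. Qed.

Let iid_cons_sigma_additive : semi_sigma_additive iid_cons.
Proof.
pose nu : {measure set _ -> \bar R} := pushforward (mu \x P) (@tuple_cons R n).
exact: (@measure_semi_sigma_additive _ _ _ (nu m)).
Qed.

HB.instance Definition _ := isMeasure.Build _ _ _ iid_cons
  iid_cons0 iid_cons_ge0 iid_cons_sigma_additive.

Let iid_consT : iid_cons setT = 1.
Proof.
rewrite /iid_cons /pushforward preimage_setT -setXTT product_measure1E//.
transitivity (1 * 1 : \bar R); last by rewrite mule1.
by congr *%E; exact: probability_setT.
Qed.

HB.instance Definition _ :=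
  @Measure_isProbability.Build _ _ R iid_cons iid_consT.

End iid_cons.

(** Built one coordinate at a time exactly like [lebesgue_tuple], so that the two measures can be
    compared by induction on [n]. *)
Fixpoint iid n : probability (n.-tuple R) R :=
  if n is m.+1 then iid_cons (iid m) else \d_([tuple] : 0.-tuple R).

Lemma ge0_integral_iidS n (f : n.+1.-tuple R -> \bar R) :
  measurable_fun setT f -> (forall t, 0 <= f t) ->
  \int[iid n.+1]_t f t = \int[mu]_x \int[iid n]_t f (tuple_cons (x, t)).
Proof.
move=> mf f0.
rewrite [LHS](_ : _ = \int[pushforward (mu \x iid n) (@tuple_cons R n)]_t f t) //.
rewrite ge0_integral_pushforward//=; last exact: measurable_tuple_cons.
rewrite preimage_setT.
have := @fubini_tonelli1 _ _ _ _ R mu (iid n) (f \o @tuple_cons R n) => /=; apply => //.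
by apply: measurableT_comp => //; exact: measurable_tuple_cons.
Qed.

Lemma integral_iid0 (f : 0.-tuple R -> \bar R) :
  measurable_fun setT f -> \int[iid 0]_t f t = f [tuple].
Proof. by move=> mf; rewrite integral_dirac//= diracT mul1e. Qed.

Lemma integral_iidS n (f : n.+1.-tuple R -> \bar R) :
  (iid n.+1).-integrable setT f ->
  \int[iid n.+1]_t f t = \int[mu]_x \int[iid n]_t f (tuple_cons (x, t)).
Proof.
move=> intf; have mf := measurable_int _ intf.
have intc : (mu \x iid n).-integrable setT (f \o @tuple_cons R n).
  apply/integrableP; split.
    by apply: measurableT_comp => //; exact: measurable_tuple_cons.
  move/integrableP : intf => [_]; apply: le_lt_trans.
  rewrite [leRHS](_ : _ = \int[pushforward (mu \x iid n) (@tuple_cons R n)]_t `|f t|) //.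
  rewrite ge0_integral_pushforward//=; first exact: measurable_tuple_cons.
  exact: measurableT_comp.
rewrite [LHS](_ : _ = \int[pushforward (mu \x iid n) (@tuple_cons R n)]_t f t) //.
rewrite integral_pushforward//=; last exact: measurable_tuple_cons.
rewrite preimage_setT.
by have := integral12_prod_meas1 intc => /= <-.
Qed.

Variable g : R -> R.
Hypotheses (mg : measurable_fun setT g) (g0 : forall x, (0 <= g x)%R).
Hypothesis muE : forall A, measurable A ->
  mu A = \int[@lebesgue_measure R]_(x in A) (g x)%:E.

(** The two recursions run in parallel: each coordinate is integrated against [mu], hence against
    [g], and the factors collect into the product. *)
Lemma ge0_integral_iid_density n (f : n.-tuple R -> \bar R) :
  measurable_fun setT f -> (forall t, 0 <= f t) ->
  \int[iid n]_t f t =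
  \int[lebesgue_tuple R n]_t (f t * (\prod_(i < n) g (tnth t i))%:E).
Proof.
have mprod k : measurable_fun setT
    (fun t : k.-tuple R => (\prod_(i < k) g (tnth t i))%:E).
  apply/measurable_EFinP; apply: measurable_prod => i _.
  by apply: measurableT_comp => //; exact: measurable_tnth.
have prod0 k (t : k.-tuple R) : 0 <= (\prod_(i < k) g (tnth t i))%:E.
  by rewrite lee_fin prodr_ge0.
elim: n f => [|n IH] f mf f0.
  rewrite integral_iid0// ge0_integral_lebesgue_tuple0//.
  - by rewrite big_ord0 mule1.
  - by apply: emeasurable_funM => //; exact: mprod.
  - by move=> t; rewrite mule_ge0.
have mfc x : measurable_fun setT (fun t => f (tuple_cons (x, t))).
  by apply: measurableT_comp => //; exact: measurable_tuple_consr.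
rewrite ge0_integral_iidS// ge0_integral_lebesgue_tupleS; last 2 first.
- by apply: emeasurable_funM => //; exact: mprod.
- by move=> t; rewrite mule_ge0.
rewrite (ge0_integral_density_lebesgue mg g0 muE); last 2 first.
- apply: (measurable_fun_fubini_tonelli_F (f \o @tuple_cons R n)) => //=.
  by apply: measurableT_comp => //; exact: measurable_tuple_cons.
- by move=> x; apply: integral_ge0.
apply: eq_integral => x _; rewrite IH// -ge0_integralZr//; last 3 first.
- by apply: emeasurable_funM => //; exact: mprod.
- by move=> t _; rewrite mule_ge0.
- by rewrite lee_fin.
apply: eq_integral => t _; rewrite -muleA -EFinM big_ord_recl mulrC; congr (_ * (_ * _)%:E).
by apply: eq_bigr => i _; rewrite !(tnth_nth 0%R).
Qed.

End iid.

(** * Lindeberg's swapping argument *)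

Section bounded_expectation.
Context d {T : measurableType d} {R : realType}.
Variable P : probability T R.
Implicit Types f g : T -> R.

Lemma bounded_integrable f M : measurable_fun setT f -> (forall x, `|f x| <= M) ->
  P.-integrable setT (EFin \o f).
Proof.
move=> mf fM; apply: measurable_bounded_integrable => //.
  by apply: (le_lt_trans (probability_le1 P measurableT)); rewrite ltry.
exists M; split; first exact: num_real.
by move=> y My x _; exact: le_trans (fM x) (ltW My).
Qed.

Lemma Rintegral_cst1 (r : R) : \int[P]_x (r : R) = r.
Proof.
rewrite Rintegral_cst//= (_ : P _ = 1%E) ?mulr1//; exact: probability_setT.
Qed.

Lemma normr_Rintegral_le f M : measurable_fun setT f -> (forall x, `|f x| <= M) ->
  `|\int[P]_x f x| <= M.
Proof.
move=> mf fM; have fi := bounded_integrable mf fM.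
apply: (le_trans (le_normr_Rintegral _ fi)) => //.
rewrite -[leRHS]Rintegral_cst1; apply: le_Rintegral => //.
- exact: integrable_norm.
- exact: finite_measure_integrable_cst.
Qed.

Lemma normr_RintegralB_le f g h : P.-integrable setT (EFin \o f) ->
  P.-integrable setT (EFin \o g) -> P.-integrable setT (EFin \o h) ->
  (forall x, `|f x - g x| <= h x) ->
  `|\int[P]_x f x - \int[P]_x g x| <= \int[P]_x h x.
Proof.
move=> fi gi hi fgh; rewrite -RintegralB//.
have fgi : P.-integrable setT (EFin \o (fun x => f x - g x)).
  exact: (integrableB measurableT fi gi).
apply: (le_trans (le_normr_Rintegral _ fgi)) => //.
apply: le_Rintegral => //; exact: integrable_norm.
Qed.

Lemma EFin_Rintegral f : P.-integrable setT (EFin \o f) ->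
  (\int[P]_x (f x)%:E)%E = (\int[P]_x f x)%:E.
Proof. by move=> fi; rewrite /Rintegral fineK// integrable_fin_num. Qed.

End bounded_expectation.

Section bounded_lipschitz.
Context {R : realType}.
Implicit Types (f : R -> R) (M C : R).

(** One constant serves for both bounds. The class gives measurability and integrability for free
    and is preserved, with the same constant, by averaging over a random shift. *)
Definition bounded_lipschitz M f :=
  (forall x, `|f x| <= M) /\ (forall x y, `|f x - f y| <= M * `|x - y|).

Lemma bounded_lipschitz_continuous M f : bounded_lipschitz M f -> continuous f.
Proof.
move=> [fM fL] x; apply/cvgrPdist_le => /= e e0.
have M0 : 0 <= M by apply: le_trans (fM x).
have M10 : 0 < M + 1 by rewrite ltr_wpDl.
near=> y; apply: (le_trans (fL _ _)).
apply: (@le_trans _ _ ((M + 1) * `|x - y|)); first by rewrite ler_wpM2r// lerDl.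
rewrite -ler_pdivlMl// mulrC.
near: y; apply: cvgr_dist_le => //; rewrite divr_gt0//.
Unshelve. all: by end_near. Qed.

Lemma bounded_lipschitz_measurable M f :
  bounded_lipschitz M f -> measurable_fun setT f.
Proof.
by move=> /bounded_lipschitz_continuous cf; exact: continuous_measurable_fun.
Qed.

Lemma bounded_lipschitz_integrable M f d (T : measurableType d)
    (P : probability T R) (X : T -> R) : bounded_lipschitz M f ->
  measurable_fun setT X -> P.-integrable setT (EFin \o (f \o X)).
Proof.
move=> fM mX; apply: (@bounded_integrable _ _ _ _ _ M); last by move=> x; exact: fM.1.
by apply: measurableT_comp => //; exact: bounded_lipschitz_measurable fM.
Qed.

Section average.
Context d (T : measurableType d) (P : probability T R) (X : T -> R).
Hypothesis mX : measurable_fun setT X.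

Let mXw w : measurable_fun setT (fun x => w + X x).
Proof. exact: measurable_funD. Qed.

Lemma bounded_lipschitz_shift_integrable M f w : bounded_lipschitz M f ->
  P.-integrable setT (EFin \o (fun x => f (w + X x))).
Proof. by move=> fM; apply: (bounded_lipschitz_integrable _ fM (mXw w)). Qed.

Lemma bounded_lipschitz_average M f : bounded_lipschitz M f ->
  bounded_lipschitz M (fun w => \int[P]_x f (w + X x)).
Proof.
move=> fM; split=> [w|w z].
  apply: normr_Rintegral_le => [|x]; last exact: fM.1.
  by apply: measurableT_comp => //; exact: bounded_lipschitz_measurable fM.
rewrite -[leRHS](Rintegral_cst1 P); apply: normr_RintegralB_le.
- exact: bounded_lipschitz_shift_integrable fM.
- exact: bounded_lipschitz_shift_integrable fM.
- exact: finite_measure_integrable_cst.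
- move=> x; apply: (le_trans (fM.2 _ _)).
  by rewrite (_ : w + X x - (z + X x) = w - z)//; ring.
Qed.

End average.

(** [f1] and [f2] play the first two derivatives of [f], but only a uniform Taylor bound is asked
    for. In this form the property passes under an integral without any differentiation. *)
Definition taylor2 M C f f1 f2 :=
  [/\ bounded_lipschitz M f, bounded_lipschitz M f1, bounded_lipschitz M f2 &
   forall w h, `|f (w + h) - (f w + h * f1 w + h ^+ 2 / 2 * f2 w)| <= C * `|h| ^+ 3].

Section taylor2_average.
Context d (T : measurableType d) (P : probability T R) (X : T -> R).
Hypothesis mX : measurable_fun setT X.

Lemma taylor2_average M C f f1 f2 : taylor2 M C f f1 f2 ->
  taylor2 M C (fun w => \int[P]_x f (w + X x)) (fun w => \int[P]_x f1 (w + X x))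
    (fun w => \int[P]_x f2 (w + X x)).
Proof.
move=> [fM f1M f2M fC]; split; try exact: bounded_lipschitz_average.
move=> w h.
have i0 := bounded_lipschitz_shift_integrable P mX w fM.
have i1 := bounded_lipschitz_shift_integrable P mX w f1M.
have i2 := bounded_lipschitz_shift_integrable P mX w f2M.
have i1' : P.-integrable setT (EFin \o (fun x => h * f1 (w + X x))).
  exact: (integrableZl measurableT h i1).
have i2' : P.-integrable setT (EFin \o (fun x => h ^+ 2 / 2 * f2 (w + X x))).
  exact: (integrableZl measurableT (h ^+ 2 / 2) i2).
have i01 : P.-integrable setT (EFin \o (fun x => f (w + X x) + h * f1 (w + X x))).
  exact: (integrableD measurableT i0 i1').
rewrite -!RintegralZl// -RintegralD// -RintegralD//.
rewrite -[leRHS](Rintegral_cst1 P); apply: normr_RintegralB_le.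
- exact: bounded_lipschitz_shift_integrable fM.
- exact: (integrableD measurableT i01 i2').
- exact: finite_measure_integrable_cst.
- by move=> x; rewrite (_ : w + h + X x = w + X x + h) ?fC//; ring.
Qed.

Hypothesis X1 : P.-integrable setT (EFin \o X).
Hypothesis X2 : P.-integrable setT (EFin \o (fun x => X x ^+ 2)).
Hypothesis X3 : P.-integrable setT (EFin \o (fun x => `|X x| ^+ 3)).

(** The linear term integrates to zero, so up to a third moment the mean depends on [X] through its
    variance alone. Two centered variables of equal variance are therefore interchangeable. *)
Lemma taylor2_step M C f f1 f2 w : taylor2 M C f f1 f2 -> \int[P]_x X x = 0 ->
  `|\int[P]_x f (w + X x) - (f w + (\int[P]_x (X x ^+ 2)) / 2 * f2 w)| <=
  C * \int[P]_x (`|X x| ^+ 3).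
Proof.
move=> [fM f1M f2M fC] EX.
have i0 := bounded_lipschitz_shift_integrable P mX w fM.
have ic : P.-integrable setT (EFin \o (fun x => f w)).
  exact: finite_measure_integrable_cst.
have i1 : P.-integrable setT (EFin \o (fun x => f1 w * X x)).
  exact: (integrableZl measurableT (f1 w) X1).
have i2 : P.-integrable setT (EFin \o (fun x => f2 w / 2 * X x ^+ 2)).
  exact: (integrableZl measurableT (f2 w / 2) X2).
have i01 : P.-integrable setT (EFin \o (fun x => f w + f1 w * X x)).
  exact: (integrableD measurableT ic i1).
have -> : f w + (\int[P]_x (X x ^+ 2)) / 2 * f2 w =
    \int[P]_x (f w + f1 w * X x + f2 w / 2 * X x ^+ 2).
  rewrite RintegralD// RintegralD// !RintegralZl// Rintegral_cst1 EX; ring.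
rewrite -RintegralZl//; apply: normr_RintegralB_le => //.
- exact: (integrableD measurableT i01 i2).
- exact: (integrableZl measurableT C X3).
- move=> x; rewrite (_ : f w + f1 w * X x + f2 w / 2 * X x ^+ 2 =
    f w + X x * f1 w + X x ^+ 2 / 2 * f2 w) ?fC//; ring.
Qed.

End taylor2_average.

End bounded_lipschitz.

Section lindeberg.
Context {R : realType}.
Implicit Types (mu N : probability R R) (xi : R -> R).

Definition centered3 mu xi := [/\ measurable_fun setT xi,
  mu.-integrable setT (EFin \o (fun x => `|xi x| ^+ 3)) &
  \int[mu]_x xi x = 0].

(** On a probability space the third absolute moment controls the lower ones, since [a] and [a ^+ 2]
    are at most [1 + a ^+ 3] for [a >= 0]. *)
Lemma integrable3W mu xi : measurable_fun setT xi ->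
  mu.-integrable setT (EFin \o (fun x => `|xi x| ^+ 3)) ->
  mu.-integrable setT (EFin \o xi) /\
  mu.-integrable setT (EFin \o (fun x => xi x ^+ 2)).
Proof.
move=> mxi i3.
have i13 : mu.-integrable setT (EFin \o (fun x => 1 + `|xi x| ^+ 3)).
  apply: (@integrableD _ _ _ mu setT measurableT (EFin \o cst 1) _ _ i3).
  exact: finite_measure_integrable_cst.
have le13 (a : R) : 0 <= a -> a <= 1 + a ^+ 3 /\ a ^+ 2 <= 1 + a ^+ 3.
  move=> a0; have [a1|a1] := leP a 1.
    have a3 := exprn_ge0 3 a0.
    have aa : 0 <= a * (1 - a) by rewrite mulr_ge0// subr_ge0.
    by rewrite expr2; split; lra.
  have a1' := ltW a1.
  have b1 : 0 <= a * (a - 1) by rewrite mulr_ge0// subr_ge0.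
  have b2 : 0 <= a * (a * (a - 1)) by rewrite mulr_ge0.
  by rewrite exprSr expr2; split; lra.
split; apply: (le_integrable measurableT _ _ i13) => /=.
- exact/measurable_EFinP.
- move=> x _; rewrite lee_fin [leRHS]ger0_norm ?addr_ge0//.
  by have [] := le13 _ (normr_ge0 (xi x)).
- by apply/measurable_EFinP; exact: measurable_funX.
- move=> x _; rewrite lee_fin [leRHS]ger0_norm ?addr_ge0// normrX.
  by have [] := le13 _ (normr_ge0 (xi x)).
Qed.

Section iid_sums.
Variable mu : probability R R.

Definition tuple_sum n (xi : 'I_n -> R -> R) (t : n.-tuple R) : R :=
  \sum_(i < n) xi i (tnth t i).

Lemma measurable_tuple_sum n (xi : 'I_n -> R -> R) :
  (forall i, measurable_fun setT (xi i)) -> measurable_fun setT (tuple_sum xi).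
Proof.
move=> mxi; apply: measurable_sum => i.
by apply: measurableT_comp => //; exact: measurable_tnth.
Qed.

Lemma tuple_sum_cons n (xi : 'I_n.+1 -> R -> R) x (t : n.-tuple R) :
  tuple_sum xi (tuple_cons (x, t)) =
  xi ord0 x + tuple_sum (fun i => xi (lift ord0 i)) t.
Proof.
rewrite /tuple_sum big_ord_recl; congr (_ + _).
by apply: eq_bigr => i _; rewrite !(tnth_nth 0).
Qed.

Lemma Rintegral_iidS n (f : n.+1.-tuple R -> R) M :
  measurable_fun setT f -> (forall t, `|f t| <= M) ->
  \int[iid mu n.+1]_t f t =
  \int[mu]_x \int[iid mu n]_t f (tuple_cons (x, t)).
Proof.
move=> mf fM; rewrite {1}/Rintegral integral_iidS; last exact: bounded_integrable fM.
congr fine; apply: eq_integral => x _; apply: EFin_Rintegral.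
apply: (@bounded_integrable _ _ _ _ _ M) => //.
by apply: measurableT_comp => //; exact: measurable_tuple_consr.
Qed.

(* [N] plays the standard normal law: the swapping argument only needs three
   moments and stability under convolution. *)
Variable N : probability R R.
Hypothesis N3 : centered3 N id.
Hypothesis N2 : \int[N]_x (x ^+ 2) = 1.
Hypothesis N_stable : forall M f u v w, bounded_lipschitz M f -> 0 <= u -> 0 <= v ->
  \int[N]_x \int[N]_y f (w + Num.sqrt u * x + Num.sqrt v * y) =
  \int[N]_x f (w + Num.sqrt (u + v) * x).

Let m3 := \int[N]_x (`|x| ^+ 3).

(** Induction on [n], with the shift [w] free so that it can absorb the first coordinate. The
    constant [C] does not grow, because averaging over a Gaussian keeps a test function in
    [taylor2 M C]. *)
Lemma lindeberg_swap n (xi : 'I_n -> R -> R) M C f f1 f2 w :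
  let v i := \int[mu]_x (xi i x ^+ 2) : R in
  (forall i, centered3 mu (xi i)) -> taylor2 M C f f1 f2 ->
  `|\int[iid mu n]_t f (w + tuple_sum xi t)
    - \int[N]_x f (w + Num.sqrt (\sum_(i < n) v i) * x)| <=
  C * \sum_(i < n) (\int[mu]_x (`|xi i x| ^+ 3) + m3 * Num.sqrt (v i) ^+ 3).
Proof.
elim: n xi M C f f1 f2 w => [|n IH] xi M C f f1 f2 w v xi3 fT.
  rewrite !big_ord0 sqrtr0 mulr0.
  under [X in _ - X]eq_Rintegral do rewrite mul0r addr0.
  under eq_Rintegral do rewrite /tuple_sum big_ord0 addr0.
  by rewrite !Rintegral_cst1 subrr normr0.
have [fM f1M f2M fC] := fT.
have [mxi i3 xi0] : centered3 mu (xi ord0) by [].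
have [i1 i2] := integrable3W mxi i3.
have mxi' i : measurable_fun setT (xi i) by have [] := xi3 i.
have v0 i : 0 <= v i by apply: Rintegral_ge0 => x _; exact: sqr_ge0.
pose V := \sum_(i < n) v (lift ord0 i).
have V0 : 0 <= V by apply: sumr_ge0.
have mid : measurable_fun setT (id : R -> R) by exact: measurable_id.
have msV u : measurable_fun setT (fun x : R => Num.sqrt u * x).
  by exact: measurable_funM.
(* [g] is [f] averaged over the Gaussian that replaces all coordinates but the first. *)
pose g w := \int[N]_x f (w + Num.sqrt V * x).
pose g1 w := \int[N]_x f1 (w + Num.sqrt V * x).
pose g2 w := \int[N]_x f2 (w + Num.sqrt V * x).
have gT : taylor2 M C g g1 g2 by apply: (taylor2_average N (msV V) fT).
have [gM _ _ _] := gT.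
rewrite (@Rintegral_iidS _ _ M); last 2 first.
- apply: measurableT_comp; first exact: bounded_lipschitz_measurable fM.
  by apply: measurable_funD => //; exact: measurable_tuple_sum.
- by move=> t; exact: fM.1.
under eq_Rintegral do under eq_Rintegral do rewrite tuple_sum_cons addrA.
rewrite !big_ord_recl/= -/V.
have Xi m := measurable_tuple_sum (fun i => mxi' (lift m i)).
pose h w := \int[iid mu n]_t f (w + tuple_sum (fun i => xi (lift ord0 i)) t).
have hM : bounded_lipschitz M h by exact: bounded_lipschitz_average.
pose rest := \sum_(i < n) (\int[mu]_x (`|xi (lift ord0 i) x| ^+ 3)
  + m3 * Num.sqrt (v (lift ord0 i)) ^+ 3).
(* The induction hypothesis, applied for each value of the first coordinate, replaces the other
   coordinates. *)
have T1 : `|\int[mu]_x h (w + xi ord0 x) - \int[mu]_x g (w + xi ord0 x)| <= C * rest.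
  rewrite -[leRHS](Rintegral_cst1 mu); apply: normr_RintegralB_le.
  - exact: bounded_lipschitz_shift_integrable hM.
  - exact: bounded_lipschitz_shift_integrable gM.
  - exact: finite_measure_integrable_cst.
  - by move=> x; apply: (IH _ M C f f1 f2).
(* [T2] and [T3] compare the first coordinate, and a Gaussian of the same variance, with one and the
   same quadratic expansion of [g] at [w]. *)
have T2 := taylor2_step mxi i1 i2 i3 w gT xi0.
have [_ N3i N30] := N3.
have [N1i N2i] := integrable3W mid N3i.
have s0 : Num.sqrt (v ord0) ^+ 2 = v ord0 by rewrite sqr_sqrtr.
have sN2 : (fun x : R => (Num.sqrt (v ord0) * x) ^+ 2) = (fun x => v ord0 * x ^+ 2).
  by apply/funext => x; rewrite exprMn s0.
have sN3 : (fun x : R => `|Num.sqrt (v ord0) * x| ^+ 3) =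
    (fun x => Num.sqrt (v ord0) ^+ 3 * `|x| ^+ 3).
  by apply/funext => x; rewrite normrM exprMn (ger0_norm (sqrtr_ge0 _)).
have T3 : `|\int[N]_x g (w + Num.sqrt (v ord0) * x) - (g w + v ord0 / 2 * g2 w)| <=
    C * (m3 * Num.sqrt (v ord0) ^+ 3).
  have e2 : \int[N]_x ((Num.sqrt (v ord0) * x) ^+ 2) = v ord0.
    by rewrite sN2 RintegralZl// N2 mulr1.
  have e3 : \int[N]_x (`|Num.sqrt (v ord0) * x| ^+ 3) = m3 * Num.sqrt (v ord0) ^+ 3.
    by rewrite sN3 RintegralZl// mulrC.
  have h1 : N.-integrable setT (EFin \o (fun x => Num.sqrt (v ord0) * x)).
    exact: (integrableZl measurableT (Num.sqrt (v ord0)) N1i).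
  have h2 : N.-integrable setT (EFin \o (fun x => (Num.sqrt (v ord0) * x) ^+ 2)).
    by rewrite sN2; exact: (integrableZl measurableT (v ord0) N2i).
  have h3 : N.-integrable setT (EFin \o (fun x => `|Num.sqrt (v ord0) * x| ^+ 3)).
    by rewrite sN3; exact: (integrableZl measurableT (Num.sqrt (v ord0) ^+ 3) N3i).
  have h0 : \int[N]_x (Num.sqrt (v ord0) * x) = 0.
    by rewrite RintegralZl//= N30 mulr0.
  have := @taylor2_step R _ _ N _ (msV (v ord0)) h1 h2 h3 M C g g1 g2 w gT h0.
  by rewrite e2 e3.
(* The Gaussians of variances [v ord0] and [V] merge into one. *)
rewrite -(N_stable w fM (v0 ord0) V0).
rewrite -/(v ord0) -/rest.
set A := (X in `|X - _|); set B := (X in `|_ - X|).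
have EA : A = \int[mu]_x h (w + xi ord0 x) by [].
have EB : B = \int[N]_x g (w + Num.sqrt (v ord0) * x) by [].
rewrite EA EB; move: T1 T2 T3; rewrite -/(v ord0) !ler_norml !mulrDr.
by move=> /andP[? ?] /andP[? ?] /andP[? ?]; apply/andP; split; lra.
Qed.

End iid_sums.
End lindeberg.

(** * Weak convergence tested on cubic splines *)

Section cubic_spline.
Context {R : realType}.
Implicit Types (x y w h a k : R).

Let pos x : R := Num.max x 0.

(** The distribution function of a sum of three independent uniform variables on [0, 1], as a third
    difference of truncated cubes. It climbs from 0 to 1 over [0, 3] and is just smooth enough for a
    Taylor expansion with cubic remainder; [spline3'] and [spline3''] are its derivatives, given by
    explicit formulas. *)
Definition spline3 x : R :=
  (pos x ^+ 3 - 3 * pos (x - 1) ^+ 3 + 3 * pos (x - 2) ^+ 3 - pos (x - 3) ^+ 3) / 6.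
Let spline3' x : R := (3 * pos x ^+ 2 - 3 * (3 * pos (x - 1) ^+ 2)
  + 3 * (3 * pos (x - 2) ^+ 2) - 3 * pos (x - 3) ^+ 2) / 6.
Let spline3'' x : R :=
  (6 * pos x - 3 * (6 * pos (x - 1)) + 3 * (6 * pos (x - 2)) - 6 * pos (x - 3)) / 6.

Let pos0 x : x <= 0 -> pos x = 0. Proof. exact: max_r. Qed.
Let posx x : 0 <= x -> pos x = x. Proof. exact: max_l. Qed.

(** The second derivative of the truncated cube is 6-Lipschitz, whence the remainder constant 1. The
    four cases are the signs of [w] and [w + h]. *)
Let cub_taylor w h :
  `|pos (w + h) ^+ 3 - (pos w ^+ 3 + h * (3 * pos w ^+ 2) + h ^+ 2 / 2 * (6 * pos w))|
  <= `|h| ^+ 3.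
Proof.
have mono (u v : R) : 0 <= u -> u <= v -> u ^+ 3 <= v ^+ 3.
  by move=> u0 uv; apply: lerXn2r => //; rewrite nnegrE// (le_trans u0).
have [w0|/ltW w0] := leP 0 w; have [wh0|/ltW wh0] := leP 0 (w + h);
  rewrite ?(posx w0) ?(posx wh0) ?(pos0 w0) ?(pos0 wh0).
- by rewrite (_ : _ - _ = h ^+ 3) ?normrX//; field.
- have h0 : 0 <= - h by lra.
  have d0 : 0 <= - h - w by lra.
  have d1 : - h - w <= - h by lra.
  rewrite -normrN [leRHS](_ : _ = (- h) ^+ 3); last by rewrite -normrN ger0_norm.
  rewrite (_ : - (_ - _) = (- h) ^+ 3 - (- h - w) ^+ 3); last by field.
  have m1 := mono _ _ d0 d1; have m2 := exprn_ge0 3 d0.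
  by rewrite ger0_norm; lra.
- have h0 : w + h <= h by lra.
  rewrite !expr0n/= !mulr0 !addr0 subr0 normrX.
  by apply: mono => //; rewrite !ger0_norm//; lra.
- by rewrite !expr0n/= !mulr0 !addr0 subr0 normr0 exprn_ge0.
Qed.

(** The truncated cubes enter with weights 1, 3, 3, 1 over 6, which gives the constant 8 / 6,
    rounded up to 2. *)
Lemma spline3_taylor w h :
  `|spline3 (w + h) - (spline3 w + h * spline3' w + h ^+ 2 / 2 * spline3'' w)|
  <= 2 * `|h| ^+ 3.
Proof.
have t0 := cub_taylor w h; have t1 := cub_taylor (w - 1) h.
have t2 := cub_taylor (w - 2) h; have t3 := cub_taylor (w - 3) h.
have e z : w - z + h = w + h - z by ring.
rewrite e in t1; rewrite e in t2; rewrite e in t3.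
move: t0 t1 t2 t3; rewrite /spline3 /spline3' /spline3'' !ler_norml.
move=> /andP[? ?] /andP[? ?] /andP[? ?] /andP[? ?]; apply/andP; split; lra.
Qed.

Lemma spline3_le0 x : x <= 0 -> spline3 x = 0.
Proof.
move=> x0; rewrite /spline3 !pos0; [|lra..].
by rewrite expr0n/= !mulr0 !subr0 addr0 mul0r.
Qed.

Lemma spline3_ge3 x : 3 <= x -> spline3 x = 1.
Proof. by move=> x3; rewrite /spline3 !posx; [field|lra..]. Qed.

(** The spline and its two derivatives are constant on either side of [0, 3], so they may be
    evaluated at the clamped point. There the truncated powers are bounded and Lipschitz, and
    clamping itself is 1-Lipschitz. *)
Let clamp x : R := Num.max (Num.min x 3) 0.

Let clamp_itv x : 0 <= clamp x <= 3.
Proof. by rewrite /clamp le_max lexx orbT/= ge_max ge_min lexx orbT ler0n. Qed.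

Let clampP x : [\/ (x <= 0 /\ clamp x = 0), clamp x = x | (3 <= x /\ clamp x = 3)].
Proof.
rewrite /clamp; have [x3|/ltW x3] := leP x 3.
  by have [|] := leP x 0; [constructor 1|constructor 2].
by constructor 3; rewrite max_l.
Qed.

Let max_lip x y z : `|Num.max x z - Num.max y z| <= `|x - y|.
Proof.
have := ler_norm (x - y); have := ler_norm (- (x - y)); rewrite normrN.
have := normr_ge0 (x - y) => ? ? ?.
by have [|] := leP x z; have [|] := leP y z => ? ?; rewrite ler_norml; apply/andP; split; lra.
Qed.

Let min_lip x y z : `|Num.min x z - Num.min y z| <= `|x - y|.
Proof.
have := ler_norm (x - y); have := ler_norm (- (x - y)); rewrite normrN.
have := normr_ge0 (x - y) => ? ? ?.
by have [|] := leP x z; have [|] := leP y z => ? ?; rewrite ler_norml; apply/andP; split; lra.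
Qed.

Let clamp_lip x y : `|clamp x - clamp y| <= `|x - y|.
Proof. by apply: (le_trans (max_lip _ _ _)); exact: min_lip. Qed.

Let spline3_clamp x : spline3 x = spline3 (clamp x).
Proof.
have [[x0 ->]|->|[x3 ->]]// := clampP x; first by rewrite !spline3_le0.
by rewrite !spline3_ge3.
Qed.

Let spline3'_clamp x : spline3' x = spline3' (clamp x).
Proof.
have [[x0 ->]|->|[x3 ->]]// := clampP x; rewrite /spline3'.
  by rewrite !pos0; lra.
by rewrite !posx; [field|lra..].
Qed.

Let spline3''_clamp x : spline3'' x = spline3'' (clamp x).
Proof.
have [[x0 ->]|->|[x3 ->]]// := clampP x; rewrite /spline3''.
  by rewrite !pos0; lra.
by rewrite !posx; [field|lra..].
Qed.

Let pos_itv x z : 0 <= z -> 0 <= pos (clamp x - z) <= 3.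
Proof.
have /andP[c0 c3] := clamp_itv x => z0.
by rewrite le_max lexx orbT/= ge_max ler0n andbT; lra.
Qed.

Let pos_lip x y z : `|pos (clamp x - z) - pos (clamp y - z)| <= `|x - y|.
Proof.
apply: (le_trans (max_lip _ _ _)).
by rewrite (_ : _ - _ = clamp x - clamp y) ?clamp_lip//; ring.
Qed.

Let sqr_lip (u v e : R) : 0 <= u <= 3 -> 0 <= v <= 3 -> `|u - v| <= e ->
  `|u ^+ 2 - v ^+ 2| <= 6 * e.
Proof.
move=> /andP[u0 u3] /andP[v0 v3] uv.
rewrite (_ : _ - _ = (u + v) * (u - v)); last by ring.
by rewrite normrM ler_pM// ger0_norm; lra.
Qed.

Let cub_lip (u v e : R) : 0 <= u <= 3 -> 0 <= v <= 3 -> `|u - v| <= e ->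
  `|u ^+ 3 - v ^+ 3| <= 27 * e.
Proof.
move=> /andP[u0 u3] /andP[v0 v3] uv.
rewrite (_ : _ - _ = (u * u + u * v + v * v) * (u - v)); last by ring.
have le9 (a b : R) : 0 <= a -> a <= 3 -> 0 <= b -> b <= 3 -> 0 <= a * b <= 3 * 3.
  by move=> *; rewrite mulr_ge0//= ler_pM.
have /andP[? ?] := le9 u u u0 u3 u0 u3; have /andP[? ?] := le9 u v u0 u3 v0 v3.
have /andP[? ?] := le9 v v v0 v3 v0 v3.
by rewrite normrM ler_pM// ger0_norm; lra.
Qed.

Let bnd2 (u : R) : 0 <= u <= 3 -> 0 <= u ^+ 2 <= 9.
Proof. by move=> /andP[u0 u3]; rewrite exprn_ge0//= expr2; nra. Qed.

Let bnd3 (u : R) : 0 <= u <= 3 -> 0 <= u ^+ 3 <= 27.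
Proof.
move=> /andP[u0 u3]; rewrite exprn_ge0//= (_ : 27 = 3 ^+ 3 :> R); last by ring.
by apply: lerXn2r => //; rewrite nnegrE.
Qed.

Let i0 x : 0 <= pos (clamp x) <= 3.
Proof. by have := @pos_itv x 0 (lexx _); rewrite subr0. Qed.
Let i1 x := @pos_itv x 1 ler01.
Let i2 x := @pos_itv x 2 (ler0n _ 2).
Let i3 x := @pos_itv x 3 (ler0n _ 3).
Let l0 x y : `|pos (clamp x) - pos (clamp y)| <= `|x - y|.
Proof. by have := pos_lip x y 0; rewrite !subr0. Qed.

Let combo_bnd (b : R) (u0 u1 u2 u3 : R) : 0 <= u0 <= b -> 0 <= u1 <= b -> 0 <= u2 <= b ->
  0 <= u3 <= b -> `|(u0 - 3 * u1 + 3 * u2 - u3) / 6| <= 2 * b.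
Proof.
move=> /andP[? ?] /andP[? ?] /andP[? ?] /andP[? ?].
by rewrite ler_norml; apply/andP; split; lra.
Qed.

Let combo_lip (b : R) (u0 u1 u2 u3 v0 v1 v2 v3 : R) :
  `|u0 - v0| <= b -> `|u1 - v1| <= b -> `|u2 - v2| <= b -> `|u3 - v3| <= b ->
  `|(u0 - 3 * u1 + 3 * u2 - u3) / 6 - (v0 - 3 * v1 + 3 * v2 - v3) / 6| <= 2 * b.
Proof.
rewrite !ler_norml => /andP[? ?] /andP[? ?] /andP[? ?] /andP[? ?].
by apply/andP; split; lra.
Qed.

Let scale_lip (c b u v : R) : 0 <= c -> `|u - v| <= b -> `|c * u - c * v| <= c * b.
Proof. by move=> c0 uv; rewrite -mulrBr normrM (ger0_norm c0) ler_wpM2l. Qed.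

Let scale_bnd (c b u : R) : 0 <= c -> 0 <= u <= b -> 0 <= c * u <= c * b.
Proof. by move=> c0 /andP[u0 ub]; rewrite mulr_ge0//= ler_wpM2l. Qed.

(** On [0, 3] the cube is bounded by 27 and has Lipschitz constant 27; the factor 2 bounds the total
    weight 8 / 6. The same 54 is kept for the two derivatives. *)
Let spline3_bl : bounded_lipschitz 54 spline3.
Proof.
split=> [x|x y].
  rewrite spline3_clamp (_ : 54 = 2 * 27); last by ring.
  by apply: combo_bnd; apply: bnd3.
rewrite spline3_clamp (spline3_clamp y) (_ : 54 = 2 * 27); last by ring.
by rewrite -mulrA; apply: combo_lip; apply: cub_lip.
Qed.

Let spline3'_bl : bounded_lipschitz 54 spline3'.
Proof.
split=> [x|x y].
  rewrite spline3'_clamp (_ : 54 = 2 * (3 * 9)); last by ring.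
  by apply: combo_bnd; apply: scale_bnd => //; apply: bnd2.
rewrite spline3'_clamp (spline3'_clamp y).
apply: (@le_trans _ _ (2 * (3 * (6 * `|x - y|)))); last first.
  by have := normr_ge0 (x - y); lra.
by apply: combo_lip; apply: scale_lip => //; apply: sqr_lip.
Qed.

Let spline3''_bl : bounded_lipschitz 54 spline3''.
Proof.
split=> [x|x y].
  rewrite spline3''_clamp; apply: (@le_trans _ _ (2 * (6 * 3))); last by lra.
  by apply: combo_bnd; apply: scale_bnd.
rewrite spline3''_clamp (spline3''_clamp y).
apply: (@le_trans _ _ (2 * (6 * `|x - y|))); last first.
  by have := normr_ge0 (x - y); lra.
by apply: combo_lip; apply: scale_lip.
Qed.

Lemma spline3_itv x : 0 <= spline3 x <= 1.
Proof.
have [x0|/ltW x0] := leP x 0; first by rewrite spline3_le0// lexx ler01.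
have [x3|/ltW x3] := leP 3 x; first by rewrite spline3_ge3// lexx ler01.
have sq (u : R) : 0 <= u -> 0 <= u ^+ 3 by move=> u0; exact: exprn_ge0.
rewrite /spline3 (posx x0) (@pos0 (x - 3)); last lra.
have [x1|/ltW x1] := leP x 1.
  rewrite !(@pos0 (x - _)); [|lra..].
  have := sq _ x0; have : x ^+ 3 <= 1 ^+ 3 by apply: lerXn2r; rewrite ?nnegrE.
  by rewrite expr0n expr1n /= => ? ?; apply/andP; split; lra.
have [x2|/ltW x2] := leP x 2.
  rewrite (@posx (x - 1)) ?(@pos0 (x - 2)); [|lra..].
  have y0 : 0 <= x - 1 by lra.
  have y1 : 0 <= 1 - (x - 1) by lra.
  (* With [y = x - 1] the numerator is [1 + 3 y + 3 y^2 - 2 y^3]. The product in [a0] helps to bound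
     it below by 0, and the one in [a1], equal to [1 - 3 y^2 + 2 y^3], to bound it above by 6. *)
  have a0 : 0 <= (x - 1) ^+ 2 * (1 - (x - 1)) by rewrite mulr_ge0// sqr_ge0.
  have a1 : 0 <= (1 - (x - 1)) ^+ 2 * (1 + 2 * (x - 1)).
    by rewrite mulr_ge0// ?sqr_ge0//; lra.
  have a2 := sqr_ge0 (x - 1).
  rewrite expr0n/=; apply/andP; split; lra.
rewrite !(@posx (x - _)); [|lra..].
have d0 : 0 <= 3 - x by lra.
have d3 := sq _ d0.
have d1 : (3 - x) ^+ 3 <= 1 ^+ 3 by apply: lerXn2r; rewrite ?nnegrE//; lra.
rewrite (_ : (_ / 6) = 1 - (3 - x) ^+ 3 / 6); last by field.
by rewrite expr1n in d1; apply/andP; split; lra.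
Qed.

Lemma spline3_taylor2 a k : 0 < k ->
  exists M C f1 f2, taylor2 M C (fun x => spline3 ((x - a) * k)) f1 f2.
Proof.
(* Each derivative brings out a factor [k], and each Lipschitz bound one more; [K] dominates all the
   powers that occur. *)
move=> k0; pose K := 1 + k + k ^+ 2 + k ^+ 3.
have k2 : 0 <= k ^+ 2 by exact: sqr_ge0.
have k3 : 0 <= k ^+ 3 by rewrite exprn_ge0// ltW.
have bl (c : R) (f : R -> R) : 0 <= c -> c * 54 <= 54 * K -> c * k * 54 <= 54 * K ->
    bounded_lipschitz 54 f ->
    bounded_lipschitz (54 * K) (fun x => c * f ((x - a) * k)).
  move=> c0 cK ckK [fM fL]; split=> [x|x y].
    by rewrite normrM (ger0_norm c0) (le_trans _ cK)// ler_wpM2l.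
  rewrite -mulrBr normrM (ger0_norm c0).
  apply: (@le_trans _ _ (c * (54 * (k * `|x - y|)))).
    rewrite ler_wpM2l// (le_trans (fL _ _))// ler_wpM2l//.
    rewrite (_ : _ - _ = k * (x - y)); last by ring.
    by rewrite normrM gtr0_norm.
  rewrite (_ : c * _ = c * k * 54 * `|x - y|); last by ring.
  by rewrite ler_wpM2r.
exists (54 * K), (2 * k ^+ 3), (fun x => k * spline3' ((x - a) * k)),
  (fun x => k ^+ 2 * spline3'' ((x - a) * k)); split.
- have := @bl 1 _ ler01 _ _ spline3_bl.
  rewrite (_ : (fun x => 1 * _) = (fun x => spline3 ((x - a) * k))); last first.
    by apply/funext => x; rewrite mul1r.
  by apply; rewrite /K; lra.
- by apply: bl => //; rewrite /K ?expr2; lra.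
- by apply: bl => //; rewrite /K ?exprSr ?expr0 ?mul1r; lra.
move=> w h; have := spline3_taylor ((w - a) * k) (h * k).
rewrite normrM (gtr0_norm k0) !exprMn.
rewrite (_ : (w - a) * k + h * k = (w + h - a) * k); last by ring.
rewrite (_ : _ - _ = spline3 ((w + h - a) * k) - (spline3 ((w - a) * k) +
  h * (k * spline3' ((w - a) * k)) + h ^+ 2 / 2 * (k ^+ 2 * spline3'' ((w - a) * k)))).
  by move/le_trans; apply; lra.
by field.
Qed.

End cubic_spline.

Section bounded_convergence.
Context d {T : measurableType d} {R : realType}.
Variable P : probability T R.

Lemma bounded_convergence (f_ : (T -> R)^nat) (f : T -> R) (M : R) :
  (forall n, measurable_fun setT (f_ n)) -> (forall n x, `|f_ n x| <= M) ->
  (forall x, f_ ^~ x @ \oo --> f x) ->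
  \int[P]_x f_ n x @[n --> \oo] --> \int[P]_x f x.
Proof.
move=> mf_ f_M f_f; apply: fine_cvg.
have fM x : `|f x| <= M.
  have /(@cvg_lim _) <- // : `|f_ n x| @[n --> \oo] --> `|f x|.
    by apply: cvg_norm; exact: f_f.
  apply: limr_le; first by apply: is_cvg_norm; apply/cvg_ex; exists (f x).
  by apply: nearW => n; exact: f_M.
have mf : measurable_fun setT f.
  by apply: (measurable_fun_cvg mf_) => x _; exact: f_f.
rewrite fineK; last by apply: integrable_fin_num => //; exact: bounded_integrable fM.
apply: (@dominated_cvg _ _ _ P setT measurableT _ _ (cst M%:E)) => //.
- by move=> n; exact/measurable_EFinP.
- by move=> x _; apply/cvg_EFin; [exact: nearW|exact: f_f].
- exact: finite_measure_integrable_cst.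
- by move=> n x _; rewrite lee_fin.
Qed.

End bounded_convergence.

(** Uniform continuity with only [x] confined to the segment, so that the endpoints need no care.
    Compactness enters as a covering statement for the filter of small positive [dl]. *)
Lemma continuous_heine {R : realType} (f : R -> R) (a b e : R) : continuous f -> 0 < e ->
  exists2 dl, 0 < dl & forall x y, a <= x <= b -> `|x - y| <= dl -> `|f x - f y| <= e.
Proof.
move=> cf e0.
have /compact_near_coveringP := @segment_compact R a b.
move=> /(_ R (0^'+) (fun dl x => forall y, `|x - y| <= dl -> `|f x - f y| <= e) _).
have e2 : 0 < e / 2 by rewrite divr_gt0.
case.
  move=> x xab; have /cvgrPdist_le/(_ _ e2)/nbhs_normP[r /= r0 fr] := cf x.
  have r2 : 0 < r / 2 by rewrite divr_gt0.
  near=> z dl => /= y zy.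
  have xz : `|x - z| < r / 2 by near: z; apply/nbhs_normP; exists (r / 2).
  have dlr : dl < r / 2 by near: dl; exact: nbhs_right_lt.
  have h1 := fr z; have h2 := fr y; rewrite /ball/= in h1 h2.
  have xy : `|x - y| < r.
    rewrite (_ : x - y = (x - z) + (z - y)); last by ring.
    by rewrite (le_lt_trans (ler_normD _ _))//; lra.
  rewrite (_ : f z - f y = (f x - f y) - (f x - f z)); last by ring.
  rewrite (le_trans (ler_normB _ _))//.
  have := h2 xy; have : `|f x - f z| <= e / 2 by apply: h1; lra.
  by lra.
move=> r /= r0 H; exists (r / 2); first by rewrite divr_gt0.
move=> x y xab; apply: (H (r / 2)) => /=; rewrite ?divr_gt0//.
by rewrite sub0r normrN gtr0_norm ?divr_gt0//; lra.
Unshelve. all: by end_near. Qed.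

Section spline_interpolation.
Context {R : realType}.
Variables (f : R -> R) (a dl e : R).
Hypotheses (dl0 : 0 < dl) (e0 : 0 <= e).

Let pt j : R := a + j%:R * dl.

(** A smooth staircase through the values of [f] at the nodes. The scale [3 / dl] makes each step
    climb exactly between two consecutive nodes, since [spline3] rises over [0, 3]. *)
Definition spline_interp n x : R :=
  f a + \sum_(j < n) (f (pt j.+1) - f (pt j)) * spline3 ((x - pt j) * (3 / dl)).

Let ptS j : pt j.+1 = pt j + dl. Proof. by rewrite /pt -natr1; ring. Qed.
Let pt0 : pt 0 = a. Proof. by rewrite /pt mul0r addr0. Qed.
Let pt_le i j : (i <= j)%N -> pt i <= pt j.
Proof. by move=> ij; rewrite lerD2l ler_pM2r// ler_nat. Qed.

Let step0 j x : x <= pt j -> spline3 ((x - pt j) * (3 / dl)) = 0.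
Proof.
move=> xj; apply: spline3_le0; rewrite pmulr_lle0 ?divr_gt0//; lra.
Qed.

Let step1 j x : pt j.+1 <= x -> spline3 ((x - pt j) * (3 / dl)) = 1.
Proof.
rewrite ptS => xj; apply: spline3_ge3.
rewrite mulrA ler_pdivlMr// mulrC ler_wpM2r//; lra.
Qed.

Lemma spline_interp_le n x : x <= a -> spline_interp n x = f a.
Proof.
move=> xa; rewrite /spline_interp big1 ?addr0// => j _.
by rewrite step0 ?mulr0// (le_trans xa)// -pt0 pt_le.
Qed.

Lemma spline_interp_ge n x : pt n <= x -> spline_interp n x = f (pt n).
Proof.
rewrite /spline_interp; elim: n => [|n IH] nx; first by rewrite big_ord0 addr0 pt0.
rewrite big_ord_recr/= addrA IH ?(le_trans _ nx) ?pt_le// step1//; ring.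
Qed.

(** Between two nodes a single step is being climbed, so the interpolant is a convex combination of
    the two nodal values there, and those are close to [f x]. *)
Lemma spline_interp_in n x : (forall j y, (j < n)%N -> pt j <= y <= pt j.+1 ->
    `|f (pt j) - f y| <= e) ->
  a <= x <= pt n -> `|f x - spline_interp n x| <= 2 * e.
Proof.
elim: n => [|n IH] fe /andP[ax xn].
  rewrite /spline_interp big_ord0 addr0 (_ : x = a) ?subrr ?normr0; last first.
    by apply/le_anti; rewrite ax -pt0 xn.
  by rewrite mulr_ge0.
have [xn1|/ltW xn1] := leP x (pt n).
  rewrite /spline_interp big_ord_recr/= step0// mulr0 addr0.
  by apply: IH => [j y jn|]; [apply: fe; exact: ltnW|rewrite ax].
have := @spline_interp_ge n x xn1.
rewrite /spline_interp big_ord_recr/= addrA => ->.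
have /andP[s0 s1] := spline3_itv ((x - pt n) * (3 / dl)).
have h1 := fe n x (ltnSn n); have h2 := fe n (pt n.+1) (ltnSn n).
rewrite xn1 xn in h1; rewrite lexx ptS lerDl (ltW dl0) in h2.
have := h1 isT; have := h2 isT; rewrite -ptS; set s := spline3 _ in s0 s1 *.
have -> : f x - (f (pt n) + (f (pt n.+1) - f (pt n)) * s) =
   (f (pt n) - f (pt n.+1)) * s - (f (pt n) - f x) by ring.
move=> h h'; rewrite (le_trans (ler_normB _ _))// (_ : 2 * e = e + e); last by ring.
apply: lerD => //; rewrite normrM (ger0_norm s0) (le_trans _ h)//.
by rewrite ler_piMr.
Qed.

End spline_interpolation.

(** * From splines to bounded continuous functions *)

Section weak_convergence.
Context {R : realType}.
Variables (d : nat -> measure_display) (T : forall n, measurableType (d n)).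
Variables (P : forall n, probability (T n) R) (Y : forall n, T n -> R).
Variable nu : probability (measurableTypeR R) R.
Hypothesis mY : forall n, measurable_fun [set: T n] (@Y n).

(** Measurability and boundedness are bundled with convergence so that the class is closed under
    linear combinations. *)
Definition weak_test (g : R -> R) :=
  [/\ measurable_fun setT g, exists M, forall x, `|g x| <= M &
   \int[P n]_w g (@Y n w) @[n --> \oo] --> \int[nu]_x g x].

Let integrableY n g : weak_test g -> (P n).-integrable setT (EFin \o (g \o @Y n)).
Proof.
move=> [mg [M gM] _]; apply: (@bounded_integrable _ _ _ _ _ M).
  exact: measurableT_comp.
by move=> x; exact: gM.
Qed.

Let integrablenu g : weak_test g -> nu.-integrable setT (EFin \o g).
Proof.
move=> [mg [M gM] _]; exact: (@bounded_integrable _ _ _ nu g M mg gM).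
Qed.

Lemma weak_test_cst r : weak_test (fun=> r).
Proof.
split; first exact: measurable_cst.
  by exists `|r|.
rewrite Rintegral_cst1; under eq_fun do rewrite Rintegral_cst1.
exact: cvg_cst.
Qed.

Lemma weak_testD f g : weak_test f -> weak_test g -> weak_test (fun x => f x + g x).
Proof.
move=> fw gw; have [mf [Mf fM] cf] := fw; have [mg [Mg gM] cg] := gw; split.
- exact: measurable_funD.
- exists (Mf + Mg) => x; apply: (le_trans (ler_normD _ _)).
  by apply: lerD; [exact: fM|exact: gM].
- rewrite (RintegralD measurableT (integrablenu fw) (integrablenu gw)).
  rewrite [X in X @ _](_ : _ = (fun n => \int[P n]_w f (@Y n w) + \int[P n]_w g (@Y n w))).
    exact: cvgD.
  apply/funext => n.
  exact: (RintegralD measurableT (integrableY n fw) (integrableY n gw)).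
Qed.

Lemma weak_testZ k f : weak_test f -> weak_test (fun x => k * f x).
Proof.
move=> fw; have [mf [Mf fM] cf] := fw; split.
- exact: measurable_funM.
- by exists (`|k| * Mf) => x; rewrite normrM ler_wpM2l//; exact: fM.
- rewrite (RintegralZl _ measurableT (integrablenu fw)).
  rewrite [X in X @ _](_ : _ = (fun n => k * \int[P n]_w f (@Y n w))).
    by apply: cvgM => //; exact: cvg_cst.
  by apply/funext => n; exact: (RintegralZl _ measurableT (integrableY n fw)).
Qed.

Lemma weak_test_sum n (F : 'I_n -> R -> R) : (forall i, weak_test (F i)) ->
  weak_test (fun x => \sum_(i < n) F i x).
Proof.
elim: n F => [|n IH] F wF.
  by under eq_fun do rewrite big_ord0; exact: weak_test_cst.
under eq_fun do rewrite big_ord_recr/=.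
by apply: weak_testD => //; exact: (IH (fun i => F (widen_ord (leqnSn n) i))).
Qed.

(** The dominating function [h] is itself a test function, so its mean under [P n] is controlled by
    its mean under [nu]. Of the four quarters of [e], two come from the mean of [h] under [nu] and
    one each from the convergences for [g] and [h]. *)
Lemma weak_test_sandwich (f : R -> R) : measurable_fun setT f -> (exists M, forall x, `|f x| <= M) ->
  (forall e, 0 < e -> exists g h, [/\ weak_test g, weak_test h,
     forall x, `|f x - g x| <= h x & \int[nu]_x h x <= e]) ->
  weak_test f.
Proof.
move=> mf [M fM] fgh; split => //; first by exists M.
apply/cvgrPdist_le => e e0.
have e4 : 0 < e / 4 by rewrite divr_gt0.
have [g [h [gw hw fgh' he]]] := fgh _ e4.
have [_ _ /cvgrPdist_le/(_ _ e4) cg] := gw.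
have [_ _ /cvgrPdist_le/(_ _ e4) ch] := hw.
have fi : nu.-integrable setT (EFin \o f) by exact: (@bounded_integrable _ _ _ nu f M mf fM).
have h1 := normr_RintegralB_le fi (integrablenu gw) (integrablenu hw) fgh'.
near=> n.
have fin : (P n).-integrable setT (EFin \o (fun w => f (@Y n w))).
  apply: (@bounded_integrable _ _ _ _ _ M) => //; exact: measurableT_comp.
have h2 := normr_RintegralB_le fin (integrableY n gw) (integrableY n hw)
  (fun w => fgh' (@Y n w)).
have h3 : `|\int[nu]_x g x - \int[P n]_w g (@Y n w)| <= e / 4 by near: n.
have h4 : `|\int[nu]_x h x - \int[P n]_w h (@Y n w)| <= e / 4 by near: n.
move: h1 h2 h3 h4; rewrite /= !ler_norml.
by move=> /andP[? ?] /andP[? ?] /andP[? ?] /andP[? ?]; apply/andP; split; lra.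
Unshelve. all: by end_near. Qed.

Hypothesis cvg_spline : forall a k, 0 < k ->
  \int[P n]_w spline3 ((@Y n w - a) * k) @[n --> \oo] --> \int[nu]_x spline3 ((x - a) * k).

Let spline_weak a k : 0 < k -> weak_test (fun x => spline3 ((x - a) * k)).
Proof.
move=> k0; split; last exact: cvg_spline.
  have [M [C [f1 [f2 [sM _ _ _]]]]] := @spline3_taylor2 R a k k0.
  exact: bounded_lipschitz_measurable sM.
exists 1 => x; have /andP[s0 s1] := spline3_itv ((x - a) * k).
by rewrite ger0_norm.
Qed.

(* Nonnegative, at least 1 outside ]-m-3, m+3[, and vanishing pointwise as m grows. *)
Let tail (m : nat) (x : R) : R :=
  1 - spline3 ((x - - (m%:R + 3)) * 1) + spline3 ((x - m%:R) * 1).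

Let tail_ge0 m x : 0 <= tail m x.
Proof.
rewrite /tail; have /andP[] := spline3_itv ((x - - (m%:R + 3)) * 1).
by have /andP[] := spline3_itv ((x - m%:R) * 1); lra.
Qed.

Let tail_ge1 m x : m%:R + 3 <= `|x| -> 1 <= tail m x.
Proof.
rewrite /tail ler_normr => /orP[] mx.
  rewrite (@spline3_ge3 _ ((x - m%:R) * 1)); last lra.
  by have /andP[] := spline3_itv ((x - - (m%:R + 3)) * 1); lra.
rewrite (@spline3_le0 _ ((x - - (m%:R + 3)) * 1)); last lra.
by have /andP[] := spline3_itv ((x - m%:R) * 1); lra.
Qed.

Let tail_weak m : weak_test (tail m).
Proof.
apply: weak_testD; last exact: spline_weak.
have := weak_testD (weak_test_cst 1) (weak_testZ (-1) (spline_weak (- (m%:R + 3)) ltr01)).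
by under eq_fun do rewrite mulN1r.
Qed.

Let tail_cvg : \int[nu]_x tail m x @[m --> \oo] --> (0 : R).
Proof.
rewrite -[X in _ --> X](Rintegral_cst1 nu); apply: (@bounded_convergence _ _ _ _ _ _ 2).
- by move=> m; have [] := tail_weak m.
- move=> m x; rewrite ger0_norm// /tail.
  have /andP[] := spline3_itv ((x - - (m%:R + 3)) * 1).
  by have /andP[] := spline3_itv ((x - m%:R) * 1); lra.
- move=> x; apply/cvgrPdist_le => e e0; near=> m.
  have xm : `|x| <= m%:R by near: m; exact: nbhs_infty_ger.
  have := ler_norm x; have := ler_norm (- x); rewrite normrN => ? ?.
  rewrite /tail (@spline3_ge3 _ ((x - - (m%:R + 3)) * 1)); last lra.
  rewrite (@spline3_le0 _ ((x - m%:R) * 1)); last lra.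
  by rewrite subrr addr0 subrr normr0 ltW.
Unshelve. all: by end_near. Qed.

(** On a large segment [f] is uniformly close to a staircase of splines; outside, the difference is
    at most [2 * M]. Tightness is not assumed: [tail m] is a combination of splines, so its means
    along [P n] follow its mean under the limit law. *)
Lemma cvg_in_distribution_spline : cvg_in_distribution P Y nu.
Proof.
split=> // f cf [M fM]; have mf : measurable_fun setT f.
  exact: continuous_measurable_fun.
suff : weak_test f by case.
apply: weak_test_sandwich => //; first by exists M.
move=> e e0; have M0 : 0 <= M := le_trans (normr_ge0 _) (fM 0).
(* Chosen so that [2 * M * u <= e / 2]; adding 1 to [M] covers the case [M = 0]. *)
pose u := e / (4 * (M + 1)).
have u0 : 0 < u by rewrite divr_gt0// mulr_gt0//; lra.
have [m mu] : exists m, \int[nu]_x tail m x <= u.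
  have /cvgrPdist_le/(_ _ u0)[m _ mu] := tail_cvg; exists m.
  have := mu m (leqnn m); rewrite /= sub0r normrN; exact: le_trans (ler_norm _).
have e4 : 0 < e / 4 by rewrite divr_gt0.
pose L : R := m%:R + 3.
have L0 : 0 < L by rewrite /L ltr_wpDl.
have [dl dl0 fdl] := @continuous_heine R f (- L) L (e / 4) cf e4.
(* The mesh [dl'] cuts [-L, L] into exactly [N.+1] cells while staying below the modulus [dl]. *)
have [N NL] : exists N : nat, 2 * L / dl <= N.+1%:R.
  by exists (Num.truncn (2 * L / dl)); exact/ltW/truncnS_gt.
pose dl' := 2 * L / N.+1%:R.
have dl'0 : 0 < dl' by rewrite divr_gt0// mulr_gt0.
have dl'dl : dl' <= dl by rewrite /dl' ler_pdivrMr// [dl * _]mulrC -ler_pdivrMr.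
have ptN : - L + N.+1%:R * dl' = L by rewrite /dl' mulrC divfK// ; ring.
exists (spline_interp f (- L) dl' N.+1), (fun x => e / 2 + 2 * M * tail m x); split.
- apply: weak_testD; first exact: weak_test_cst.
  apply: weak_test_sum => j; apply: weak_testZ; apply: spline_weak.
  by rewrite divr_gt0.
- exact: (weak_testD (weak_test_cst (e / 2)) (weak_testZ (2 * M) (tail_weak m))).
- move=> x; have tx := tail_ge0 m x.
  have MT : 0 <= M * tail m x by rewrite mulr_ge0.
  have out y : L <= `|x| -> `|f x - f y| <= e / 2 + 2 * M * tail m x.
    move=> Lx; have t1 := tail_ge1 Lx.
    rewrite (le_trans (ler_normB _ _))// -mulrA.
    have : M * 1 <= M * tail m x by rewrite ler_wpM2l.
    by have := fM x; have := fM y; lra.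
  have [xL|Lx] := leP x (- L).
    rewrite spline_interp_le//; apply: out; rewrite ler_normr; apply/orP; right; lra.
  have [xL|xL] := leP L x.
    rewrite spline_interp_ge//; last by rewrite ptN.
    by apply: out; rewrite ler_normr xL.
  apply: (@le_trans _ _ (2 * (e / 4))); last by rewrite -mulrA; lra.
  apply: spline_interp_in => //; first exact: ltW.
    move=> j y jN /andP[h1 h2]; apply: fdl.
      have jp : 0 <= j%:R * dl' by rewrite mulr_ge0// ltW.
      have : j%:R * dl' <= N.+1%:R * dl' by rewrite ler_pM2r// ler_nat ltnW.
      by move=> ?; apply/andP; split; lra.
    rewrite -normrN opprB ger0_norm; last lra.
    move: h2; rewrite -natr1 mulrDl mul1r; lra.
  by rewrite ptN; apply/andP; split; exact: ltW.
- rewrite (RintegralD measurableT (integrablenu (weak_test_cst (e / 2)))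
    (integrablenu (weak_testZ (2 * M) (tail_weak m)))).
  rewrite Rintegral_cst1 (RintegralZl _ measurableT (integrablenu (tail_weak m))).
  have : M * \int[nu]_x tail m x <= M * u by rewrite ler_wpM2l.
  have : M * u <= e / 4.
    rewrite /u (_ : M * (e / (4 * (M + 1))) = e / 4 * (M / (M + 1))); last first.
      by field; rewrite gt_eqF//; lra.
    have M1 : M / (M + 1) <= 1 by rewrite ler_pdivrMr ?mul1r; lra.
    by rewrite ler_piMr// ltW.
  by rewrite -mulrA; lra.
Qed.

End weak_convergence.

(** * Moments and Gaussian stability *)

Section pgauss_integral.
Context {R : realType}.
Local Notation mu := (@lebesgue_measure R).

(** The bound [1 - u <= exp (- u)] is inverted, and [1 / (1 - u)] is then compared with the
    quadratic on [|u| <= 1 / 2]. *)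
Lemma expR_le_quad (u : R) : `|u| <= 1 / 2 -> expR u <= 1 + u + 2 * u ^+ 2.
Proof.
rewrite ler_norml => /andP[u1 u2].
have h := expR_ge1Dx (- u); have e0 := expR_gt0 (- u).
have h1 : 0 < 1 - u by lra.
have e1 : expR u = (expR (- u))^-1 by rewrite expRN invrK.
rewrite e1 (@le_trans _ _ (1 - u)^-1)//; first by rewrite lef_pV2// posrE.
rewrite -div1r ler_pdivrMr//.
have : 0 <= u ^+ 2 * (1 - 2 * u) by rewrite mulr_ge0// ?sqr_ge0//; lra.
lra.
Qed.

(* The two sides touch at [l = 1], so their slopes there agree. *)
Lemma powR_tangent (k t : R) : 0 <= t ->
  (forall l, 0 < l -> 1 - (l - 1) * t <= l `^ (- k)) -> t = k.
Proof.
move=> t0 H.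
(* With [l = exp y], the term [2 * k ^+ 2] is the quadratic error of [exp (- k y)], and [2 * t] that
   of [exp y]; the 1 makes [C] positive. *)
pose C := 2 * k ^+ 2 + 2 * t + 1.
have C0 : 0 < C by have := sqr_ge0 k; rewrite /C; lra.
have key y : `|y| <= 1 / 2 -> `|k * y| <= 1 / 2 -> (k - t) * y <= C * y ^+ 2.
  move=> y1 ky; have := H (expR y) (expR_gt0 y).
  rewrite -expRM mulrN [y * k]mulrC => h1.
  have h2 : expR (- (k * y)) <= 1 - k * y + 2 * (k * y) ^+ 2.
    by have := @expR_le_quad (- (k * y)); rewrite normrN sqrrN; apply.
  have h3 := expR_le_quad y1.
  have h4 : (expR y - 1) * t <= (y + 2 * y ^+ 2) * t by rewrite ler_wpM2r//; lra.
  by rewrite /C; have := sqr_ge0 y; lra.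
have [//|tk] := eqVneq t k.
have D0 : 0 < `|k - t| by rewrite normr_gt0 subr_eq0 eq_sym.
have K0 : 0 < 2 * (`|k| + 1) by rewrite mulr_gt0// ltr_wpDl.
(* Small enough for [key] to hold at both [y] and [- y], and for [C * y] to be at most half of
   [|k - t|], which is the contradiction. *)
pose y := Num.min (1 / 2) (Num.min (1 / (2 * (`|k| + 1))) (`|k - t| / (2 * C))).
have y0 : 0 < y by rewrite !lt_min !divr_gt0// mulr_gt0.
have y1 : y <= 1 / 2 by rewrite ge_min lexx.
have y2 : y <= 1 / (2 * (`|k| + 1)) by rewrite !ge_min lexx !orbT.
have y3 : y <= `|k - t| / (2 * C) by rewrite !ge_min lexx !orbT.
have ky : `|k| * y <= 1 / 2.
  rewrite (@le_trans _ _ ((`|k| + 1) * y))// ?ler_wpM2r ?(ltW y0) ?lerDl//.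
  have := y2; rewrite ler_pdivlMr// => h; lra.
have Ky : C * y <= `|k - t| / 2.
  by have := y3; rewrite ler_pdivlMr ?mulr_gt0// => h; lra.
have := key y; have := key (- y).
rewrite normrN !normrM normrN (gtr0_norm y0) sqrrN => /(_ y1 ky) h1 /(_ y1 ky) h2.
have h3 : `|k - t| * y <= C * y * y.
  by have [|] := ler0P (k - t); lra.
have : `|k - t| <= C * y by move: h3; rewrite ler_pM2r.
lra.
Qed.

Lemma ge0_integral_pgauss (p : \bar R) (f : R -> \bar R) :
  measurable_fun setT f -> (forall x, 0 <= f x)%E ->
  (\int[pgauss_prob p]_x f x = \int[mu]_x (f x * (pgauss_pdf p x)%:E))%E.
Proof.
apply: (@ge0_integral_density_lebesgue R (pgauss_prob p) (pgauss_pdf p)) => //.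
- exact: measurable_pgauss_pdf.
- exact: pgauss_pdf_ge0.
Qed.

Variable r : R.
Hypothesis r0 : 0 < r.

Let w (x : R) : R := `|x| `^ r / r.

Let w_ge0 x : 0 <= w x.
Proof. by rewrite divr_ge0 ?powR_ge0// ltW. Qed.

Let mw : measurable_fun setT w.
Proof.
apply: measurable_funM => //.
by apply: (measurableT_comp (measurable_powR _)).
Qed.

Let J k l : \bar R := (\int[mu]_x (w x ^+ k * expR (- (l * w x)))%:E)%E.

Let mJ k l : measurable_fun setT (fun x => (w x ^+ k * expR (- (l * w x)))%:E).
Proof.
apply/measurable_EFinP; apply: measurable_funM; first exact: measurable_funX.
apply: measurableT_comp => //; apply: measurable_funN; exact: measurable_funM.
Qed.

Let J_pos k l x : (0 <= (w x ^+ k * expR (- (l * w x)))%:E)%E.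
Proof. by rewrite lee_fin mulr_ge0 ?expR_ge0 ?exprn_ge0. Qed.

(** Dilating [x] by the power [- 1 / r] of [l] divides [w] by [l]; the Jacobian supplies the
    exponent [r^-1] and the factor [w ^+ k] supplies [k]. *)
Let J_scale k l : 0 < l -> (J k l = (l `^ (- (r^-1 + k%:R)))%:E * J k 1)%E.
Proof.
move=> l0; have a0 : 0 < l `^ (- r^-1) by rewrite powR_gt0.
rewrite {1}/J (@ge0_integral_affine R _ 0 _ a0 (mJ k l) (J_pos k l)).
have wa x : w (l `^ (- r^-1) * x + 0) = l^-1 * w x.
  rewrite addr0 /w normrM (gtr0_norm a0) powRM ?(ltW a0)//.
  by rewrite -powRrM mulNr mulVf ?gt_eqF// powR_inv1 ?(ltW l0)// mulrA.
under eq_integral => x _.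
  rewrite wa mulVKf ?gt_eqF// exprMn -mulrA EFinM.
  over.
rewrite ge0_integralZl//; last 3 first.
- have := mJ k 1; rewrite (_ : (fun x => _) = (fun x => (w x ^+ k * expR (- w x))%:E))//.
  by apply/funext => x; rewrite mul1r.
- by move=> x _; rewrite lee_fin mulr_ge0 ?expR_ge0 ?exprn_ge0.
- by rewrite lee_fin exprn_ge0// invr_ge0 ltW.
rewrite muleA -EFinM opprD powRD; last by rewrite (gt_eqF l0) implybT.
rewrite exprVn -(powR_mulrn k (ltW l0)) -powRN; congr (_ * _)%E.
by apply: eq_integral => x _; rewrite mul1r.
Qed.

Let J01 : (J 0 1 = (2 * r `^ r^-1 * Gamma (r^-1 + 1))%:E)%E.
Proof.
rewrite -integral_pgauss//; apply: eq_integral => x _.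
by rewrite expr0 !mul1r.
Qed.

(** The inequality [1 + t <= exp t] at [t = u / (2 * b)], raised to the power [b]. *)
Let powR_le_expR (b u : R) : 0 <= b -> 0 <= u ->
  u `^ b <= (2 * b) `^ b * expR (u / 2).
Proof.
rewrite le_eqVlt => /predU1P[<- u0|b0 u0].
  by rewrite !powRr0 mul1r -{1}(@expR0 R) ler_expR divr_ge0.
have uE : u = (2 * b) * (u / (2 * b)).
  by rewrite mulrCA divff ?mulr1// mulf_neq0// gt_eqF.
rewrite [in leLHS]uE powRM ?divr_ge0 ?mulr_ge0 ?(ltW b0)//.
apply: ler_wpM2l; first exact: powR_ge0.
rewrite (_ : u / 2 = (u / (2 * b)) * b); last first.
  by rewrite invfM -!mulrA mulVf ?mulr1// gt_eqF.
rewrite expRM; apply: ge0_ler_powR; rewrite ?nnegrE ?expR_ge0 ?(ltW b0)//.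
  by rewrite divr_ge0 ?mulr_ge0 ?(ltW b0).
by apply: le_trans (expR_ge1Dx _); rewrite lerDr.
Qed.

(** Half of the exponent absorbs the power of [|x|]; the other half leaves [J 0 2^-1], which the
    scaling rule relates to the normalizing integral. *)
Lemma pgauss_fin_moment_lty s : 0 <= s ->
  (\int[pgauss_prob r%:E]_x (`|x| `^ s)%:E < +oo)%E.
Proof.
move=> s0; set c := (2 * r `^ r^-1 * Gamma (r^-1 + 1))^-1.
have c0 : 0 <= c by rewrite invr_ge0 ltW// integral_pgauss_gt0.
have mp : measurable_fun setT (fun x : R => `|x| `^ s).
  by apply: (measurableT_comp (measurable_powR _)).
rewrite ge0_integral_pgauss; last 2 first.
- exact/measurable_EFinP.
- by move=> x; rewrite lee_fin powR_ge0.
pose C := r `^ (s / r) * (2 * (s / r)) `^ (s / r) * c.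
have C0 : 0 <= C by rewrite !mulr_ge0 ?powR_ge0.
apply: (@le_lt_trans _ _ (\int[mu]_x (C%:E * (w x ^+ 0 * expR (- (2^-1 * w x)))%:E))%E).
  apply: ge0_le_integral => //=.
  - by move=> x _; rewrite lee_fin mulr_ge0 ?powR_ge0 ?(@pgauss_pdf_ge0 _ r%:E).
  - apply/measurable_EFinP; apply: measurable_funM => //.
    exact: (@measurable_pgauss_pdf _ r%:E).
  - by apply: measurable_funeM; exact: mJ.
  - move=> x _; rewrite r0 -/c -/(w x) -EFinM lee_fin expr0 mul1r.
    have -> : `|x| `^ s = r `^ (s / r) * w x `^ (s / r).
      rewrite -powRM ?(ltW r0)// /w mulrCA divff ?gt_eqF// mulr1 -powRrM mulrCA.
      by rewrite divff ?gt_eqF// mulr1.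
    rewrite /C -!mulrA; apply: ler_wpM2l; first exact: powR_ge0.
    have sr : 0 <= s / r by rewrite divr_ge0// ltW.
    have := powR_le_expR sr (w_ge0 x).
    move=> /(ler_wpM2r (mulr_ge0 c0 (expR_ge0 (- w x)))); move/le_trans; apply.
    rewrite -mulrA ler_wpM2l ?powR_ge0// mulrCA ler_wpM2l// -expRD ler_expR; lra.
rewrite ge0_integralZl//=; last first.
  exact: mJ.
by rewrite -/(J 0 2^-1) J_scale ?invr_gt0// J01 -!EFinM ltry.
Qed.

Local Notation X := (pgauss_prob r%:E).

Let w_pow k x : w x ^+ k = `|x| `^ (r * k%:R) / r ^+ k.
Proof. by rewrite /w expr_div_n powRrM powR_mulrn ?powR_ge0. Qed.

Let w_int k : X.-integrable setT (EFin \o (fun x => w x ^+ k)).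
Proof.
apply/integrableP; split; first by apply/measurable_EFinP; exact: measurable_funX.
have rk : 0 <= r * k%:R by rewrite mulr_ge0// ltW.
have h := pgauss_fin_moment_lty rk.
under eq_integral => x _.
  rewrite /= ger0_norm ?exprn_ge0// w_pow mulrC EFinM.
  over.
rewrite ge0_integralZl//=; last first.
- by rewrite lee_fin invr_ge0 exprn_ge0// ltW.
- by apply/measurable_EFinP; apply: (measurableT_comp (measurable_powR _)).
- by rewrite lte_mul_pinfty// lee_fin invr_ge0 exprn_ge0// ltW.
Qed.

Let exp_int k l : 0 < l ->
  (\int[X]_x (w x ^+ k * expR (- ((l - 1) * w x)))%:E =
   ((2 * r `^ r^-1 * Gamma (r^-1 + 1))^-1)%:E * J k l)%E.
Proof.
move=> l0; rewrite ge0_integral_pgauss; last 2 first.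
- by have := mJ k (l - 1).
- by move=> x; exact: J_pos.
have c0 : (0 <= ((2 * r `^ r^-1 * Gamma (r^-1 + 1))^-1)%:E)%E.
  by rewrite lee_fin invr_ge0 ltW// integral_pgauss_gt0.
rewrite /J -ge0_integralZl//; last exact: mJ.
apply: eq_integral => x _; rewrite /= r0 -/(w x) -!EFinM; congr _%:E.
rewrite mulrCA; congr (_ * _); rewrite -mulrA -expRD; congr (_ * expR _); ring.
Qed.

(** Tilting the density by [exp (- (l - 1) w)] turns the exponent [w] into [l * w], so the scaling
    rule yields a Laplace transform: under [X], [w] follows the Gamma law of shape [r^-1]. *)
Let exp_scale k l : 0 < l ->
  (\int[X]_x (w x ^+ k * expR (- ((l - 1) * w x)))%:E =
   (l `^ (- (r^-1 + k%:R)) * \int[X]_x (w x ^+ k))%:E)%E.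
Proof.
move=> l0; rewrite exp_int// J_scale// muleCA -exp_int// EFinM -EFin_Rintegral//.
by congr *%E; apply: eq_integral => x _; rewrite subrr mul0r oppr0 expR0 mulr1.
Qed.

(** Integrating [1 - (l - 1) w <= exp (- (l - 1) w)] against [w ^+ k] bounds an affine function of
    [l] by a power of [l], with equality at [l = 1]. The equality of slopes given by [powR_tangent]
    is the moment recursion, without integration by parts. *)
Let w_step k : 0 < \int[X]_x (w x ^+ k) ->
  \int[X]_x (w x ^+ k.+1) = (r^-1 + k%:R) * \int[X]_x (w x ^+ k).
Proof.
move=> m0; set m := \int[X]_x (w x ^+ k) in m0 *.
rewrite -[LHS](divfK (lt0r_neq0 m0)); congr (_ * _).
apply: powR_tangent.
  by rewrite divr_ge0 ?(ltW m0)//; apply: Rintegral_ge0 => x _; exact: exprn_ge0.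
move=> l l0; rewrite -(ler_pM2r m0) mulrBl mul1r -mulrA divfK ?gt_eqF//.
have i1 : X.-integrable setT (EFin \o (fun x => (l - 1) * w x ^+ k.+1)).
  exact: (integrableZl measurableT (l - 1) (w_int k.+1)).
rewrite -RintegralZl// -RintegralB//.
have ie : X.-integrable setT (EFin \o (fun x => w x ^+ k * expR (- ((l - 1) * w x)))).
  apply/integrableP; split; first exact: mJ.
  under eq_integral do rewrite /= ger0_norm ?mulr_ge0 ?expR_ge0 ?exprn_ge0//.
  by rewrite exp_scale// ltry.
have -> : l `^ (- (r^-1 + k%:R)) * m = \int[X]_x (w x ^+ k * expR (- ((l - 1) * w x))).
  by rewrite /Rintegral exp_scale.
apply: le_Rintegral => //.
  exact: (integrableB measurableT (w_int k) i1).
move=> x _; rewrite exprSr mulrCA -[X in X - _]mulr1 -mulrBr ler_wpM2l ?exprn_ge0//.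
exact: expR_ge1Dx.
Qed.

Let w0 : \int[X]_x (w x ^+ 0) = 1.
Proof. by under eq_Rintegral do rewrite expr0; rewrite Rintegral_cst1. Qed.

Lemma pgauss_fin_momentr : \int[X]_x (`|x| `^ r) = 1.
Proof.
have w1 : \int[X]_x (w x ^+ 1) = r^-1 by rewrite w_step w0// addr0 mulr1.
have i := w_int 1.
transitivity (r * \int[X]_x (w x ^+ 1)); last by rewrite w1 mulfV// gt_eqF.
rewrite -RintegralZl//; apply: eq_Rintegral => x _.
by rewrite expr1 /w mulrC divfK// gt_eqF.
Qed.

Lemma pgauss_fin_momentr2 : \int[X]_x ((`|x| `^ r) ^+ 2) = 1 + r.
Proof.
have w1 : \int[X]_x (w x ^+ 1) = r^-1 by rewrite w_step w0// addr0 mulr1.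
have w2 : \int[X]_x (w x ^+ 2) = (r^-1 + 1) * r^-1.
  by rewrite w_step w1// invr_gt0.
have i := w_int 2.
transitivity (r ^+ 2 * \int[X]_x (w x ^+ 2)).
  rewrite -RintegralZl//; apply: eq_Rintegral => x _.
  by rewrite -exprMn /w mulrC divfK// gt_eqF.
by rewrite w2; field; rewrite gt_eqF.
Qed.

End pgauss_integral.

Lemma RintegralD_cst d (T : measurableType d) (R : realType) (P : probability T R)
    (f : T -> R) (r : R) : P.-integrable setT (EFin \o f) ->
  \int[P]_x (f x + r) = \int[P]_x f x + r.
Proof.
move=> fi; have ri : P.-integrable setT (EFin \o (fun=> r)).
  exact: finite_measure_integrable_cst.
by rewrite RintegralD// Rintegral_cst1.
Qed.

(** * The case [r = 2]: the standard normal law *)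

Section standard_normal.
Local Arguments pgauss_pdf : simpl never.
Context {R : realType}.
Local Notation mu := (@lebesgue_measure R).
Local Notation N := (pgauss_prob (2%:E : \bar R)).
Local Notation phi := (pgauss_pdf (2%:E : \bar R)).

Let c : R := (2 * 2 `^ 2^-1 * Gamma (2^-1 + 1))^-1.

Let c0 : 0 < c. Proof. by rewrite invr_gt0 integral_pgauss_gt0. Qed.

Let phiE x : phi x = c * expR (- (x ^+ 2 / 2)).
Proof.
by rewrite /pgauss_pdf ltr0n powR_mulrn// real_normK ?num_real.
Qed.

Let phi_ge0 x : 0 <= phi x. Proof. exact: pgauss_pdf_ge0. Qed.

Let mphi : measurable_fun setT phi. Proof. exact: measurable_pgauss_pdf. Qed.

Let mphi_comp (f : R -> R) : measurable_fun setT f ->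
  measurable_fun setT (fun x => (phi (f x))%:E).
Proof. by move=> mf; apply/measurable_EFinP; exact: (measurableT_comp mphi). Qed.

Section ge0_stable.
Variables (h : R -> \bar R) (a b : R).
Hypotheses (mh : measurable_fun setT h) (h0 : forall x, (0 <= h x)%E).
Hypotheses (a0 : 0 < a) (b0 : 0 < b).
Let s := Num.sqrt (a ^+ 2 + b ^+ 2).

Let s0 : 0 < s. Proof. by rewrite sqrtr_gt0 addr_gt0// exprn_gt0. Qed.

Let s2 : s ^+ 2 = a ^+ 2 + b ^+ 2.
Proof. by rewrite sqr_sqrtr// addr_ge0// sqr_ge0. Qed.

(** The joint density of [x] and [z = a x + b y] for independent standard normal [x] and [y]. *)
Let g (x z : R) : R := phi ((z - a * x) / b) / b * phi x.

Let mg : measurable_fun [set: R * R] (fun u => (g u.1 u.2)%:E).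
Proof.
apply/measurable_EFinP; apply: measurable_funM.
  apply: measurable_funM => //; apply: (measurableT_comp mphi).
  apply: measurable_funM => //; apply: measurable_funB => //.
  exact: measurable_funM.
exact: (measurableT_comp mphi).
Qed.

Let g0 x z : (0 <= (g x z)%:E)%E.
Proof. by rewrite lee_fin mulr_ge0// divr_ge0// ltW. Qed.

(* completing the square *)
Let gE x z : g x z = phi (z / s) / b * phi (s / b * x + - (a * z / (b * s))).
Proof.
rewrite /g !phiE.
have E : (z - a * x) / b * ((z - a * x) / b) + x * x =
   z / s * (z / s) + (s / b * x + - (a * z / (b * s))) * (s / b * x + - (a * z / (b * s))).
  have bn : b != 0 by rewrite gt_eqF.
  have sn : s != 0 by rewrite gt_eqF.
  (* Denominators are cleared first, because the identity holds only modulo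
     [s ^+ 2 = a ^+ 2 + b ^+ 2], which [field] does not know. *)
  apply: (mulfI (_ : (b * s) ^+ 2 != 0)); first by rewrite expf_neq0// mulf_neq0.
  have -> : (b * s) ^+ 2 * ((z - a * x) / b * ((z - a * x) / b) + x * x) =
    s ^+ 2 * (z - a * x) ^+ 2 + s ^+ 2 * (b ^+ 2 * x ^+ 2).
    by field; rewrite bn.
  have -> : (b * s) ^+ 2 * (z / s * (z / s) + (s / b * x + - (a * z / (b * s))) *
      (s / b * x + - (a * z / (b * s)))) = b ^+ 2 * z ^+ 2 + (s ^+ 2 * x - a * z) ^+ 2.
    by field; rewrite bn sn.
  by rewrite s2; ring.
have H u v u' v' : u * u + v * v = u' * u' + v' * v' ->
   c * expR (- (u ^+ 2 / 2)) / b * (c * expR (- (v ^+ 2 / 2))) =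
   c * expR (- (u' ^+ 2 / 2)) / b * (c * expR (- (v' ^+ 2 / 2))).
  move=> uv.
  transitivity (c * c / b * (expR (- (u ^+ 2 / 2)) * expR (- (v ^+ 2 / 2)))); first by ring.
  rewrite -expRD (_ : - (u ^+ 2 / 2) + _ = - (u' ^+ 2 / 2) - (v' ^+ 2 / 2)).
    by rewrite expRD; ring.
  by rewrite !expr2; lra.
exact: H.
Qed.

(** Once the square is completed, the integrand in [x] is an affinely transported normal density, so
    the integral follows from total mass 1 whatever the value of [c]. *)
Let int_g z : (\int[mu]_x (g x z)%:E = (phi (z / s) / s)%:E)%E.
Proof.
have sb : 0 < s / b by rewrite divr_gt0.
have mp : measurable_fun setT (fun x => (phi x)%:E) by exact/measurable_EFinP.
have p0 x : (0 <= (phi x)%:E)%E by rewrite lee_fin.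
have E := @ge0_integral_affine R (s / b) (- (a * z / (b * s))) _ sb mp p0.
rewrite integral_pgauss_pdf in E.
under eq_integral do rewrite gE EFinM.
rewrite ge0_integralZl//=.
- have I : (\int[mu]_x (phi (s / b * x + - (a * z / (b * s))))%:E = (b / s)%:E)%E.
    transitivity (((b / s)%:E * ((s / b)%:E *
      \int[mu]_x (phi (s / b * x + - (a * z / (b * s))))%:E))%E).
      by rewrite muleA -EFinM (_ : b / s * (s / b) = 1) ?mul1e//;
        field; rewrite !gt_eqF.
    by rewrite -E mule1.
  by rewrite I -EFinM; congr _%:E; field; rewrite !gt_eqF.
- by apply: mphi_comp; apply: measurable_funD => //; exact: measurable_funM.
- by rewrite lee_fin divr_ge0// ltW.
Qed.

(** The inner integral is rewritten in the variable [z = a x + b y]; Tonelli then integrates [x] out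
    first, leaving the marginal density [int_g]. *)
Lemma ge0_normal_stable :
  (\int[N]_x \int[N]_y h (a * x + b * y) = \int[N]_z h (s * z))%E.
Proof.
have mab x : measurable_fun setT (fun y => a * x + b * y).
  by apply: measurable_funD => //; exact: measurable_funM.
have mF x : measurable_fun setT (fun z => h z * (phi ((z - a * x) / b) / b)%:E)%E.
  apply: emeasurable_funM => //; apply/measurable_EFinP; apply: measurable_funM => //.
  apply: (measurableT_comp mphi); apply: measurable_funM => //.
  exact: measurable_funB.
have F0 x z : (0 <= h z * (phi ((z - a * x) / b) / b)%:E)%E.
  by rewrite mule_ge0// lee_fin divr_ge0// ltW.
have inner x : (\int[N]_y h (a * x + b * y) =
    \int[mu]_z (h z * (phi ((z - a * x) / b) / b)%:E))%E.
  rewrite ge0_integral_pgauss//; last exact: measurableT_comp.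
  rewrite (@ge0_integral_affine R b (a * x) _ b0 (mF x) (F0 x)).
  rewrite -ge0_integralZl//=.
  + apply: eq_integral => y _; rewrite muleCA [b * y + _]addrC; congr *%E.
    rewrite -EFinM; congr _%:E.
    rewrite (_ : (a * x + b * y - a * x) / b = y); last by field; rewrite gt_eqF.
    by rewrite mulrC divfK// gt_eqF.
  + by apply: (measurableT_comp (mF x)); apply: measurable_funD => //; exact: measurable_funM.
  + by rewrite lee_fin ltW.
under eq_integral do rewrite inner.
have mG : measurable_fun [set: measurableTypeR R * measurableTypeR R]
    (fun u => h u.2 * (g u.1 u.2)%:E)%E.
  apply: emeasurable_funM; last exact: mg.
  exact: (measurableT_comp mh).
have G0 u : (0 <= h u.2 * (g u.1 u.2)%:E)%E by rewrite mule_ge0.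
rewrite [LHS]ge0_integral_pgauss; last 2 first.
- apply: (@measurable_fun_fubini_tonelli_F _ _ _ _ R mu
    (fun u => h u.2 * (phi ((u.2 - a * u.1) / b) / b)%:E)%E).
    apply: emeasurable_funM; first exact: (measurableT_comp mh).
    apply/measurable_EFinP; apply: measurable_funM => //.
    apply: (measurableT_comp mphi); apply: measurable_funM => //.
    by apply: measurable_funB => //; exact: measurable_funM.
  by move=> u; exact: F0.
- by move=> x; apply: integral_ge0.
transitivity (\int[mu]_x \int[mu]_z (h z * (g x z)%:E))%E.
  apply: eq_integral => x _; rewrite -ge0_integralZr ?lee_fin//; last exact: mF.
  by apply: eq_integral => z _; rewrite -muleA -EFinM.
transitivity (\int[mu]_z \int[mu]_x (h z * (g x z)%:E))%E.
  exact: (@fubini_tonelli _ _ _ _ R mu mu (fun u => h u.2 * (g u.1 u.2)%:E)%E mG G0).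
transitivity (\int[mu]_z (h z * (phi (z / s) / s)%:E))%E.
  apply: eq_integral => z _; rewrite -int_g ge0_integralZl//.
  exact: (measurableT_comp mg (measurable_pair2 z)).
rewrite ge0_integral_pgauss//; last first.
  by apply: (measurableT_comp mh); exact: measurable_funM.
have mK : measurable_fun setT (fun z => (h z * (phi (z / s) / s)%:E)%E).
  apply: emeasurable_funM => //; apply/measurable_EFinP; apply: measurable_funM => //.
  by apply: (measurableT_comp mphi); exact: measurable_funM.
have K0 z : (0 <= h z * (phi (z / s) / s)%:E)%E.
  by rewrite mule_ge0// lee_fin divr_ge0// ltW.
rewrite (@ge0_integral_affine R s 0 _ s0 mK K0) -ge0_integralZl//=.
- apply: eq_integral => z _; rewrite addr0 muleCA; congr *%E; rewrite -EFinM.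
  congr _%:E; rewrite (_ : s * z / s = z); last by field; rewrite gt_eqF.
  by rewrite mulrC divfK// gt_eqF.
- by apply: (measurableT_comp mK); apply: measurable_funD => //; exact: measurable_funM.
- by rewrite lee_fin ltW.
Qed.

End ge0_stable.

Lemma normal_stable M (f : R -> R) u v w : bounded_lipschitz M f -> 0 <= u -> 0 <= v ->
  \int[N]_x \int[N]_y f (w + Num.sqrt u * x + Num.sqrt v * y) =
  \int[N]_x f (w + Num.sqrt (u + v) * x).
Proof.
move=> fbl; have mf := bounded_lipschitz_measurable fbl; have [fM _] := fbl.
rewrite le_eqVlt => /predU1P[<- v0|u0].
  under eq_Rintegral do under eq_Rintegral do rewrite sqrtr0 mul0r addr0.
  by rewrite Rintegral_cst1 add0r.
rewrite le_eqVlt => /predU1P[<-|v0].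
  under eq_Rintegral do under eq_Rintegral do rewrite sqrtr0 mul0r addr0.
  by under eq_Rintegral do rewrite Rintegral_cst1; rewrite addr0.
set a := Num.sqrt u; set b := Num.sqrt v.
have a0 : 0 < a by rewrite sqrtr_gt0.
have b0 : 0 < b by rewrite sqrtr_gt0.
have sE : Num.sqrt (u + v) = Num.sqrt (a ^+ 2 + b ^+ 2).
  by rewrite !sqr_sqrtr ?ltW.
have M0 : 0 <= M := le_trans (normr_ge0 _) (fM 0).
(* Adding [M] makes the bounded function nonnegative, as the Tonelli version requires; the shift is
   cancelled by [addIr M]. *)
pose h x := f (w + x) + M.
have h0 x : 0 <= h x by have := fM (w + x); rewrite ler_norml /h; lra.
have mfw : measurable_fun setT (fun x => f (w + x)).
  by apply: (measurableT_comp mf); exact: measurable_funD.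
have mh : measurable_fun setT h by exact: measurable_funD.
have hM x : `|h x| <= M + M.
  by have := fM (w + x); rewrite !ler_norml /h => /andP[? ?]; apply/andP; split; lra.
have := @ge0_normal_stable (EFin \o h) a b _ _ a0 b0.
rewrite -sE => /(_ _ _) /= H.
have mab x : measurable_fun setT (fun y => a * x + b * y).
  by apply: measurable_funD => //; exact: measurable_funM.
have mc (k : R) : measurable_fun setT (fun y => k * y) by exact: measurable_funM.
have ih x : N.-integrable setT (EFin \o (fun y => h (a * x + b * y))).
  by apply: (@bounded_integrable _ _ _ _ _ (M + M)) => //; exact: (measurableT_comp mh).
have ifab x : N.-integrable setT (EFin \o (fun y => f (w + a * x + b * y))).
  apply: (@bounded_integrable _ _ _ _ _ M) => //; under eq_fun do rewrite -addrA.
  exact: (measurableT_comp mfw).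
have ifs : N.-integrable setT (EFin \o (fun y => f (w + Num.sqrt (u + v) * y))).
  by apply: (@bounded_integrable _ _ _ _ _ M) => //; exact: (measurableT_comp mfw).
have hE x : \int[N]_y h (a * x + b * y) = \int[N]_y f (w + a * x + b * y) + M.
  by rewrite -RintegralD_cst//; apply: eq_Rintegral => y _; rewrite /h addrA.
have hsE : \int[N]_y h (Num.sqrt (u + v) * y) = \int[N]_y f (w + Num.sqrt (u + v) * y) + M.
  exact: RintegralD_cst.
apply: (addIr M); rewrite -hsE.
have HE : (\int[N]_x (\int[N]_y h (a * x + b * y))%:E)%E =
    (\int[N]_z (h (Num.sqrt (u + v) * z))%:E)%E.
  rewrite -H; last 2 first.
  - exact/measurable_EFinP.
  - by move=> x; rewrite lee_fin.
  by apply: eq_integral => x _; rewrite EFin_Rintegral.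
rewrite [RHS]/Rintegral -HE -/(Rintegral N setT _).
under [RHS]eq_Rintegral do rewrite hE.
rewrite RintegralD_cst//.
have Fbl := bounded_lipschitz_average N (mc b) fbl.
exact: (bounded_lipschitz_shift_integrable N (mc a) w Fbl).
Qed.

Lemma ge0_normal_opp (h : R -> \bar R) : measurable_fun setT h ->
  (forall x, 0 <= h x)%E -> (\int[N]_x h (- x)%R = \int[N]_x h x)%E.
Proof.
move=> mh h0; rewrite !ge0_integral_pgauss//; last exact: measurableT_comp.
pose nu : {measure set (measurableTypeR R) -> \bar R} :=
  pushforward mu (-%R : measurableTypeR R -> measurableTypeR R).
have mN : measurable_fun [set: measurableTypeR R] (-%R : measurableTypeR R -> measurableTypeR R).
  exact: measurable_funN.
rewrite [RHS](eq_measure_integral (nu mN)); last first.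
  by move=> A mA _; apply/esym/lebesgue_measureN.
rewrite ge0_integral_pushforward//=.
- by apply: eq_integral => x _; rewrite !phiE sqrrN.
- by apply: emeasurable_funM => //; exact/measurable_EFinP.
- by move=> x _; rewrite mule_ge0// lee_fin.
Qed.

Let powR2 (x : R) : `|x| `^ 2 = x ^+ 2.
Proof. by rewrite powR_mulrn// real_normK ?num_real. Qed.

(** The mean is zero because the positive and negative parts of [x] are exchanged by the reflection,
    under which the law is invariant. *)
Lemma normal_centered3 : centered3 N (id : R -> R).
Proof.
have mid : measurable_fun setT (id : R -> R) by exact: measurable_id.
have i3 : N.-integrable setT (EFin \o (fun x : R => `|x| ^+ 3)).
  apply/integrableP; split.
    by apply/measurable_EFinP; apply: measurable_funX; exact: normr_measurable.
  under eq_integral do rewrite /= ger0_norm ?exprn_ge0// -powR_mulrn//.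
  exact: pgauss_fin_moment_lty.
split=> //; have [i1 _] := integrable3W mid i3.
have mp : measurable_fun setT (fun x : R => (Num.max x 0)%:E).
  by apply/measurable_EFinP; apply: (measurable_maxr mid); exact: measurable_cst.
have ip : N.-integrable setT (EFin \o (fun x : R => Num.max x 0)).
  apply: (le_integrable measurableT _ _ i1) => // x _ /=.
  by rewrite lee_fin; case: (leP x 0) => x0; rewrite ?normr0 ?normr_ge0.
have iN : N.-integrable setT (EFin \o (fun x : R => Num.max (- x) 0)).
  apply: (le_integrable measurableT _ _ i1) => /=.
    by apply: (measurableT_comp mp); exact: measurable_funN.
  by move=> x _; rewrite lee_fin; case: (leP (- x) 0) => x0; rewrite ?normr0 ?normr_ge0 ?normrN.
transitivity (\int[N]_x (Num.max x 0) - \int[N]_x (Num.max (- x) 0)).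
  rewrite -RintegralB//; apply: eq_Rintegral => x _.
  by case: (leP x 0) => x0; case: (leP (- x) 0) => x1; lra.
rewrite /Rintegral (ge0_normal_opp mp) ?subrr// => x.
by rewrite lee_fin le_max lexx orbT.
Qed.

Lemma normal_second_moment : \int[N]_x (x ^+ 2) = 1.
Proof.
have := @pgauss_fin_momentr R 2 (ltr0n _ 2).
by under eq_Rintegral do rewrite powR2.
Qed.

Let phi1 : phi = normal_pdf 0 1.
Proof.
have n1 : (1 : R) != 0 by rewrite oner_neq0.
have phiN x : phi x = c / normal_peak 1 * normal_pdf 0 1 x.
  rewrite normal_pdfE// phiE /normal_fun subr0 expr1n mulrA divfK; last first.
    by rewrite gt_eqF// normal_peak_gt0.
  by congr (_ * expR _); rewrite mulNr -mulr_natr mul1r.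
have k0 : 0 <= c / normal_peak 1.
  by rewrite divr_ge0// ?ltW// normal_peak_gt0.
have := @integral_pgauss_pdf R 2%:E.
under eq_integral do rewrite phiN EFinM.
rewrite ge0_integralZl//=; last 2 first.
- by apply/measurable_EFinP; exact: measurable_normal_pdf.
- by move=> x _; rewrite lee_fin normal_pdf_ge0.
rewrite integral_normal_pdf mule1 => -[k1].
by apply/funext => x; rewrite phiN k1 mul1r.
Qed.

Lemma Rintegral_normal_prob M (f : R -> R) (s : R) : 0 < s -> measurable_fun setT f ->
  (forall x, `|f x| <= M) -> \int[normal_prob 0 s]_x f x = \int[N]_x f (s * x).
Proof.
move=> s0 mf fM; have M0 : 0 <= M := le_trans (normr_ge0 _) (fM 0).
pose h x := f x + M.
have h0 x : 0 <= h x by have := fM x; rewrite ler_norml /h; lra.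
have mh : measurable_fun setT h by exact: measurable_funD.
have mhE : measurable_fun setT (EFin \o h) by exact/measurable_EFinP.
have ms : measurable_fun setT (fun x : R => s * x) by exact: measurable_funM.
have sn : s != 0 by rewrite gt_eqF.
apply: (addIr M).
have if1 : (normal_prob 0 s).-integrable setT (EFin \o f).
  exact: (@bounded_integrable _ _ _ (normal_prob 0 s) f M mf fM).
have if2 : N.-integrable setT (EFin \o (fun x => f (s * x))).
  by apply: (@bounded_integrable _ _ _ _ _ M) => //; exact: measurableT_comp.
rewrite -RintegralD_cst// -RintegralD_cst//; congr fine.
have h0E x : (0 <= (EFin \o h) x)%E by rewrite lee_fin.
have npE A : measurable A ->
    normal_prob 0 s A = (\int[mu]_(x in A) (normal_pdf 0 s x)%:E)%E by [].
rewrite (@ge0_integral_density _ _ _ mu (normal_prob 0 s) (normal_pdf 0 s)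
  (measurable_normal_pdf 0 s) (normal_pdf_ge0 0 s) npE (EFin \o h) mhE h0E).
rewrite ge0_integral_pgauss; last 2 first.
- exact: (measurableT_comp mhE ms).
- by move=> x; rewrite lee_fin; exact: h0.
have mK : measurable_fun setT (fun x => ((h x)%:E * (normal_pdf 0 s x)%:E)%E).
  by apply: emeasurable_funM => //; apply/measurable_EFinP; exact: measurable_normal_pdf.
have K0 x : (0 <= (h x)%:E * (normal_pdf 0 s x)%:E)%E.
  by rewrite mule_ge0// lee_fin// normal_pdf_ge0.
rewrite (@ge0_integral_affine R s 0 _ s0 mK K0) -ge0_integralZl//=.
- apply: eq_integral => x _; rewrite addr0 muleCA; congr *%E; rewrite -EFinM.
  congr _%:E; rewrite phi1 !normal_pdfE// ?oner_neq0//.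
  rewrite mulrA; congr (_ * _).
    rewrite /normal_peak expr1n mul1r -mulrnAr sqrtrM ?sqr_ge0// sqrtr_sqr gtr0_norm//.
    by rewrite invfM mulrA mulfV// mul1r.
  rewrite /normal_fun !subr0 expr1n exprMn; congr expR; field.
  by rewrite sn.
- by apply: (measurableT_comp mK); apply: measurable_funD => //; exact: measurable_funM.
- by rewrite lee_fin ltW.
Qed.

End standard_normal.

(** * The uniform law on the ball as a p-Gaussian sample *)

Section ball_law.
Context {R : realType}.
Local Open Scope ereal_scope.
Variables (n : nat) (B : set (n.-tuple R)) (mu : probability R R).
(** The class of functions for which the means under the product law and over [B] are proportional:
    those homogeneous of degree 0 for finite [p], all of them for the cube. *)
Variable good : (n.-tuple R -> \bar R) -> Prop.
Hypothesis mB : measurable B.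
Hypothesis good1 : good (cst 1).
Local Notation lam := (lebesgue_tuple R n).

Variable K : \bar R.
Hypothesis K_ge0 : 0 <= K.
Hypothesis iidE : forall g, good g -> measurable_fun setT g -> (forall t, 0 <= g t) ->
  \int[iid mu n]_t g t = K * \int[lam]_(t in B) g t.

(** The identity tested on the constant 1 reads [K * lam B = 1]. This alone shows that the volume is
    positive and finite. *)
Lemma ball_volume : exists v : R, [/\ (0 < v)%R, lam B = v%:E & K = (v^-1)%:E].
Proof.
have K1 : K * lam B = 1.
  have := iidE good1 (@measurable_cst _ _ _ _ setT 1) (fun=> lee01).
  rewrite !integral_cst//= !mul1e => <-; exact: probability_setT.
have vB0 : 0 <= lam B by [].
have : lam B != 0 by apply: contra_eq_neq K1 => ->; rewrite mule0 eq_sym onee_eq0.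
have : lam B != +oo.
  apply: contra_eq_neq K1 => ->.
  by case: (eqVneq K 0) => [->|Kn0];
    rewrite ?mul0e 1?eq_sym ?onee_eq0// gt0_muley// lt0e Kn0.
move: K1 vB0; case vE : (lam B) => [v| |]// K1 v0 _ vn0.
have {v0} v0 : (0 < v)%R by rewrite lt_neqAle eq_sym -lee_fin v0 andbT.
exists v; split => //; have vn : v != 0%R by rewrite gt_eqF.
by rewrite -[K]mule1 -(divff vn) EFinM muleA K1 mul1e.
Qed.

Lemma uniform_ball_law d (T : measurableType d) (P : probability T R)
    (Z : {RV P >-> n.-tuple R}) : uniform_on Z B ->
  forall g, good g -> measurable_fun setT g -> (forall t, 0 <= g t) ->
    \int[P]_w g (Z w) = \int[iid mu n]_t g t.
Proof.
move=> ZB g gg mg g0; have [v [v0 vE KE]] := ball_volume.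
rewrite iidE// KE -(ge0_integral_distribution Z mg g0)/=.
have mf : measurable_fun setT (fun t => \1_B t / v)%R.
  by apply: measurable_funM => //; exact: measurable_indic.
rewrite (@ge0_integral_density _ _ _ lam (distribution P Z) (fun t => \1_B t / v)%R)//.
- rewrite [in RHS]integral_mkcond -ge0_integralZl//.
  + apply: eq_integral => t _; rewrite patchE indicE; case: ifPn => tB.
      by rewrite mul1r muleC.
    by rewrite mul0r !mule0.
  + by apply/(measurable_restrictT _ mB); exact: measurable_funTS.
  + by move=> t _; rewrite patchE; case: ifP.
  + by rewrite lee_fin invr_ge0 ltW.
- by move=> t; rewrite divr_ge0// ltW.
- move=> A mA; transitivity (lam (A `&` B) / lam B); first exact: ZB.
  rewrite vE; under [RHS]eq_integral do rewrite mulrC EFinM.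
  rewrite ge0_integralZl//.
  + by rewrite integral_indic// setIC inver gt_eqF// muleC.
  + by apply: measurable_funTS; exact/measurable_EFinP/measurable_indic.
  + by rewrite lee_fin invr_ge0 ltW.
Qed.

End ball_law.

Section lpball_finite.
Context {R : realType}.
Variables (n : nat) (r : R).
Hypothesis r0 : (0 < r)%R.
Local Notation lam := (lebesgue_tuple R n).
Local Notation mu := (@lebesgue_measure R).

Definition powsum (t : n.-tuple R) : R := \sum_(i < n) `|tnth t i| `^ r.

Lemma powsum_ge0 t : 0 <= powsum t.
Proof. by apply: sumr_ge0 => i _; exact: powR_ge0. Qed.

Lemma measurable_powsum : measurable_fun setT powsum.
Proof.
apply: measurable_sum => i.
apply: (@measurableT_comp _ _ _ _ _ _ (fun x : R => `|x| `^ r)); last exact: measurable_tnth.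
by apply: (measurableT_comp (measurable_powR _)).
Qed.

Lemma powsum_scale c t : 0 < c -> powsum (tuple_scale c t) = c `^ r * powsum t.
Proof.
move=> c0; rewrite /powsum mulr_sumr; apply: eq_bigr => i _.
by rewrite tnth_tuple_scale normrM (gtr0_norm c0) powRM// ltW.
Qed.

Lemma lpnorm_powsum t : lpnorm r%:E (col_of_tuple t) = powsum t `^ r^-1.
Proof. by rewrite /lpnorm; congr (_ `^ _); apply: eq_bigr => i _; rewrite mxE. Qed.

Lemma lpnorm_le_powsum t c : 0 <= c ->
  (lpnorm r%:E (col_of_tuple t) <= c) = (powsum t <= c `^ r).
Proof.
move=> c0; rewrite lpnorm_powsum; apply/idP/idP => h.
  rewrite -[leLHS]powRr1 ?powsum_ge0// -(mulVf (lt0r_neq0 r0)) powRrM.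
  by apply: ge0_ler_powR; rewrite ?nnegrE ?powR_ge0 ?(ltW r0).
rewrite -[leRHS]powRr1// -(mulfV (lt0r_neq0 r0)) powRrM.
by apply: ge0_ler_powR; rewrite ?nnegrE ?powR_ge0 ?powsum_ge0 ?invr_ge0 ?(ltW r0).
Qed.

Lemma lpballE : lpball r%:E n = [set t | powsum t <= 1].
Proof.
by apply/seteqP; split => t /=; rewrite /lpball/= lpnorm_le_powsum// powR1.
Qed.

Lemma measurable_powsum_le c : measurable [set t | powsum t <= c].
Proof.
rewrite (_ : [set t | _] = powsum @^-1` `]-oo, c]); last first.
  by apply/seteqP; split => t /=; rewrite in_itv.
by rewrite -[X in measurable X]setTI; exact: measurable_powsum.
Qed.

Definition homogeneous0 (g : n.-tuple R -> \bar R) :=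
  forall c t, 0 < c -> g (tuple_scale c t) = g t.

Let k : R := (2 * r `^ r^-1 * Gamma (r^-1 + 1))^-1.

(** The weight of level [y] in the mixture: [exp (- y)] times the n-th power of the dilation factor
    that carries the unit ball to [powsum t <= r * y]. Levels [y <= 0] are cut off, since the
    dilation needs a positive factor. *)
Let dens (y : R) : R := \1_`]0, +oo[ y * ((r * y) `^ r^-1) ^+ n * expR (- y).

Let dens_ge0 y : 0 <= dens y.
Proof. by rewrite !mulr_ge0 ?expR_ge0 ?exprn_ge0 ?powR_ge0. Qed.

Let mdens : measurable_fun setT dens.
Proof.
apply: measurable_funM; last by apply: measurableT_comp => //; exact: measurable_funN.
apply: measurable_funM; first exact: measurable_indic.
apply: measurable_funX; apply: (measurableT_comp (measurable_powR _)).
exact: measurable_funM.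
Qed.

Let K : \bar R := ((k ^+ n)%:E * \int[mu]_y (dens y)%:E)%E.

Let k0 : 0 <= k.
Proof. by rewrite invr_ge0 ltW// integral_pgauss_gt0. Qed.

Let K_ge0 : (0 <= K)%E.
Proof.
apply: mule_ge0; first by rewrite lee_fin exprn_ge0.
by apply: integral_ge0 => y _; rewrite lee_fin.
Qed.

Let tailE a : (expR (- a))%:E = (\int[mu]_(y in `[a, +oo[) (expR (- y))%:E)%E.
Proof.
have cE (z : R^o) : {for z, continuous (fun t : R^o => expR (- t))}.
  apply: continuous_comp; last exact: continuous_expR.
  by apply: (@continuousN _ R^o) => //; exact: cvg_id.
have mE : measurable_fun setT (fun y : R => (expR (- y))%:E).
  by apply/measurable_EFinP; apply: measurableT_comp => //; exact: measurable_funN.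
rewrite (@ge0_continuous_FTC2y _ _ (fun t => - expR (- t)) _ 0).
- by rewrite EFinN oppeK add0e.
- by move=> x _; exact: expR_ge0.
- by apply: continuous_subspaceT.
- by rewrite -oppr0; apply: cvgN; exact: cvgr_expR.
- by move=> x _; exact: ex_derive.
- by apply: cvg_at_right_filter; apply: cvgN; exact: cE.
- move=> x _; rewrite derive1N//.
  rewrite derive1_comp// derive1N// derive1_id derive1E.
  by have /funeqP -> := @derive_expR R; rewrite mulrN1 opprK.
Qed.

Let A : set (R * n.-tuple R) := [set z | 0 < z.1 /\ powsum z.2 / r <= z.1].

Let mA : measurable A.
Proof.
rewrite (_ : A = (fst @^-1` `]0, +oo[) `&` ((fun z => z.1 - powsum z.2 / r) @^-1` `[0, +oo[)).
  apply: measurableI; rewrite -[X in measurable X]setTI.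
    exact: measurable_fst.
  apply: (_ : measurable_fun setT (fun z : R * n.-tuple R => _)) => //.
  apply: measurable_funB => //; apply: measurable_funM => //.
  exact: (measurableT_comp measurable_powsum).
by apply/seteqP; split => -[y t] /=; rewrite /A/= !in_itv/= !andbT subr_ge0.
Qed.

Let tail_indic (t : n.-tuple R) :
  ((expR (- (powsum t / r)))%:E = \int[mu]_y (\1_A (y, t) * expR (- y))%:E)%E.
Proof.
have mE : measurable_fun setT (fun y : R => (expR (- y))%:E).
  by apply/measurable_EFinP; apply: measurableT_comp => //; exact: measurable_funN.
set u := powsum t / r.
have u0 : 0 <= u by rewrite divr_ge0 ?powsum_ge0// ltW.
rewrite tailE -integral_itv_obnd_cbnd; last exact: measurable_funTS.
(* [A] demands [0 < y], so the endpoint is excluded exactly when [u = 0]; a single point has measure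
   zero, which lets each case choose its interval. *)
case: (eqVneq u 0) => [uE|un].
  rewrite integral_mkcond; apply: eq_integral => y _.
  rewrite patchE indicE mem_setE in_itv/= andbT uE.
  case: ifPn => y0; [rewrite mem_set ?mul1r//; split => //=; rewrite -/u uE; exact: ltW|].
  by rewrite memNset ?mul0r//= => -[/= y1 _]; rewrite y1 in y0.
have u1 : 0 < u by rewrite lt_neqAle eq_sym un.
rewrite integral_itv_obnd_cbnd; last exact: measurable_funTS.
rewrite integral_mkcond; apply: eq_integral => y _.
rewrite patchE indicE mem_setE in_itv/= andbT.
case: ifPn => y0; [rewrite mem_set ?mul1r//; split => //=; exact: lt_le_trans y0|].
by rewrite memNset ?mul0r//= => -[/= _ y1]; rewrite y1 in y0.
Qed.

(** Dilating the slice of [A] at height [y] back to the unit ball costs the Jacobian and leaves [g]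
    unchanged by homogeneity. *)
Let dilate (g : n.-tuple R -> \bar R) y : homogeneous0 g ->
  measurable_fun setT g -> (forall t, 0 <= g t)%E ->
  (\int[lam]_t (g t * (\1_A (y, t) * expR (- y))%:E) =
   (dens y)%:E * \int[lam]_(t in lpball r%:E n) g t)%E.
Proof.
move=> hg mg g0.
have mi : measurable_fun setT (fun t => (\1_A (y, t) * expR (- y))%:E).
  apply/measurable_EFinP; apply: measurable_funM => //.
  apply: (@measurableT_comp _ _ _ _ _ _ (\1_A : R * n.-tuple R -> R)) => //.
have i0 t : (0 <= (\1_A (y, t) * expR (- y))%:E)%E by rewrite lee_fin mulr_ge0 ?expR_ge0.
have [y0|y0] := leP y 0.
  rewrite /dens indicE memNset ?mul0r ?mul0e; last first.
    by rewrite /= in_itv/= andbT ltNge y0.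
  apply: integral0_eq => t _; rewrite indicE memNset ?mul0r ?mule0// => -[/= y1 _].
  by rewrite ltNge y0 in y1.
have ry : 0 < r * y by rewrite mulr_gt0.
have c0 : 0 < (r * y) `^ r^-1 by rewrite powR_gt0.
rewrite (@ge0_integral_lebesgue_tuple_scale _ _ _ _ c0); last 2 first.
- exact: emeasurable_funM.
- by move=> t; rewrite mule_ge0.
have -> : dens y = ((r * y) `^ r^-1) ^+ n * expR (- y).
  by rewrite /dens indicE mem_set ?mul1r//= in_itv/= andbT.
rewrite EFinM -muleA; congr (_ * _)%E.
have mb : measurable (lpball r%:E n) by rewrite lpballE; exact: measurable_powsum_le.
have mgb : measurable_fun (lpball r%:E n) g by exact: measurable_funTS.
rewrite -ge0_integralZl ?lee_fin ?expR_ge0// [RHS]integral_mkcond.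
apply: eq_integral => t _; rewrite hg// patchE indicE lpballE muleC.
have E : ((y, tuple_scale ((r * y) `^ r^-1) t) \in A) = (powsum t <= 1).
  apply/idP/idP; rewrite inE /A/= powsum_scale// -powRrM mulVf ?gt_eqF//.
    move=> [_]; rewrite powRr1 ?(ltW ry)// ler_pdivrMr// [y * r]mulrC.
    by rewrite -[leRHS]mulr1 ler_pM2l.
  move=> t1; split => //; rewrite powRr1 ?(ltW ry)// ler_pdivrMr// [y * r]mulrC.
  by rewrite -[leRHS]mulr1 ler_pM2l.
rewrite E; have [t1|t1] := boolP (powsum t <= 1); first by rewrite mem_set// mul1r.
by rewrite memNset ?mul0r ?mul0e//; exact/negP.
Qed.

(* Writing [exp (- u)] as the integral of [exp (- y)] over [y >= u] turns the
   Gaussian integral into a mixture of integrals over dilated balls, which by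
   homogeneity are all proportional to the one over the unit ball. *)
Lemma pgauss_homogeneous (g : n.-tuple R -> \bar R) : homogeneous0 g ->
  measurable_fun setT g -> (forall t, 0 <= g t)%E ->
  (\int[iid (pgauss_prob r%:E) n]_t g t = K * \int[lam]_(t in lpball r%:E n) g t)%E.
Proof.
move=> hg mg g0.
have I0 : (0 <= \int[lam]_(t in lpball r%:E n) g t)%E by exact: integral_ge0.
have mG : measurable_fun [set: n.-tuple R * measurableTypeR R]
    (fun z => g z.1 * (\1_A (z.2, z.1) * expR (- z.2))%:E)%E.
  apply: emeasurable_funM; first exact: (measurableT_comp mg).
  apply/measurable_EFinP; apply: measurable_funM.
    apply: (@measurableT_comp _ _ _ _ _ _ (\1_A : R * n.-tuple R -> R)).
      exact: measurable_indic.
    exact: measurable_swap.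
  by apply: measurableT_comp => //; apply: measurable_funN; exact: measurable_snd.
have G0 z : (0 <= g z.1 * (\1_A (z.2, z.1) * expR (- z.2))%:E)%E.
  by rewrite mule_ge0// lee_fin mulr_ge0 ?expR_ge0.
transitivity ((k ^+ n)%:E * \int[lam]_t (g t * (expR (- (powsum t / r)))%:E))%E.
  rewrite (@ge0_integral_iid_density R (pgauss_prob r%:E) (pgauss_pdf r%:E)
    (measurable_pgauss_pdf r%:E) (pgauss_pdf_ge0 r%:E) _ n g mg g0)//.
  rewrite -ge0_integralZl//.
  - apply: eq_integral => t _; rewrite muleCA -EFinM; congr (_ * _%:E)%E.
    rewrite /pgauss_pdf r0 big_split/= prodr_const card_ord; congr (_ * _).
    rewrite -expR_sum; congr expR.
    by rewrite sumrN -mulr_suml.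
  - apply: emeasurable_funM => //; apply/measurable_EFinP.
    apply: measurableT_comp => //; apply: measurable_funN.
    by apply: measurable_funM => //; exact: measurable_powsum.
  - by move=> t _; rewrite mule_ge0// lee_fin expR_ge0.
  - by rewrite lee_fin exprn_ge0.
rewrite /K -muleA; congr (_ * _)%E.
transitivity (\int[lam]_t \int[mu]_y (g t * (\1_A (y, t) * expR (- y))%:E))%E.
  have mty t : measurable_fun [set: measurableTypeR R]
      (fun y => (\1_A (y, t) * expR (- y))%:E).
    apply/measurable_EFinP; apply: measurable_funM.
      apply: (@measurableT_comp _ _ _ _ _ _ (\1_A : R * n.-tuple R -> R)) => //.
    by apply: measurableT_comp => //; exact: measurable_funN.
  have ty0 t y : (0 <= (\1_A (y, t) * expR (- y))%:E)%E.
    by rewrite lee_fin mulr_ge0 ?expR_ge0.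
  by apply: eq_integral => t _; rewrite tail_indic -ge0_integralZl.
transitivity (\int[mu]_y \int[lam]_t (g t * (\1_A (y, t) * expR (- y))%:E))%E.
  exact: (@fubini_tonelli _ _ _ _ R lam mu
    (fun z => g z.1 * (\1_A (z.2, z.1) * expR (- z.2))%:E)%E mG G0).
rewrite -ge0_integralZr//.
- by apply: eq_integral => y _; rewrite dilate.
- exact/measurable_EFinP.
- by move=> y _; rewrite lee_fin.
Qed.

Variables (d : measure_display) (T : measurableType d) (P : probability T R).
Variable Z : {RV P >-> n.-tuple R}.
Hypothesis ZB : uniform_on Z (lpball r%:E n).

Let mB : measurable (lpball r%:E n : set (n.-tuple R)).
Proof. by rewrite lpballE; exact: measurable_powsum_le. Qed.

Let homogeneous0_cst : homogeneous0 (cst 1%E).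
Proof. by []. Qed.

Lemma uniform_lpball_law (g : n.-tuple R -> \bar R) : homogeneous0 g ->
  measurable_fun setT g -> (forall t, 0 <= g t)%E ->
  (\int[P]_w g (Z w) = \int[iid (pgauss_prob r%:E) n]_t g t)%E.
Proof.
exact: (uniform_ball_law mB homogeneous0_cst K_ge0 pgauss_homogeneous ZB).
Qed.

Lemma uniform_lpball_le (c : R) : 0 < c <= 1 ->
  P [set w | lpnorm r%:E (col_of_tuple (Z w)) <= c] = (c ^+ n)%:E.
Proof.
move=> /andP[c0 c1].
pose E := [set t : n.-tuple R | powsum t <= c `^ r].
have mE : measurable E by exact: measurable_powsum_le.
have cr1 : c `^ r <= 1.
  by have := @ge0_ler_powR _ r (ltW r0) c 1; rewrite powR1; apply; rewrite ?nnegrE ?(ltW c0).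
have EB : E `&` lpball r%:E n = E.
  by rewrite lpballE; apply/setIidl => t /= h; exact: le_trans cr1.
transitivity (distribution P Z E).
  rewrite /distribution/= /pushforward; congr (P _).
  by apply/seteqP; split => w /=; rewrite lpnorm_le_powsum// ltW.
rewrite ZB// EB.
have vE : (lam E = (c ^+ n)%:E * lam (lpball r%:E n))%E.
  transitivity (\int[lam]_t (\1_E t)%:E)%E; first by rewrite integral_indic// setIT.
  rewrite (@ge0_integral_lebesgue_tuple_scale _ _ _ _ c0); last 2 first.
  - exact/measurable_EFinP/measurable_indic.
  - by move=> t; rewrite lee_fin.
  congr (_ * _)%E; rewrite -[in RHS](setIT (lpball _ _)) -integral_indic//.
  apply: eq_integral => t _; congr ((_ : bool)%:R)%:E.
  rewrite lpballE; apply/idP/idP; rewrite !inE /E/= powsum_scale//.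
    by rewrite ger_pMr// powR_gt0.
  by rewrite ger_pMr// powR_gt0.
have [v [v0 vB _]] := ball_volume mB homogeneous0_cst K_ge0 pgauss_homogeneous.
by rewrite vE -muleA vB inver (gt_eqF v0) -(EFinM v) mulfV ?mule1// gt_eqF.
Qed.

End lpball_finite.

Section lpball_infinite.
Context {R : realType}.
Variable n : nat.
Local Notation lam := (lebesgue_tuple R n).

Let lpballE : lpball +oo%E n = [set t : n.-tuple R | forall i, tnth t i \in `[-1, 1]].
Proof.
apply/seteqP; split => t; rewrite /lpball /lpnorm/=.
  move=> h i; rewrite in_itv/= -ler_norml (le_trans _ h)//.
  have := @le_bigmax _ _ _ (0 : R) (fun i => `|col_of_tuple t i 0|) i.
  by rewrite mxE.
by move=> h; apply: bigmax_le => // i _; have := h i; rewrite mxE ler_norml in_itv.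
Qed.

Let mB : measurable (lpball +oo%E n : set (n.-tuple R)).
Proof.
rewrite lpballE (_ : [set _ | _] =
    \bigcap_(i in [set: 'I_n]) (@tnth n R ^~ i @^-1` `[-1, 1])); last first.
  by apply/seteqP; split => [t tA i _|t tA i] //=; exact: (tA i I).
apply: fin_bigcap_measurable => // i _; rewrite -[X in measurable X]setTI.
exact: measurable_tnth.
Qed.

(** The product density is [2^-1 ^+ n] times the indicator of the cube, so the proportionality needs
    no homogeneity. *)
Lemma uniform_cube_law d (T : measurableType d) (P : probability T R)
    (Z : {RV P >-> n.-tuple R}) (g : n.-tuple R -> \bar R) :
  uniform_on Z (lpball +oo%E n) -> measurable_fun setT g -> (forall t, 0 <= g t)%E ->
  (\int[P]_w g (Z w) = \int[iid (pgauss_prob +oo%E) n]_t g t)%E.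
Proof.
move=> ZB mg g0.
have K0 : (0 <= ((2^-1 : R) ^+ n)%:E)%E by rewrite lee_fin exprn_ge0.
apply: (uniform_ball_law mB (I : (fun=> True) (cst 1%E)) K0 _ ZB) => // {mg g0}g _ mg g0.
rewrite (@ge0_integral_iid_density R (pgauss_prob +oo%E) (pgauss_pdf +oo%E)
  (measurable_pgauss_pdf +oo%E) (pgauss_pdf_ge0 +oo%E) _ n g mg g0)//.
have mgB : measurable_fun (lpball +oo%E n) g by exact: measurable_funTS.
rewrite -ge0_integralZl// [RHS]integral_mkcond; apply: eq_integral => t _.
rewrite patchE big_split/= prodr_const card_ord muleC EFinM.
case: ifPn => [|] tB; last first.
  have [i ti] : exists i, tnth t i \notin `[-1, 1].
    apply: contrapT => /forallNP h; move: tB; rewrite lpballE => /negP; apply.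
    by rewrite inE => i; have := h i => /negP; rewrite negbK.
  rewrite (bigD1 i)//= indicE memNset ?mul0r ?mule0 ?mul0e//.
  by apply/negP.
rewrite big1 ?mule1// => i _; rewrite indicE mem_set//.
by move: tB; rewrite lpballE inE => /(_ i).
Qed.

End lpball_infinite.

(** * The limit theorem for ratios of weighted means *)

Section linear_combination.
Context {R : realType}.
Variables (mu : probability R R) (f h : R -> R).
Hypotheses (f3 : centered3 mu f) (h3 : centered3 mu h).

Let mf : measurable_fun setT f. Proof. by case: f3. Qed.
Let mh : measurable_fun setT h. Proof. by case: h3. Qed.
Let f3i : mu.-integrable setT (EFin \o (fun x => `|f x| ^+ 3)). Proof. by case: f3. Qed.
Let h3i : mu.-integrable setT (EFin \o (fun x => `|h x| ^+ 3)). Proof. by case: h3. Qed.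
Let f1i : mu.-integrable setT (EFin \o f). Proof. by have [] := integrable3W mf f3i. Qed.
Let h1i : mu.-integrable setT (EFin \o h). Proof. by have [] := integrable3W mh h3i. Qed.
Let f2i : mu.-integrable setT (EFin \o (fun x => f x ^+ 2)).
Proof. by have [] := integrable3W mf f3i. Qed.
Let h2i : mu.-integrable setT (EFin \o (fun x => h x ^+ 2)).
Proof. by have [] := integrable3W mh h3i. Qed.

Lemma integrable_mul3 : mu.-integrable setT (EFin \o (fun x => f x * h x)).
Proof.
apply: (le_integrable measurableT _ _ (integrableD measurableT f2i h2i)) => /=.
  by apply/measurable_EFinP; exact: measurable_funM.
move=> x _; rewrite lee_fin [leRHS]ger0_norm ?addr_ge0 ?sqr_ge0//.
rewrite normrM -(real_normK (num_real (f x))) -(real_normK (num_real (h x))).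
have := sqr_ge0 (`|f x| - `|h x|); have := sqr_ge0 `|f x|; have := sqr_ge0 `|h x|.
lra.
Qed.

Variables a b : R.

Let cube_le (u v : R) : `|u + v| ^+ 3 <= 4 * (`|u| ^+ 3 + `|v| ^+ 3).
Proof.
apply: (@le_trans _ _ ((`|u| + `|v|) ^+ 3)).
  by apply: lerXn2r; rewrite ?nnegrE ?addr_ge0// ler_normD.
set x := `|u|; set y := `|v|.
have x0 : 0 <= x := normr_ge0 u; have y0 : 0 <= y := normr_ge0 v.
(* The difference [4 (x^3 + y^3) - (x + y)^3] is three times this product. *)
have : 0 <= (x + y) * (x - y) ^+ 2 by rewrite mulr_ge0 ?addr_ge0 ?sqr_ge0.
lra.
Qed.

Let af3i : mu.-integrable setT (EFin \o (fun x => 4 * `|a| ^+ 3 * `|f x| ^+ 3)).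
Proof. exact: (integrableZl measurableT (4 * `|a| ^+ 3) f3i). Qed.
Let bh3i : mu.-integrable setT (EFin \o (fun x => 4 * `|b| ^+ 3 * `|h x| ^+ 3)).
Proof. exact: (integrableZl measurableT (4 * `|b| ^+ 3) h3i). Qed.
Let afi : mu.-integrable setT (EFin \o (fun x => a * f x)).
Proof. exact: (integrableZl measurableT a f1i). Qed.
Let bhi : mu.-integrable setT (EFin \o (fun x => b * h x)).
Proof. exact: (integrableZl measurableT b h1i). Qed.

Let bound3i : mu.-integrable setT
  (EFin \o (fun x => 4 * `|a| ^+ 3 * `|f x| ^+ 3 + 4 * `|b| ^+ 3 * `|h x| ^+ 3)).
Proof. exact: (integrableD measurableT af3i bh3i). Qed.

Let bound3 x : `|a * f x + b * h x| ^+ 3 <=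
  4 * `|a| ^+ 3 * `|f x| ^+ 3 + 4 * `|b| ^+ 3 * `|h x| ^+ 3.
Proof. by apply: (le_trans (cube_le _ _)); rewrite !normrM !exprMn; lra. Qed.

Lemma centered3_lin : centered3 mu (fun x => a * f x + b * h x).
Proof.
have ml : measurable_fun setT (fun x => a * f x + b * h x).
  by apply: measurable_funD; exact: measurable_funM.
split=> //.
- apply: (le_integrable measurableT _ _ bound3i) => /=.
    by apply/measurable_EFinP; apply: measurable_funX; exact: measurableT_comp.
  by move=> x _; rewrite lee_fin normrX normr_id [leRHS]ger0_norm ?addr_ge0 ?mulr_ge0 ?exprn_ge0.
- rewrite RintegralD// !RintegralZl//.
  by case: f3 => _ _ ->; case: h3 => _ _ ->; rewrite !mulr0 addr0.
Qed.

Lemma Rintegral_lin3 : \int[mu]_x (`|a * f x + b * h x| ^+ 3) <=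
  4 * `|a| ^+ 3 * \int[mu]_x (`|f x| ^+ 3) + 4 * `|b| ^+ 3 * \int[mu]_x (`|h x| ^+ 3).
Proof.
rewrite -!RintegralZl// -RintegralD//; apply: le_Rintegral => //.
by have [] := centered3_lin.
Qed.

Lemma Rintegral_lin2 : \int[mu]_x ((a * f x + b * h x) ^+ 2) =
  a ^+ 2 * \int[mu]_x (f x ^+ 2) + 2 * a * b * \int[mu]_x (f x * h x)
  + b ^+ 2 * \int[mu]_x (h x ^+ 2).
Proof.
have i1 : mu.-integrable setT (EFin \o (fun x => a ^+ 2 * f x ^+ 2)).
  exact: (integrableZl measurableT (a ^+ 2) f2i).
have i2 : mu.-integrable setT (EFin \o (fun x => 2 * a * b * (f x * h x))).
  exact: (integrableZl measurableT (2 * a * b) integrable_mul3).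
have i3 : mu.-integrable setT (EFin \o (fun x => b ^+ 2 * h x ^+ 2)).
  exact: (integrableZl measurableT (b ^+ 2) h2i).
have i12 : mu.-integrable setT
    (EFin \o (fun x => a ^+ 2 * f x ^+ 2 + 2 * a * b * (f x * h x))).
  exact: (integrableD measurableT i1 i2).
have fhi := integrable_mul3.
rewrite -!RintegralZl// -!RintegralD//.
by apply: eq_Rintegral => x _; ring.
Qed.

End linear_combination.

(** Additivity of the variance; the shift [w] carries the coordinate split off in the induction. *)
Lemma iid_sum_sqr {R : realType} (mu : probability R R) n (xi : 'I_n -> R -> R) w :
  (forall i, centered3 mu (xi i)) ->
  (\int[iid mu n]_t ((w + tuple_sum xi t) ^+ 2)%:E =
   (w ^+ 2 + \sum_(i < n) \int[mu]_x (xi i x ^+ 2))%:E)%E.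
Proof.
elim: n xi w => [|n IH] xi w xi3.
  rewrite big_ord0 addr0 integral_iid0; first by rewrite /tuple_sum big_ord0 addr0.
  apply/measurable_EFinP; apply: measurable_funX; apply: measurable_funD => //.
  by apply: measurable_tuple_sum => -[].
have mxi i : measurable_fun setT (xi i) by have [] := xi3 i.
rewrite ge0_integral_iidS; last 2 first.
- apply/measurable_EFinP; apply: measurable_funX; apply: measurable_funD => //.
  exact: measurable_tuple_sum.
- by move=> t; rewrite lee_fin sqr_ge0.
under eq_integral do under eq_integral do rewrite tuple_sum_cons addrA.
under eq_integral do rewrite IH//.
have [m0 i30 e0] := xi3 ord0; have [i1 i2] := integrable3W m0 i30.
set V := \sum_(i < n) _.
have ic : mu.-integrable setT (EFin \o (fun x : R => w ^+ 2 + V)).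
  exact: finite_measure_integrable_cst.
have i1' : mu.-integrable setT (EFin \o (fun x => 2 * w * xi ord0 x)).
  exact: (integrableZl measurableT (2 * w) i1).
have i12 : mu.-integrable setT (EFin \o (fun x => 2 * w * xi ord0 x + xi ord0 x ^+ 2)).
  exact: (integrableD measurableT i1' i2).
rewrite (eq_integral (EFin \o (fun x =>
    (w ^+ 2 + V) + (2 * w * xi ord0 x + xi ord0 x ^+ 2)))); last first.
  by move=> x _ /=; congr _%:E; ring.
rewrite EFin_Rintegral; last exact: (integrableD measurableT ic i12).
rewrite (RintegralD measurableT ic i12) Rintegral_cst1 (RintegralD measurableT i1' i2).
rewrite (RintegralZl _ measurableT i1) e0.
by rewrite big_ord_recl -/V; congr _%:E; ring.
Qed.

(** * Second-order expansion of the ratio *)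

Section delta_method.
Context {R : realType}.
Variables al ka : R.
Hypotheses (i0 : 0 <= al) (k0 : 0 <= ka).

Let ln_quad (x : R) : `|x| <= 1 / 2 -> x - 2 * x ^+ 2 <= ln (1 + x) <= x.
Proof.
rewrite ler_norml => /andP[x1 x2].
have y0 : 0 < 1 + x by lra.
rewrite le_ln1Dx ?andbT; last lra.
have h : ln (1 + x)^-1 <= (1 + x)^-1 - 1.
  have := @le_ln1Dx R ((1 + x)^-1 - 1); rewrite [1 + (_ - 1)]addrC subrK; apply.
  have : 0 < (1 + x)^-1 by rewrite invr_gt0.
  by lra.
rewrite lnV ?posrE// in h.
have e : (1 + x) * (1 + x)^-1 = 1 by rewrite mulfV// gt_eqF.
have : (1 + x)^-1 <= 1 - x + 2 * x ^+ 2.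
  rewrite -div1r ler_pdivrMr//.
  have : 0 <= x ^+ 2 * (1 + 2 * x) by rewrite mulr_ge0// ?sqr_ge0//; lra.
  lra.
lra.
Qed.

Definition ratio_fun (x y : R) : R := (1 + x) `^ al * (1 + y) `^ (- ka).

(** The function is [exp u] with [u = al * ln (1 + x) - ka * ln (1 + y)], so quadratic bounds for
    the logarithm and the exponential suffice. *)
Lemma ratio_fun_taylor : exists eta C, [/\ 0 < eta, 0 <= C &
  forall x y, `|x| <= eta -> `|y| <= eta -> `|ratio_fun x y| <= 2 /\
   `|ratio_fun x y - 1 - (al * x - ka * y)| <= C * (x ^+ 2 + y ^+ 2)].
Proof.
have al0 := i0; have ka0 := k0; move: al0 ka0 => al0 ka0.
pose s := al + ka + 1.
have s0 : 0 < s by rewrite /s; lra.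
(* [|u| <= 2 * s * (|x| + |y|)], so this radius gives [|u| <= 1 / 2]. In the constant, [2 * s] comes
   from linearizing the logarithms and [16 * s ^+ 2] from twice [u ^+ 2]. *)
exists (1 / (8 * s)), (2 * s + 16 * s ^+ 2); split.
- by rewrite divr_gt0// mulr_gt0.
- by rewrite addr_ge0// mulr_ge0// ?sqr_ge0// ltW.
move=> x y xe ye.
have e2 : 1 / (8 * s) <= 1 / 2 by rewrite ler_pdivrMr ?mulr_gt0//; rewrite /s; lra.
have /andP[lx1 lx2] := ln_quad (le_trans xe e2).
have /andP[ly1 ly2] := ln_quad (le_trans ye e2).
have x1 : 0 < 1 + x.
  by have := le_trans xe e2; rewrite ler_norml => /andP[]; lra.
have y1 : 0 < 1 + y.
  by have := le_trans ye e2; rewrite ler_norml => /andP[]; lra.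
pose u := al * ln (1 + x) - ka * ln (1 + y).
have rE : ratio_fun x y = expR u.
  rewrite /ratio_fun /powR !gt_eqF// -expRD /u; congr expR; ring.
have ns (a : R) : `|a| <= 1 / (8 * s) -> `|a| * (8 * s) <= 1.
  by rewrite ler_pdivlMr// mulr_gt0.
have lnle (a : R) : `|a| <= 1 / (8 * s) -> a - 2 * a ^+ 2 <= ln (1 + a) -> ln (1 + a) <= a ->
    `|ln (1 + a)| <= 2 * `|a|.
  move=> ae l1 l2; have a2 : a ^+ 2 <= `|a| / 2.
    rewrite -(real_normK (num_real a)) expr2.
    by rewrite ler_wpM2l// -div1r (le_trans ae).
  by rewrite ler_norml; have := ler_norm a; have := ler_norm (- a);
    rewrite normrN => ? ?; apply/andP; split; lra.
have nx := lnle _ xe lx1 lx2; have ny := lnle _ ye ly1 ly2.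
have absu : `|u| <= 2 * s * (`|x| + `|y|).
  rewrite (le_trans (ler_normB _ _))// !normrM (ger0_norm i0) (ger0_norm k0).
  have : al * `|ln (1 + x)| <= al * (2 * `|x|) by rewrite ler_wpM2l.
  have : ka * `|ln (1 + y)| <= ka * (2 * `|y|) by rewrite ler_wpM2l.
  have : 0 <= al * `|y| by rewrite mulr_ge0.
  have : 0 <= ka * `|x| by rewrite mulr_ge0.
  have := normr_ge0 x; have := normr_ge0 y.
  by rewrite /s; lra.
have u12 : `|u| <= 1 / 2.
  by apply: (le_trans absu); have := ns _ xe; have := ns _ ye; lra.
have u2 : u ^+ 2 <= 8 * s ^+ 2 * (x ^+ 2 + y ^+ 2).
  rewrite -(real_normK (num_real u)).
  apply: (@le_trans _ _ ((2 * s * (`|x| + `|y|)) ^+ 2)).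
    by apply: lerXn2r; rewrite ?nnegrE ?mulr_ge0 ?addr_ge0// ltW.
  rewrite -(real_normK (num_real x)) -(real_normK (num_real y)).
  have := mulr_ge0 (sqr_ge0 s) (sqr_ge0 (`|x| - `|y|)); lra.
have hu := expR_le_quad u12; have hl := expR_ge1Dx u.
rewrite rE; split.
  rewrite ger0_norm ?expR_ge0//.
  have : u ^+ 2 <= 1 / 4.
    rewrite -(real_normK (num_real u)); have : `|u| ^+ 2 <= (1 / 2) ^+ 2.
      by apply: lerXn2r; rewrite ?nnegrE.
    by rewrite [X in _ <= X](_ : _ = 1 / 4)//; field.
  by have := ler_norm u; lra.
have ux : `|u - (al * x - ka * y)| <= 2 * s * (x ^+ 2 + y ^+ 2).
  have p1 : 0 <= al * (ln (1 + x) - (x - 2 * x ^+ 2)) by rewrite mulr_ge0// subr_ge0.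
  have p2 : 0 <= al * (x - ln (1 + x)) by rewrite mulr_ge0// subr_ge0.
  have p3 : 0 <= ka * (ln (1 + y) - (y - 2 * y ^+ 2)) by rewrite mulr_ge0// subr_ge0.
  have p4 : 0 <= ka * (y - ln (1 + y)) by rewrite mulr_ge0// subr_ge0.
  have q1 : 0 <= al * x ^+ 2 by rewrite mulr_ge0// sqr_ge0.
  have q2 : 0 <= al * y ^+ 2 by rewrite mulr_ge0// sqr_ge0.
  have q3 : 0 <= ka * x ^+ 2 by rewrite mulr_ge0// sqr_ge0.
  have q4 : 0 <= ka * y ^+ 2 by rewrite mulr_ge0// sqr_ge0.
  have := sqr_ge0 x; have := sqr_ge0 y => ? ?.
  by rewrite ler_norml /u /s; apply/andP; split; lra.
move: ux; rewrite !ler_norml => /andP[? ?].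
have := sqr_ge0 x; have := sqr_ge0 y => ? ?.
by apply/andP; split; lra.
Qed.

End delta_method.

(** Lyapunov's inequality from a pointwise bound: [y^3] exceeds [3 / 2 * s * y^2 - s^3 / 2] by
    [(y - s)^2 (y + s / 2)], and the lower bound integrates to [s ^+ 3]. *)
Lemma sqrt_second_le_third {R : realType} (mu : probability R R) (xi : R -> R) :
  centered3 mu xi ->
  Num.sqrt (\int[mu]_x (xi x ^+ 2)) ^+ 3 <= \int[mu]_x (`|xi x| ^+ 3).
Proof.
move=> [mxi i3 _]; have [_ i2] := integrable3W mxi i3.
set v := \int[mu]_x (xi x ^+ 2); set s := Num.sqrt v.
have v0 : 0 <= v by apply: Rintegral_ge0 => x _; exact: sqr_ge0.
have s0 : 0 <= s by exact: sqrtr_ge0.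
have i2' : mu.-integrable setT (EFin \o (fun x => 3 / 2 * s * xi x ^+ 2)).
  exact: (integrableZl measurableT (3 / 2 * s) i2).
have ic : mu.-integrable setT (EFin \o (fun x : R => s ^+ 3 / 2)).
  exact: finite_measure_integrable_cst.
have -> : s ^+ 3 = \int[mu]_x (3 / 2 * s * xi x ^+ 2 - s ^+ 3 / 2).
  rewrite (RintegralB measurableT i2' ic) (RintegralZl _ measurableT i2).
  by rewrite Rintegral_cst1 -/v -(sqr_sqrtr v0) -/s; field.
apply: le_Rintegral => //; first exact: (integrableB measurableT i2' ic).
move=> x _; rewrite -(real_normK (num_real (xi x))); set y := `|xi x|.
have y0 : 0 <= y := normr_ge0 (xi x).
have : 0 <= (y - s) ^+ 2 * (y + s / 2) by rewrite mulr_ge0 ?sqr_ge0// addr_ge0 ?divr_ge0.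
lra.
Qed.

Section ratio_clt.
Context {R : realType}.
Variables (mu : probability R R) (f g : R -> R) (al ka : R).
Hypotheses (f3 : centered3 mu f) (g3 : centered3 mu g).
Hypotheses (al0 : 0 <= al) (ka0 : 0 <= ka).
Local Notation N := (pgauss_prob (2%:E : \bar R)).

Let F2 := \int[mu]_x (f x ^+ 2).
Let G2 := \int[mu]_x (g x ^+ 2).
Let F3 := \int[mu]_x (`|f x| ^+ 3).
Let G3 := \int[mu]_x (`|g x| ^+ 3).
Let FG := \int[mu]_x (f x * g x).
Let m3 := \int[N]_x (`|x| ^+ 3).

Let F20 : 0 <= F2. Proof. by apply: Rintegral_ge0 => x _; exact: sqr_ge0. Qed.
Let G20 : 0 <= G2. Proof. by apply: Rintegral_ge0 => x _; exact: sqr_ge0. Qed.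
Let F30 : 0 <= F3. Proof. by apply: Rintegral_ge0 => x _; exact: exprn_ge0. Qed.
Let G30 : 0 <= G3. Proof. by apply: Rintegral_ge0 => x _; exact: exprn_ge0. Qed.
Let m30 : 0 <= m3. Proof. by apply: Rintegral_ge0 => x _; exact: exprn_ge0. Qed.

(** [num_dev] and [den_dev] are the means [A] and [B] of the overview, for general centered
    functions [f] and [g]. *)
Definition num_dev n (a : 'I_n -> R) (t : n.-tuple R) : R :=
  tuple_sum (fun i x => a i / (\sum_j a j) * f x) t.
Definition den_dev n (t : n.-tuple R) : R := tuple_sum (fun (_ : 'I_n) x => n%:R^-1 * g x) t.
Definition ratio n (a : 'I_n -> R) (t : n.-tuple R) : R :=
  ratio_fun al ka (num_dev a t) (den_dev t).
Definition ratio_dev n (a : 'I_n -> R) (t : n.-tuple R) : R :=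
  (\sum_j a j) * (ratio a t - 1).

Let centered3Z1 c : centered3 mu (fun x => c * f x).
Proof.
have := centered3_lin f3 g3 c 0; congr centered3; apply/funext => x.
by rewrite mul0r addr0.
Qed.

Let centered3Z2 c : centered3 mu (fun x => c * g x).
Proof.
have := centered3_lin f3 g3 0 c; congr centered3; apply/funext => x.
by rewrite mul0r add0r.
Qed.

Lemma measurable_num_dev n (a : 'I_n -> R) : measurable_fun setT (num_dev a).
Proof. by apply: measurable_tuple_sum => i; have [] := centered3Z1 (a i / \sum_j a j). Qed.

Lemma measurable_den_dev n : measurable_fun setT (@den_dev n).
Proof. by apply: measurable_tuple_sum => i; have [] := centered3Z2 n%:R^-1. Qed.

Lemma measurable_ratio n (a : 'I_n -> R) : measurable_fun setT (ratio a).
Proof.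
apply: measurable_funM.
  apply: (measurableT_comp (measurable_powR _)); apply: measurable_funD => //.
  exact: measurable_num_dev.
apply: (measurableT_comp (measurable_powR _)); apply: measurable_funD => //.
exact: measurable_den_dev.
Qed.

Section fixed_n.
Variables (n : nat) (a : 'I_n -> R) (e : R).
Hypotheses (n0 : (0 < n)%N) (a_ge0 : forall i, 0 <= a i) (a_le : forall i, a i <= e).
Hypotheses (a2 : \sum_i a i ^+ 2 = 1) (e1 : e <= 1).

Let r := \sum_i a i.
Let c := r / n%:R.

Let nR : 0 < n%:R :> R. Proof. by rewrite ltr0n. Qed.

Let e0 : 0 <= e.
Proof. by have i := Ordinal n0; apply: le_trans (a_le i). Qed.

(** The unit sum of squares is at most [e] times the sum, so uniformly small weights force the
    prefactor [r] to be large. *)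
Lemma weights_er : 1 <= e * r.
Proof.
rewrite -a2 /r mulr_sumr; apply: ler_sum => i _.
by rewrite expr2 ler_wpM2r.
Qed.

Lemma weights_sum_gt0 : 0 < r.
Proof.
have er := weights_er; rewrite ltNge; apply/negP => r0.
have : e * r <= 0 by rewrite mulr_ge0_le0.
lra.
Qed.

(** Cauchy-Schwarz, read off from the nonnegative sum of squared deviations from the mean weight
    [c]. *)
Lemma weights_sqr : r ^+ 2 <= n%:R.
Proof.
have : 0 <= \sum_i (a i - c) ^+ 2 by apply: sumr_ge0 => i _; exact: sqr_ge0.
under eq_bigr do rewrite sqrrB.
rewrite big_split/= sumrB a2 sumr_const card_ord.
under eq_bigr do rewrite -mulr_natr.
rewrite -!mulr_suml -/r => h.
have E : 1 - r * c * 2 + c ^+ 2 *+ n = 1 - r ^+ 2 / n%:R.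
  by rewrite -mulr_natr /c; field; rewrite gt_eqF.
by move: h; rewrite E subr_ge0 ler_pdivrMr// mul1r.
Qed.

Lemma weights_mean_le : c <= e.
Proof.
rewrite /c ler_pdivrMr// mulr_natr -[n in leRHS]card_ord -sumr_const.
exact: ler_sum.
Qed.

Let c0 : 0 <= c. Proof. by rewrite divr_ge0// ltW// weights_sum_gt0. Qed.

(** The share of coordinate [i] in [r * (al * A - ka * B)]: multiplied by [r], the weights of the
    two means become [a i] and [c]. *)
Let xi (i : 'I_n) (x : R) : R := al * a i * f x + - (ka * c) * g x.

Let xi3 i : centered3 mu (xi i). Proof. exact: centered3_lin. Qed.

(** The variance of the linear part; [r ^+ 2 / n%:R] is the finite-[n] version of [G ^+ 2]. *)
Definition ratio_var : R := al ^+ 2 * F2 - 2 * al * ka * (r ^+ 2 / n%:R) * FG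
  + ka ^+ 2 * (r ^+ 2 / n%:R) * G2.

Let varE : \sum_i \int[mu]_x (xi i x ^+ 2) = ratio_var.
Proof.
rewrite (eq_bigr (fun i => al ^+ 2 * F2 * a i ^+ 2 + - (2 * al * ka * c * FG) * a i
  + (ka * c) ^+ 2 * G2)); last first.
  by move=> i _; rewrite (Rintegral_lin2 f3 g3) -/F2 -/G2 -/FG; ring.
rewrite !big_split/= -!mulr_sumr a2 sumr_const card_ord -/r -mulr_natr.
by rewrite /ratio_var /c; field; rewrite gt_eqF.
Qed.

(** Smallness comes from [\sum_i a i ^+ 3 <= e * \sum_i a i ^+ 2] and from
    [n c^3 = c * (r^2 / n) <= c <= e]. *)
Let xi_third : \sum_i \int[mu]_x (`|xi i x| ^+ 3) <= 4 * (al ^+ 3 * F3 + ka ^+ 3 * G3) * e.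
Proof.
have c3 : n%:R * c ^+ 3 <= e.
  have -> : n%:R * c ^+ 3 = c * (r ^+ 2 / n%:R) by rewrite /c; field; rewrite gt_eqF.
  apply: le_trans weights_mean_le; rewrite ler_piMr//.
  by rewrite ler_pdivrMr// mul1r weights_sqr.
have s3 : \sum_i a i ^+ 3 <= e.
  rewrite -[leRHS]mulr1 -a2 mulr_sumr; apply: ler_sum => i _.
  by rewrite exprS ler_wpM2r// sqr_ge0.
apply: (@le_trans _ _ (\sum_i (4 * al ^+ 3 * F3 * a i ^+ 3 + 4 * ka ^+ 3 * G3 * c ^+ 3))).
  apply: ler_sum => i _; apply: (le_trans (Rintegral_lin3 f3 g3 _ _)).
  rewrite normrN (ger0_norm (mulr_ge0 al0 (a_ge0 i))) (ger0_norm (mulr_ge0 ka0 c0)).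
  by rewrite !exprMn -/F3 -/G3; lra.
rewrite big_split/= -mulr_sumr sumr_const card_ord -mulr_natr.
have p1 : 4 * al ^+ 3 * F3 * \sum_i a i ^+ 3 <= 4 * al ^+ 3 * F3 * e.
  by rewrite ler_wpM2l// !mulr_ge0// exprn_ge0.
have p2 : 4 * ka ^+ 3 * G3 * (n%:R * c ^+ 3) <= 4 * ka ^+ 3 * G3 * e.
  by rewrite ler_wpM2l// !mulr_ge0// exprn_ge0.
lra.
Qed.

(** In the swapping bound, Lyapunov's inequality dominates the Gaussian third moments by those of
    [xi], whence the factor [1 + m3]. *)
Lemma weighted_clt M C phi phi1 phi2 : 0 <= C -> taylor2 M C phi phi1 phi2 ->
  `|\int[iid mu n]_t phi (tuple_sum xi t) - \int[N]_x phi (Num.sqrt ratio_var * x)| <=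
  C * ((1 + m3) * (4 * (al ^+ 3 * F3 + ka ^+ 3 * G3))) * e.
Proof.
move=> C0 T.
have L := lindeberg_swap normal_centered3 normal_second_moment
  (fun M f u v w => @normal_stable R M f u v w) 0 xi3 T.
have E0 : \int[iid mu n]_t phi (0 + tuple_sum xi t) = \int[iid mu n]_t phi (tuple_sum xi t).
  by apply: eq_Rintegral => t _; rewrite add0r.
have E1 : \int[N]_x phi (0 + Num.sqrt (\sum_i \int[mu]_x (xi i x ^+ 2)) * x) =
    \int[N]_x phi (Num.sqrt ratio_var * x).
  by rewrite varE; apply: eq_Rintegral => t _; rewrite add0r.
rewrite E0 E1 in L; apply: (le_trans L).
rewrite -mulrA ler_wpM2l//.
apply: (@le_trans _ _ (\sum_i ((1 + m3) * \int[mu]_x (`|xi i x| ^+ 3)))).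
  apply: ler_sum => i _; rewrite mulrDl mul1r lerD2l ler_wpM2l//.
  exact: sqrt_second_le_third.
by rewrite -mulr_sumr -mulrA ler_wpM2l ?addr_ge0.
Qed.

Let A := num_dev a.
Let B := @den_dev n.

Let sumE t : tuple_sum xi t = r * (al * A t - ka * B t).
Proof.
rewrite /A /B /num_dev /den_dev /tuple_sum !mulr_sumr -sumrB mulr_sumr.
apply: eq_bigr => i _; rewrite /xi -/r /c.
by field; rewrite !gt_eqF// weights_sum_gt0.
Qed.

Let A2 : (\int[iid mu n]_t (A t ^+ 2)%:E = (F2 / r ^+ 2)%:E)%E.
Proof.
have := @iid_sum_sqr R mu n _ 0 (fun i => centered3Z1 (a i / r)).
under eq_integral do rewrite add0r.
move=> ->; congr _%:E; rewrite expr0n/= add0r.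
transitivity (\sum_i (F2 / r ^+ 2 * a i ^+ 2)); last by rewrite -mulr_sumr a2 mulr1.
apply: eq_bigr => i _.
have [mf i3 _] := f3; have [_ i2] := integrable3W mf i3.
transitivity (\int[mu]_x ((a i / r) ^+ 2 * f x ^+ 2)).
  by apply: eq_Rintegral => x _; rewrite exprMn.
by rewrite RintegralZl// -/F2; field; rewrite gt_eqF// weights_sum_gt0.
Qed.

Let B2 : (\int[iid mu n]_t (B t ^+ 2)%:E = (G2 / n%:R)%:E)%E.
Proof.
have := @iid_sum_sqr R mu n _ 0 (fun i => centered3Z2 (n%:R^-1)).
under eq_integral do rewrite add0r.
move=> ->; congr _%:E; rewrite expr0n/= add0r.
have [mg i3 _] := g3; have [_ i2] := integrable3W mg i3.
rewrite sumr_const card_ord.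
have -> : \int[mu]_x ((n%:R^-1 * g x) ^+ 2) = n%:R^-1 ^+ 2 * G2.
  by rewrite -RintegralZl//; apply: eq_Rintegral => x _; rewrite exprMn.
by rewrite -mulr_natr; field; rewrite gt_eqF.
Qed.

Let mA : measurable_fun setT A. Proof. exact: measurable_num_dev. Qed.
Let mB : measurable_fun setT B. Proof. exact: measurable_den_dev. Qed.

Let A2i : (iid mu n).-integrable setT (EFin \o (fun t => A t ^+ 2)).
Proof.
apply/integrableP; split; first by apply/measurable_EFinP; exact: measurable_funX.
by under eq_integral do rewrite /= ger0_norm ?sqr_ge0//; rewrite A2 ltry.
Qed.

Let B2i : (iid mu n).-integrable setT (EFin \o (fun t => B t ^+ 2)).
Proof.
apply/integrableP; split; first by apply/measurable_EFinP; exact: measurable_funX.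
by under eq_integral do rewrite /= ger0_norm ?sqr_ge0//; rewrite B2 ltry.
Qed.

Let AB2i : (iid mu n).-integrable setT (EFin \o (fun t => A t ^+ 2 + B t ^+ 2)).
Proof. exact: (integrableD measurableT A2i B2i). Qed.

Let AB2 : \int[iid mu n]_t (A t ^+ 2 + B t ^+ 2) = F2 / r ^+ 2 + G2 / n%:R.
Proof. by rewrite RintegralD// /Rintegral A2 B2. Qed.

Let r1 : 1 / r <= e.
Proof. by rewrite ler_pdivrMr ?weights_er// weights_sum_gt0. Qed.

(** The quadratic remainder survives multiplication by the large [r], because
    [r * (F2 / r^2 + G2 / n)] is [F2 / r + G2 * c]. The unmultiplied bound follows from [1 <= r]. *)
Let AB2_le : \int[iid mu n]_t (A t ^+ 2 + B t ^+ 2) <= (F2 + G2) * e /\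
  r * \int[iid mu n]_t (A t ^+ 2 + B t ^+ 2) <= (F2 + G2) * e.
Proof.
have r0 := weights_sum_gt0.
have h1 : r * \int[iid mu n]_t (A t ^+ 2 + B t ^+ 2) <= (F2 + G2) * e.
  have -> : r * \int[iid mu n]_t (A t ^+ 2 + B t ^+ 2) = F2 * (1 / r) + G2 * c.
    by rewrite AB2 /c; field; rewrite !gt_eqF.
  by rewrite mulrDl lerD// ler_wpM2l// weights_mean_le.
split=> //; apply: le_trans h1; rewrite ler_peMl//.
  by apply: Rintegral_ge0 => t _; rewrite addr_ge0// sqr_ge0.
apply: (le_trans weights_er); rewrite ler_piMl// ltW//.
Qed.

Section eta.
Variables (eta D : R).
Hypotheses (eta0 : 0 < eta) (D0 : 0 <= D).
Hypothesis taylor : forall x y, `|x| <= eta -> `|y| <= eta -> `|ratio_fun al ka x y| <= 2 /\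
   `|ratio_fun al ka x y - 1 - (al * x - ka * y)| <= D * (x ^+ 2 + y ^+ 2).

Let far t : eta < `|A t| \/ eta < `|B t| -> 1 <= (A t ^+ 2 + B t ^+ 2) / eta ^+ 2.
Proof.
have sq x : eta < `|x| -> eta ^+ 2 <= x ^+ 2.
  move=> h; rewrite -(real_normK (num_real x)).
  by apply: lerXn2r; rewrite ?nnegrE// ltW.
rewrite ler_pdivlMr ?exprn_gt0// mul1r => -[/sq h|/sq h].
  by rewrite (le_trans h)// lerDl sqr_ge0.
by rewrite (le_trans h)// lerDr sqr_ge0.
Qed.

(** Chebyshev's inequality: a ratio above 2 forces [A] or [B] out of the range of the Taylor bound.
    This controls the factor in front of the radial error. *)
Lemma ratio_gt2_le : (\int[iid mu n]_t (\1_[set t | 2 < `|ratio a t| ] t)%:E <=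
  ((F2 + G2) / eta ^+ 2 * e)%:E)%E.
Proof.
have m2 : measurable [set t | 2 < `|ratio a t| ].
  rewrite (_ : [set t | _] = (fun t => `|ratio a t|) @^-1` `]2, +oo[); last first.
    by apply/seteqP; split => t /=; rewrite in_itv/= andbT.
  rewrite -[X in measurable X]setTI.
  apply: (_ : measurable_fun setT _) => //.
  by apply: measurableT_comp => //; exact: measurable_ratio.
have i1 : (iid mu n).-integrable setT
    (EFin \o (fun t => (eta ^+ 2)^-1 * (A t ^+ 2 + B t ^+ 2))).
  exact: (integrableZl measurableT (eta ^+ 2)^-1 AB2i).
apply: (@le_trans _ _ (\int[iid mu n]_t
    ((eta ^+ 2)^-1 * (A t ^+ 2 + B t ^+ 2))%:E)%E).
  apply: ge0_le_integral => //.
  - by apply/measurable_EFinP; exact: measurable_indic.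
  - by have := measurable_int _ i1.
  move=> t _; rewrite lee_fin indicE.
  have q0 : 0 <= (eta ^+ 2)^-1 * (A t ^+ 2 + B t ^+ 2).
    by rewrite mulr_ge0 ?invr_ge0 ?addr_ge0 ?sqr_ge0.
  case: (boolP (t \in _)) => // /set_mem/= h; rewrite mulrC; apply: far.
  have [Ae|Ae] := leP `|A t| eta; last by left.
  have [Be|Be] := leP `|B t| eta; last by right.
  by have [] := taylor Ae Be; rewrite leNgt h.
rewrite EFin_Rintegral// RintegralZl// lee_fin mulrC.
rewrite mulrAC ler_wpM2r ?invr_ge0 ?sqr_ge0//.
by have [] := AB2_le.
Qed.

Lemma ratio_dev_clt M C phi phi1 phi2 : 0 <= C -> taylor2 M C phi phi1 phi2 ->
  (forall x, 0 <= phi x <= 1) ->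
  `|\int[iid mu n]_t phi (ratio_dev a t) - \int[N]_x phi (Num.sqrt ratio_var * x)| <=
  (C * ((1 + m3) * (4 * (al ^+ 3 * F3 + ka ^+ 3 * G3)))
   + (M * D + (eta ^+ 2)^-1) * (F2 + G2)) * e.
Proof.
move=> C0 T phi01; have L := weighted_clt C0 T.
have [phiM _ _ _] := T; have M0 : 0 <= M := le_trans (normr_ge0 _) (phiM.1 0).
have r0 := weights_sum_gt0.
have my : measurable_fun setT (ratio_dev a).
  by apply: measurable_funM => //; apply: measurable_funB => //; exact: measurable_ratio.
have mx : measurable_fun setT (tuple_sum xi).
  by apply: measurable_tuple_sum => i; have [] := xi3 i.
have iy := bounded_lipschitz_integrable (iid mu n) phiM my.
have ix := bounded_lipschitz_integrable (iid mu n) phiM mx.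
(* The multiple of [A t ^+ 2 + B t ^+ 2] that dominates the pointwise error: the first term is the
   Lipschitz constant times [r] times the Taylor remainder, the second covers points outside the
   Taylor range, where the error is at most 1. *)
pose q := M * D * r + (eta ^+ 2)^-1.
have e20 : 0 <= (eta ^+ 2)^-1 by rewrite invr_ge0 sqr_ge0.
have iq : (iid mu n).-integrable setT (EFin \o (fun t => q * (A t ^+ 2 + B t ^+ 2))).
  exact: (integrableZl measurableT q AB2i).
have cmp : `|\int[iid mu n]_t phi (ratio_dev a t) - \int[iid mu n]_t phi (tuple_sum xi t)|
    <= \int[iid mu n]_t (q * (A t ^+ 2 + B t ^+ 2)).
  apply: normr_RintegralB_le => // t.
  have s0 : 0 <= A t ^+ 2 + B t ^+ 2 by rewrite addr_ge0 ?sqr_ge0.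
  have p1 : 0 <= M * D * r * (A t ^+ 2 + B t ^+ 2).
    by rewrite !mulr_ge0// ltW.
  have p2 : 0 <= (eta ^+ 2)^-1 * (A t ^+ 2 + B t ^+ 2) by rewrite mulr_ge0.
  have big : eta < `|A t| \/ eta < `|B t| ->
      `|phi (ratio_dev a t) - phi (tuple_sum xi t)| <= q * (A t ^+ 2 + B t ^+ 2).
    move=> /far h; apply: (@le_trans _ _ 1).
      have /andP[? ?] := phi01 (ratio_dev a t); have /andP[? ?] := phi01 (tuple_sum xi t).
      by rewrite ler_norml; apply/andP; split; lra.
    by rewrite (le_trans h)// mulrC /q mulrDl lerDr.
  have [Ae|Ae] := leP `|A t| eta; last by apply: big; left.
  have [Be|Be] := leP `|B t| eta; last by apply: big; right.
  apply: (le_trans (phiM.2 _ _)); rewrite /q mulrDl -!mulrA.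
  apply: (@le_trans _ _ (M * (D * (r * (A t ^+ 2 + B t ^+ 2))))); last by rewrite lerDl.
  rewrite ler_wpM2l// sumE /ratio_dev -/r -mulrBr normrM (gtr0_norm r0) mulrCA.
  rewrite ler_wpM2l// ?(ltW r0)//.
  by have [_] := taylor Ae Be.
rewrite RintegralZl// in cmp.
have [b1 b2] := AB2_le.
have bq : q * \int[iid mu n]_t (A t ^+ 2 + B t ^+ 2) <=
    (M * D + (eta ^+ 2)^-1) * (F2 + G2) * e.
  rewrite /q mulrDl -[_ * r * _]mulrA.
  have : M * D * (r * \int[iid mu n]_t (A t ^+ 2 + B t ^+ 2)) <= M * D * ((F2 + G2) * e).
    by rewrite ler_wpM2l// mulr_ge0.
  have : (eta ^+ 2)^-1 * \int[iid mu n]_t (A t ^+ 2 + B t ^+ 2) <=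
      (eta ^+ 2)^-1 * ((F2 + G2) * e) by rewrite ler_wpM2l.
  lra.
move: L cmp; rewrite !ler_norml => /andP[? ?] /andP[? ?].
by apply/andP; split; lra.
Qed.

End eta.
End fixed_n.
End ratio_clt.

(** * Moments of the p-Gaussian law and positivity of the limit variance *)

Section pgauss_moments.
Local Arguments pgauss_pdf : simpl never.
Context {R : realType}.
Local Notation mu := (@lebesgue_measure R).

Let mpow (s : R) : measurable_fun setT (fun x : R => `|x| `^ s).
Proof. by apply: (measurableT_comp (measurable_powR _)). Qed.

Let powR_cont s (x : R) : 0 < x < 1 -> {for x, continuous (fun x : R => `|x| `^ s)}.
Proof.
move=> /andP[x0 _].
have -> : (fun x : R => `|x| `^ s) = (fun y : R => y `^ s) \o (fun x : R => `|x|) by [].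
apply: continuous_comp; first exact: norm_continuous.
apply: differentiable_continuous; apply/derivable1_diffP; apply: derivable_powR.
by rewrite in_itv/= andbT normr_gt0 gt_eqF.
Qed.

Section moments.
Variable p : \bar R.
Hypothesis p0 : (0 < p)%E.
Local Notation X := (pgauss_prob p).

Lemma pgauss_moment_lty s : 0 <= s -> (\int[X]_x (`|x| `^ s)%:E < +oo)%E.
Proof.
move=> s0; move: p0; case: p => [r| |]//; first by rewrite lte_fin => r0; exact: pgauss_fin_moment_lty.
move=> _; rewrite ge0_integral_pgauss; last 2 first.
- exact/measurable_EFinP.
- by move=> x; rewrite lee_fin powR_ge0.
apply: (@le_lt_trans _ _ 1%E); last exact: ltry.
have mpdf : measurable_fun setT (fun x => (@pgauss_pdf R +oo%E x)%:E).
  by apply/measurable_EFinP; exact: measurable_pgauss_pdf.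
have mprod : measurable_fun setT (fun x : R => ((`|x| `^ s)%:E * (pgauss_pdf +oo%E x)%:E)%E).
  by apply: emeasurable_funM => //; apply/measurable_EFinP.
rewrite -(@integral_pgauss_pdf R +oo%E); apply: ge0_le_integral => //.
- by move=> x _; rewrite mule_ge0// lee_fin ?powR_ge0// pgauss_pdf_ge0.
- move=> x _; rewrite -EFinM lee_fin /pgauss_pdf indicE.
  case: (boolP (x \in _)) => [|_]; last by rewrite !mulr0.
  move=> /set_mem/=; rewrite in_itv/= -ler_norml => x1; rewrite mulr1 ler_piMl//.
  by have := @ge0_ler_powR _ s s0 `|x| 1; rewrite powR1; apply; rewrite ?nnegrE.
Qed.

Lemma pgauss_moment_integrable s : 0 <= s -> X.-integrable setT (EFin \o (fun x => `|x| `^ s)).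
Proof.
move=> s0; apply/integrableP; split; first exact/measurable_EFinP.
by under eq_integral do rewrite /= ger0_norm ?powR_ge0//; exact: pgauss_moment_lty.
Qed.

Lemma pgauss_pdf_lower : exists2 c, 0 < c & forall x, 0 < x < 1 -> c <= pgauss_pdf p x.
Proof.
have h2 : (0 : R) < 2^-1 by rewrite invr_gt0.
have inf (x : R) : 0 < x < 1 -> (2^-1 : R) <= 2^-1 * \1_`[-1, 1] x.
  move=> /andP[x0 x1]; rewrite indicE mem_set ?mulr1//= in_itv/=.
  by apply/andP; split; lra.
move: p0; rewrite /pgauss_pdf; case: p => [r| |]//; last by move=> _; exists 2^-1.
rewrite lte_fin => r0; rewrite r0.
have k0 : 0 < (2 * r `^ r^-1 * Gamma (r^-1 + 1))^-1 by rewrite invr_gt0 integral_pgauss_gt0.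
exists ((2 * r `^ r^-1 * Gamma (r^-1 + 1))^-1 * expR (- r^-1)).
  by rewrite mulr_gt0// expR_gt0.
move=> x /andP[x0 x1]; rewrite ler_pM2l// ler_expR lerN2 -[leRHS]mul1r.
rewrite ler_wpM2r ?invr_ge0 ?(ltW r0)// gtr0_norm//.
by have := @ge0_ler_powR _ r (ltW r0) x 1; rewrite powR1; apply; rewrite ?nnegrE ?ltW.
Qed.

(** On ]0, 1[ the density is bounded below, so a nonzero value, extended by continuity to an
    interval, would give the integral a positive contribution. *)
Lemma pgauss_sqr_eq0 (u : R -> R) : measurable_fun setT u ->
  (forall x, 0 < x < 1 -> {for x, continuous u}) ->
  (\int[X]_x (u x ^+ 2)%:E)%E = 0%E -> forall x, 0 < x < 1 -> u x = 0.
Proof.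
move=> mfu cu u0 x /andP[x0 x1]; apply/eqP; apply: contraT => ux.
have nux : 0 < `|u x| by rewrite normr_gt0.
have h0 : 0 < `|u x| / 2 by rewrite divr_gt0.
have xx : 0 < x < 1 by rewrite x0.
have /cvgrPdist_le/(_ _ h0)/nbhs_normP[e /= e0 ue] := cu x xx.
(* Just to the right of [x], inside ]0, 1[, [|u|] stays above half of [|u x|]. *)
pose b := Num.min 1 (x + e).
have xb : x < b by rewrite lt_min x1 ltrDl.
have [c c0 pc] := pgauss_pdf_lower.
have msq : measurable_fun setT (fun x => (u x ^+ 2)%:E).
  by apply/measurable_EFinP; exact: measurable_funX.
move: u0; rewrite ge0_integral_pgauss//; last by move=> y; rewrite lee_fin sqr_ge0.
have mprod : measurable_fun setT (fun y => ((u y ^+ 2)%:E * (pgauss_pdf p y)%:E)%E).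
  apply: emeasurable_funM; first exact: msq.
  by apply/measurable_EFinP; exact: measurable_pgauss_pdf.
have prod0 y : (0 <= (u y ^+ 2)%:E * (pgauss_pdf p y)%:E)%E.
  by rewrite mule_ge0// lee_fin ?sqr_ge0// pgauss_pdf_ge0.
move=> I0; suff : (0 < \int[mu]_y ((u y ^+ 2)%:E * (pgauss_pdf p y)%:E))%E by rewrite I0 ltxx.
pose v := (`|u x| / 2) ^+ 2 * c.
have v0 : 0 < v by rewrite mulr_gt0// exprn_gt0.
apply: (@lt_le_trans _ _ (\int[mu]_(y in `]x, b[) v%:E)%E).
  rewrite integral_cst//= lebesgue_measure_itv/= lte_fin xb -EFinB -EFinM lte_fin.
  by rewrite mulr_gt0// subr_gt0.
apply: (@le_trans _ _ (\int[mu]_(y in `]x, b[) ((u y ^+ 2)%:E * (pgauss_pdf p y)%:E))%E).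
  apply: ge0_le_integral => //.
  - by move=> y _; rewrite lee_fin ltW.
  - exact: measurable_funTS.
  - move=> y /=; rewrite in_itv/= lt_min => /and3P[xy y1 ye].
    rewrite -EFinM lee_fin; apply: ler_pM; rewrite ?sqr_ge0 ?(ltW c0)//; last first.
      by apply: pc; rewrite y1 (lt_trans x0).
    have := ue y; rewrite /ball/= distrC gtr0_norm ?subr_gt0// ltrBlDl => /(_ ye) uy.
    rewrite -(real_normK (num_real (u y))); apply: lerXn2r; rewrite ?nnegrE ?(ltW h0)//.
    have := ler_normD (u y) (u x - u y); rewrite addrC subrK; lra.
by apply: ge0_subset_integral.
Qed.

Variable q : R.
Hypothesis q0 : 0 < q.
Local Notation M := (pgauss_moment p q).

Let M_E : M = \int[X]_x (`|x| `^ q).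
Proof. by rewrite /pgauss_moment unlock. Qed.

Lemma pgauss_moment_gt0 : 0 < M.
Proof.
have M0 : 0 <= M by rewrite M_E; apply: Rintegral_ge0 => x _; exact: powR_ge0.
rewrite lt_neqAle M0 andbT eq_sym; apply/negP => /eqP ME.
have iq := pgauss_moment_integrable (ltW q0).
have qe (x : R) : (`|x| `^ (q / 2)) ^+ 2 = `|x| `^ q.
  by rewrite -powR_mulrn ?powR_ge0// -powRrM divfK.
have z : (\int[X]_x ((`|x| `^ (q / 2)) ^+ 2)%:E)%E = 0%E.
  by under eq_integral do rewrite qe; rewrite EFin_Rintegral// -M_E ME.
have h : 0 < (2^-1 : R) < 1 by apply/andP; split; lra.
have := pgauss_sqr_eq0 (mpow _) (fun x => @powR_cont _ x) z h => /eqP.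
by rewrite powR_eq0 normr_eq0 invr_eq0 pnatr_eq0.
Qed.

Definition num_fun (x : R) : R := `|x| `^ q / M - 1.

(** Used with [c = M^-1] for the numerator and [c = 1] for the denominator. The third moment rests
    on [(z + 1)^3 <= 4 z^3 + 4]. *)
Lemma centered3_powB1 (c s : R) : 0 <= s -> c * \int[X]_x (`|x| `^ s) = 1 ->
  centered3 X (fun x => c * `|x| `^ s - 1).
Proof.
move=> s0 c1.
have m : measurable_fun setT (fun x : R => c * `|x| `^ s - 1).
  by apply: measurable_funB => //; exact: measurable_funM.
split=> //; last first.
  have is1 := pgauss_moment_integrable s0.
  have icx : X.-integrable setT (EFin \o (fun x => c * `|x| `^ s)).
    exact: (integrableZl measurableT c is1).
  by rewrite RintegralD_cst// RintegralZl// c1 subrr.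
have s30 : 0 <= s * 3 by rewrite mulr_ge0.
have i3 : X.-integrable setT (EFin \o (fun x => 4 * `|c| ^+ 3 * `|x| `^ (s * 3))).
  exact: (integrableZl measurableT _ (pgauss_moment_integrable s30)).
have ic : X.-integrable setT (EFin \o (fun=> 4 : R)).
  exact: finite_measure_integrable_cst.
apply: (le_integrable measurableT _ _ (integrableD measurableT i3 ic)) => /=.
  by apply/measurable_EFinP; apply: measurable_funX; exact: measurableT_comp.
move=> x _; rewrite lee_fin normrX normr_id [leRHS]ger0_norm; last first.
  by rewrite addr_ge0// !mulr_ge0 ?powR_ge0.
have -> : `|x| `^ (s * 3) = (`|x| `^ s) ^+ 3 by rewrite powRrM powR_mulrn ?powR_ge0.
set y := `|x| `^ s; have y0 : 0 <= y by exact: powR_ge0.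
apply: (@le_trans _ _ ((`|c| * y + 1) ^+ 3)).
  apply: lerXn2r; rewrite ?nnegrE ?addr_ge0 ?mulr_ge0//.
  by rewrite (le_trans (ler_normB _ _))// normrM normr1 (ger0_norm y0).
set z := `|c| * y; have z0 : 0 <= z by rewrite mulr_ge0.
have -> : 4 * `|c| ^+ 3 * y ^+ 3 = 4 * z ^+ 3 by rewrite /z; ring.
have : 0 <= (z + 1) * (z - 1) ^+ 2 by rewrite mulr_ge0 ?addr_ge0 ?sqr_ge0.
lra.
Qed.

Lemma centered3_num_fun : centered3 X num_fun.
Proof.
have := @centered3_powB1 M^-1 q (ltW q0); rewrite -M_E mulVf ?(gt_eqF pgauss_moment_gt0)//.
move=> /(_ erefl); congr centered3; apply/funext => x.
by rewrite /num_fun mulrC.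
Qed.

Let mnum : measurable_fun setT num_fun.
Proof. by have [] := centered3_num_fun. Qed.

Let num_i2 : X.-integrable setT (EFin \o (fun x => num_fun x ^+ 2)).
Proof. by have [m i3 _] := centered3_num_fun; have [] := integrable3W m i3. Qed.

Lemma pgauss_var_num : pgauss_var p q = M ^+ 2 * \int[X]_x (num_fun x ^+ 2).
Proof.
rewrite -RintegralZl// /pgauss_var /variance covariance.unlock expectation.unlock.
congr fine; apply: eq_integral => x _; congr _%:E.
rewrite !fctE /= -[fine _]/(\int[X]_x (`|x| `^ q)) -M_E /num_fun.
by field; rewrite gt_eqF// pgauss_moment_gt0.
Qed.

Let num_cont (x : R) : 0 < x < 1 -> {for x, continuous num_fun}.
Proof.
move=> x01; apply: cvgB; last exact: cvg_cst.
by apply: cvgM; [exact: powR_cont|exact: cvg_cst].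
Qed.

(** Otherwise the q-th power would be constant on ]0, 1[, which its values at 1 / 4 and 1 / 2
    refute. *)
Lemma num_fun_sqr_gt0 : 0 < \int[X]_x (num_fun x ^+ 2).
Proof.
have F0 : 0 <= \int[X]_x (num_fun x ^+ 2) by apply: Rintegral_ge0 => x _; exact: sqr_ge0.
rewrite lt_neqAle F0 andbT eq_sym; apply/negP => /eqP FE.
have z : (\int[X]_x (num_fun x ^+ 2)%:E)%E = 0%E by rewrite EFin_Rintegral// FE.
have e x (x01 : 0 < x < 1) : x `^ q = M.
  have := pgauss_sqr_eq0 mnum num_cont z x01; have /andP[x0 _] := x01.
  rewrite /num_fun gtr0_norm// => /eqP; rewrite subr_eq0 => /eqP h.
  by rewrite -[LHS](divfK (lt0r_neq0 pgauss_moment_gt0)) h mul1r.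
have h2 : 0 < (1 / 2 : R) < 1 by apply/andP; split; lra.
have h4 : 0 < (1 / 4 : R) < 1 by apply/andP; split; lra.
have : (1 / 4 : R) `^ q < (1 / 2) `^ q.
  by apply: gt0_ltr_powR; rewrite ?nnegrE//; lra.
by rewrite (e _ h2) (e _ h4) ltxx.
Qed.

End moments.

Section finite_exponent.
Variables (r q : R).
Hypotheses (r0 : 0 < r) (q0 : 0 < q).
Local Notation X := (pgauss_prob r%:E).
Local Notation M := (pgauss_moment r%:E q).
Local Notation num := (num_fun r%:E q).

Let Er0 : (0 < r%:E)%E. Proof. by rewrite lte_fin. Qed.

Definition den_fun (x : R) : R := `|x| `^ r - 1.

Lemma centered3_den_fun : centered3 X den_fun.
Proof.
have := @centered3_powB1 r%:E Er0 1 r (ltW r0).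
rewrite pgauss_fin_momentr// mulr1 => /(_ erefl); congr centered3; apply/funext => x.
by rewrite /den_fun mul1r.
Qed.

Lemma den_fun_sqr : \int[X]_x (den_fun x ^+ 2) = r.
Proof.
have r20 : 0 <= r * 2 by rewrite mulr_ge0// ltW.
have i1 := pgauss_moment_integrable Er0 (ltW r0).
have i2 : X.-integrable setT (EFin \o (fun x => (`|x| `^ r) ^+ 2)).
  have := pgauss_moment_integrable Er0 r20; congr integrable; apply/funext => x /=.
  by rewrite powRrM powR_mulrn ?powR_ge0.
have i1' : X.-integrable setT (EFin \o (fun x => 2 * `|x| `^ r)).
  exact: (integrableZl measurableT 2 i1).
have i21 : X.-integrable setT (EFin \o (fun x => (`|x| `^ r) ^+ 2 - 2 * `|x| `^ r)).
  exact: (integrableB measurableT i2 i1').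
transitivity (\int[X]_x (((`|x| `^ r) ^+ 2 - 2 * `|x| `^ r) + 1)).
  by apply: eq_Rintegral => x _; rewrite /den_fun; ring.
rewrite RintegralD_cst// (RintegralB measurableT i2 i1') (RintegralZl _ measurableT i1).
by rewrite pgauss_fin_momentr// pgauss_fin_momentr2//; ring.
Qed.

Lemma pgauss_cov_num_den :
  pgauss_cov r%:E r%:E q = M * \int[X]_x (num x * den_fun x).
Proof.
have n3 := centered3_num_fun Er0 q0.
rewrite -(RintegralZl _ measurableT (integrable_mul3 n3 centered3_den_fun)).
have ME : fine (\int[X]_x (`|x| `^ q)%:E)%E = M by rewrite /pgauss_moment expectation.unlock.
have E1 : fine (\int[X]_x (`|x| `^ r)%:E)%E = 1 by exact: pgauss_fin_momentr.
rewrite /pgauss_cov covariance.unlock expectation.unlock.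
congr fine; apply: eq_integral => x _; congr _%:E.
rewrite !fctE /= ME E1 /num_fun /den_fun.
by field; rewrite gt_eqF// pgauss_moment_gt0.
Qed.

(** The expression is the convex combination of [q^-1 ^+ 2] times the second moment of [num], with
    weight [1 - L], and of the second moment [D] of [num / q - den_fun / r], with weight [L]. The
    former is always positive; if [L = 1] then [r != q], and [D = 0] would make a combination of two
    different powers constant on ]0, 1[. It is applied with [L = G ^+ 2]. *)
Lemma limit_var_gt0 (L : R) : 0 <= L <= 1 -> r != q \/ L < 1 ->
  0 < q^-1 ^+ 2 * \int[X]_x (num x ^+ 2)
    - 2 * q^-1 * r^-1 * L * \int[X]_x (num x * den_fun x)
    + r^-1 ^+ 2 * L * \int[X]_x (den_fun x ^+ 2).
Proof.
move=> /andP[L0 L1] rq.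
have n3 := centered3_num_fun Er0 q0; have d3 := centered3_den_fun.
have F0 := num_fun_sqr_gt0 Er0 q0.
pose D := \int[X]_x ((q^-1 * num x + - r^-1 * den_fun x) ^+ 2).
have D0 : 0 <= D by apply: Rintegral_ge0 => x _; exact: sqr_ge0.
have DE := Rintegral_lin2 n3 d3 q^-1 (- r^-1).
rewrite (_ : _ + _ = (1 - L) * (q^-1 ^+ 2 * \int[X]_x (num x ^+ 2)) + L * D); last first.
  by rewrite /D DE; ring.
have qF : 0 < q^-1 ^+ 2 * \int[X]_x (num x ^+ 2) by rewrite mulr_gt0// exprn_gt0// invr_gt0.
have [L1'|L1'] := ltP L 1.
  by rewrite ltr_pwDl ?mulr_ge0// mulr_gt0// subr_gt0.
have {rq} rq : r != q by case: rq => //; rewrite ltNge L1'.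
have -> : L = 1 by apply/le_anti; rewrite L1 L1'.
rewrite subrr mul0r add0r mul1r lt_neqAle D0 andbT eq_sym; apply/negP => /eqP DE0.
have l3 := centered3_lin n3 d3 q^-1 (- r^-1).
have [ml l3i _] := l3; have [_ l2i] := integrable3W ml l3i.
have z : (\int[X]_x ((q^-1 * num x + - r^-1 * den_fun x) ^+ 2)%:E)%E = 0%E.
  by rewrite EFin_Rintegral// -/D DE0.
have cl (x : R) : 0 < x < 1 -> {for x, continuous (fun x => q^-1 * num x + - r^-1 * den_fun x)}.
  move=> x01; apply: cvgD; (apply: cvgM; first exact: cvg_cst);
    (apply: cvgB; last exact: cvg_cst).
  by apply: cvgM; [exact: powR_cont|exact: cvg_cst].
  exact: powR_cont.
have e x (x01 : 0 < x < 1) : (q * M)^-1 * x `^ q - r^-1 * x `^ r = q^-1 - r^-1.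
  have := pgauss_sqr_eq0 Er0 ml cl z x01; have /andP[x0 _] := x01.
  rewrite /num_fun /den_fun gtr0_norm// invfM; lra.
(* At 1 / 2, 1 / 4 and 1 / 8 the two powers form geometric progressions of ratios [u] and [v].
   Successive differences [k1] and [k2] give [u = v], hence equal exponents. *)
have h2 : 0 < (1 / 2 : R) < 1 by apply/andP; split; lra.
have h4 : 0 < (1 / 2 : R) ^+ 2 < 1 by rewrite expr2; apply/andP; split; lra.
have h8 : 0 < (1 / 2 : R) ^+ 3 < 1 by rewrite !exprS expr0; apply/andP; split; lra.
pose u := (1 / 2 : R) `^ q; pose v := (1 / 2 : R) `^ r.
have pw s k : ((1 / 2 : R) ^+ k) `^ s = ((1 / 2) `^ s) ^+ k.
  rewrite -powR_mulrn; last by lra.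
  by rewrite -powRrM [k%:R * s]mulrC powRrM powR_mulrn// powR_ge0.
have e2 := e _ h2; have e4 := e _ h4; have e8 := e _ h8.
rewrite !pw in e4 e8; rewrite -/u -/v in e2 e4 e8.
have lt1 s : 0 < s -> 0 < (1 / 2 : R) `^ s < 1.
  move=> s0; rewrite powR_gt0; last lra.
  have := @gt0_ltr_powR R s s0 (1 / 2) 1; rewrite powR1; apply; rewrite ?nnegrE; lra.
have /andP[u0 u1] := lt1 _ q0; have /andP[v0 v1] := lt1 _ r0.
rewrite -/u in u0 u1; rewrite -/v in v0 v1.
pose a := (q * M)^-1; pose b := r^-1.
have M0 := pgauss_moment_gt0 Er0 q0.
have a0 : 0 < a by rewrite invr_gt0 mulr_gt0.
have b0 : 0 < b by rewrite invr_gt0.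
rewrite -/a -/b in e2 e4 e8.
have k1 : a * u * (1 - u) = b * v * (1 - v) by lra.
have k2 : a * u * (1 - u) * u = b * v * (1 - v) * v by lra.
have uv : u = v.
  have w0 : b * v * (1 - v) != 0 by rewrite !mulf_neq0 ?gt_eqF//; lra.
  by move: k2; rewrite k1; exact: mulfI.
move: rq; apply/negP; rewrite negbK; apply/eqP.
have l0 : ln (1 / 2 : R) < 0 by apply: ln_lt0; apply/andP; split; lra.
have uE t : (1 / 2 : R) `^ t = expR (t * ln (1 / 2)) by rewrite /powR gt_eqF//; lra.
move: uv; rewrite /u /v !uE => /expR_inj /(mulIf (ltr0_neq0 l0)) ->.
by [].
Qed.

End finite_exponent.
End pgauss_moments.

(** * The weighted norm on the ball *)

Section weights.
Context {R : realType}.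
Variables (q : R) (n : nat) (sigma : 'I_n -> R).
Hypotheses (q0 : 0 < q) (sigma0 : forall i, 0 < sigma i).

Let S : R := \sum_(i < n) sigma i `^ (- q).
Let Q : R := \sum_(i < n) sigma i `^ (- (2 * q)).

Definition weight (i : 'I_n) : R := sigma i `^ (- q) / Q `^ 2^-1.
Definition noether : R := (\big[Num.max/0]_(i < n) sigma i `^ (- (2 * q))) / Q.

Lemma weight_ge0 i : 0 <= weight i.
Proof. by rewrite divr_ge0 ?powR_ge0. Qed.

Lemma sum_weight : \sum_i weight i = S / Q `^ 2^-1.
Proof. by rewrite /S mulr_suml. Qed.

Let Q_ge0 : 0 <= Q. Proof. by apply: sumr_ge0 => i _; exact: powR_ge0. Qed.

Let Qsq : (Q `^ 2^-1) ^+ 2 = Q.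
Proof. by rewrite -powR_mulrn ?powR_ge0// -powRrM mulVf ?powRr1// pnatr_eq0. Qed.

Let weight_sqr i : weight i ^+ 2 = sigma i `^ (- (2 * q)) / Q.
Proof.
rewrite /weight expr_div_n Qsq; congr (_ / _).
by rewrite -powR_mulrn ?powR_ge0// -powRrM mulNr [q * _]mulrC.
Qed.

Lemma weight_le i : weight i <= Num.sqrt noether.
Proof.
rewrite -(ger0_norm (weight_ge0 i)) -sqrtr_sqr ler_wsqrtr// weight_sqr.
rewrite ler_wpM2r ?invr_ge0//.
exact: (@le_bigmax _ _ _ (0 : R) (fun i => sigma i `^ (- (2 * q))) i).
Qed.

Hypothesis n0 : (0 < n)%N.

Lemma Q_gt0 : 0 < Q.
Proof.
rewrite lt_neqAle Q_ge0 andbT eq_sym; apply/negP => /eqP.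
move=> /psumr_eq0P => /(_ (fun i _ => powR_ge0 _ _)) /(_ (Ordinal n0) isT).
by apply/eqP; rewrite gt_eqF// powR_gt0.
Qed.

Lemma S_gt0 : 0 < S.
Proof.
rewrite lt_neqAle sumr_ge0 ?andbT 1?eq_sym; last by move=> i _; exact: powR_ge0.
apply/negP => /eqP.
move=> /psumr_eq0P => /(_ (fun i _ => powR_ge0 _ _)) /(_ (Ordinal n0) isT).
by apply/eqP; rewrite gt_eqF// powR_gt0.
Qed.

Lemma sum_weight_sqr : \sum_i weight i ^+ 2 = 1.
Proof.
under eq_bigr do rewrite weight_sqr.
by rewrite -mulr_suml -/Q mulfV// gt_eqF// Q_gt0.
Qed.

Lemma weight_normalized i : weight i / \sum_j weight j = sigma i `^ (- q) / S.
Proof.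
rewrite sum_weight /weight; field.
by rewrite !gt_eqF ?powR_gt0 ?S_gt0 ?Q_gt0.
Qed.

End weights.

Section scaled_norm.
Context {R : realType}.
Variables (q : R) (n : nat) (sigma : 'I_n -> R).
Hypotheses (q0 : 0 < q) (sigma0 : forall i, 0 < sigma i).

Lemma lpnorm_invmx_diag (t : n.-tuple R) :
  lpnorm q%:E (invmx (diag_mx (\row_i sigma i)) *m col_of_tuple t) =
  (\sum_(i < n) sigma i `^ (- q) * `|tnth t i| `^ q) `^ q^-1.
Proof.
have DD : diag_mx (\row_i sigma i) *m diag_mx (\row_i (sigma i)^-1) = 1%:M.
  rewrite mulmx_diag -diag_const_mx; congr diag_mx; apply/rowP => i.
  by rewrite !mxE mulfV// gt_eqF.
have -> : invmx (diag_mx (\row_i sigma i)) = diag_mx (\row_i (sigma i)^-1).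
  have u : diag_mx (\row_i sigma i) \in unitmx by have [] := mulmx1_unit DD.
  by rewrite -[LHS]mulmx1 -DD mulmxA mulVmx// mul1mx.
rewrite /lpnorm; congr (_ `^ _); apply: eq_bigr => i _.
rewrite mul_diag_mx !mxE normrM powRM// ger0_norm ?invr_ge0 ?(ltW (sigma0 i))//.
by rewrite powRN -powR_inv1 ?(ltW (sigma0 i))// -powRrM mulN1r powRN.
Qed.

Variable p : \bar R.
Hypotheses (p0 : (0 < p)%E) (n0 : (0 < n)%N).
Local Notation M := (pgauss_moment p q).
Let S : R := \sum_(i < n) sigma i `^ (- q).

Lemma num_devE (t : n.-tuple R) : 1 + num_dev (num_fun p q) (weight q sigma) t =
  (\sum_(i < n) sigma i `^ (- q) * `|tnth t i| `^ q) / (M * S).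
Proof.
have S0 := S_gt0 q sigma0 n0; have M0 := pgauss_moment_gt0 p0 q0.
rewrite /num_dev /tuple_sum.
under eq_bigr do rewrite weight_normalized// /num_fun mulrBr mulr1.
rewrite sumrB -[X in _ - X]mulr_suml mulfV ?gt_eqF// addrC subrK mulr_suml.
apply: eq_bigr => i _; rewrite -/S; field.
by rewrite !gt_eqF.
Qed.

Lemma num_dev_powR (t : n.-tuple R) :
  (1 + num_dev (num_fun p q) (weight q sigma) t) `^ q^-1 =
  lpnorm q%:E (invmx (diag_mx (\row_i sigma i)) *m col_of_tuple t) /
    (M `^ q^-1 * S `^ q^-1).
Proof.
have S0 := S_gt0 q sigma0 n0; have M0 := pgauss_moment_gt0 p0 q0.
have MS : 0 <= M * S by rewrite mulr_ge0 ?ltW.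
rewrite num_devE lpnorm_invmx_diag powRM ?invr_ge0//; last first.
  by apply: sumr_ge0 => i _; rewrite mulr_ge0 ?powR_ge0.
congr (_ * _); rewrite -powRM ?ltW// -powR_inv1// -powRrM mulN1r powRN.
by [].
Qed.

End scaled_norm.

Section finite_ratio.
Context {R : realType}.
Variables (q r : R) (n : nat) (sigma : 'I_n -> R).
Hypotheses (q0 : 0 < q) (r0 : 0 < r) (sigma0 : forall i, 0 < sigma i) (n0 : (0 < n)%N).
Local Notation M := (pgauss_moment r%:E q).
Let S : R := \sum_(i < n) sigma i `^ (- q).
Let Er0 : (0 < r%:E)%E. Proof. by rewrite lte_fin. Qed.

Definition fin_ratio : n.-tuple R -> R :=
  ratio (num_fun r%:E q) (den_fun r) q^-1 r^-1 (weight q sigma).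

Let nR : 0 < n%:R :> R. Proof. by rewrite ltr0n. Qed.

Let den_devE (t : n.-tuple R) : 1 + den_dev (den_fun r) t = powsum r t / n%:R.
Proof.
rewrite /den_dev /tuple_sum -mulr_sumr /den_fun sumrB sumr_const card_ord.
by rewrite -/(powsum r t); field; rewrite gt_eqF.
Qed.

Let U (t : n.-tuple R) : R := \sum_(i < n) sigma i `^ (- q) * `|tnth t i| `^ q.

Let U0 t : 0 <= U t.
Proof. by apply: sumr_ge0 => i _; rewrite mulr_ge0 ?powR_ge0. Qed.

Let fin_ratioE (t : n.-tuple R) :
  fin_ratio t = (U t / (M * S)) `^ q^-1 * (powsum r t / n%:R) `^ (- r^-1).
Proof.
by rewrite /fin_ratio /ratio /ratio_fun (num_devE q0 sigma0 Er0 n0 t) den_devE.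
Qed.

Lemma fin_ratio_scale c (t : n.-tuple R) : 0 < c ->
  fin_ratio (tuple_scale c t) = fin_ratio t.
Proof.
move=> c0; rewrite !fin_ratioE.
have S0 : 0 < S := S_gt0 q sigma0 n0; have M0 := pgauss_moment_gt0 Er0 q0.
have -> : U (tuple_scale c t) = c `^ q * U t.
  rewrite /U mulr_sumr; apply: eq_bigr => i _.
  by rewrite tnth_tuple_scale normrM (gtr0_norm c0) powRM ?(ltW c0)// mulrCA.
rewrite powsum_scale// -!(mulrA (c `^ _)).
have MS : 0 <= U t / (M * S) by rewrite divr_ge0// mulr_ge0// ltW.
have PN : 0 <= powsum r t / n%:R by rewrite divr_ge0// powsum_ge0.
rewrite (powRM q^-1 (powR_ge0 c q) MS) (powRM (- r^-1) (powR_ge0 c r) PN).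
have -> : (c `^ q) `^ q^-1 = c by rewrite -powRrM mulfV ?gt_eqF// powRr1// ltW.
have -> : (c `^ r) `^ (- r^-1) = c^-1.
  by rewrite -powRrM mulrN mulfV ?gt_eqF// powR_inv1// ltW.
by field; rewrite gt_eqF.
Qed.

(** Separates the normalized norm into a factor of degree 0, whose law is the same under the
    p-Gaussian sample, and the radius, which is close to 1. *)
Lemma fin_ratio_lpnorm (t : n.-tuple R) :
  n%:R `^ r^-1 * lpnorm q%:E (invmx (diag_mx (\row_i sigma i)) *m col_of_tuple t) /
    (M `^ q^-1 * S `^ q^-1) =
  fin_ratio t * lpnorm r%:E (col_of_tuple t).
Proof.
rewrite -mulrA -(num_dev_powR q0 sigma0 Er0 n0 t) fin_ratioE (num_devE q0 sigma0 Er0 n0 t).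
rewrite lpnorm_powsum -/S -/(U t); have P0 := powsum_ge0 r t.
(* At the origin every power of 0 involved, even the negative one, is 0 by convention, so both sides
   vanish. *)
have [PE|Pn] := eqVneq (powsum r t) 0.
  have t0 i : `|tnth t i| = 0.
    have := psumr_eq0P (fun i _ => powR_ge0 `|tnth t i| r) PE (i := i) isT.
    by move=> /eqP; rewrite powR_eq0 => /andP[/eqP].
  have qn : q^-1 != 0 by rewrite invr_eq0 gt_eqF.
  have rn : r^-1 != 0 by rewrite invr_eq0 gt_eqF.
  have -> : U t = 0.
    by rewrite /U big1// => i _; rewrite t0 powR0 ?mulr0// gt_eqF.
  by rewrite PE !mul0r !powR0 ?mulr0// oppr_eq0.
have Pp : 0 < powsum r t by rewrite lt_neqAle eq_sym Pn.
have -> : (powsum r t / n%:R) `^ (- r^-1) = (powsum r t `^ r^-1)^-1 * n%:R `^ r^-1.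
  rewrite powRM ?invr_ge0// powRN -[n%:R^-1]powR_inv1//.
  by rewrite -powRrM mulN1r opprK.
by field; rewrite gt_eqF// powR_gt0.
Qed.

End finite_ratio.

(** * Replacing the radius by 1 *)

Section radial_correction.
Context {R : realType}.
Variables (q r : R) (n : nat) (sigma : 'I_n -> R).
Hypotheses (q0 : 0 < q) (r0 : 0 < r) (sigma0 : forall i, 0 < sigma i) (n0 : (0 < n)%N).
Variables (d : measure_display) (T : measurableType d) (P : probability T R).
Variable Z : {RV P >-> n.-tuple R}.
Hypothesis ZB : uniform_on Z (lpball r%:E n).
Local Notation a := (weight q sigma).
Local Notation X := (iid (pgauss_prob r%:E) n).
Let Er0 : (0 < r%:E)%E. Proof. by rewrite lte_fin. Qed.
Let rho : R := \sum_i a i.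

Definition radial_dev (t : n.-tuple R) : R :=
  rho * (fin_ratio q r sigma t * lpnorm r%:E (col_of_tuple t) - 1).
Definition fin_ratio_dev (t : n.-tuple R) : R := rho * (fin_ratio q r sigma t - 1).

Lemma measurable_fin_ratio : measurable_fun setT (fin_ratio q r sigma).
Proof.
exact: (measurable_ratio q^-1 r^-1 (centered3_num_fun Er0 q0) (centered3_den_fun r0)).
Qed.

Let mnorm : measurable_fun setT (fun t : n.-tuple R => lpnorm r%:E (col_of_tuple t)).
Proof.
under eq_fun do rewrite lpnorm_powsum.
by apply: (measurableT_comp (measurable_powR _)); exact: measurable_powsum.
Qed.

Lemma measurable_radial_dev : measurable_fun setT radial_dev.
Proof.
apply: measurable_funM => //; apply: measurable_funB => //.
by apply: measurable_funM; [exact: measurable_fin_ratio|exact: mnorm].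
Qed.

Let mdev : measurable_fun setT fin_ratio_dev.
Proof.
apply: measurable_funM => //; apply: measurable_funB => //.
exact: measurable_fin_ratio.
Qed.

Lemma Rintegral_fin_ratio_dev (phi : R -> R) : measurable_fun setT phi ->
  (forall x, 0 <= phi x) ->
  \int[P]_w phi (fin_ratio_dev (Z w)) = \int[X]_t phi (fin_ratio_dev t).
Proof.
move=> mphi phi0; congr fine.
apply: (uniform_lpball_law r0 ZB (g := fun t => (phi (fin_ratio_dev t))%:E)).
- by move=> c t c0; rewrite /fin_ratio_dev fin_ratio_scale.
- by apply/measurable_EFinP; exact: (measurableT_comp mphi).
- by move=> t; rewrite lee_fin.
Qed.

Let big : set (n.-tuple R) := [set t | 2 < `|fin_ratio q r sigma t| ].
Let nle (c : R) : set (n.-tuple R) := [set t | lpnorm r%:E (col_of_tuple t) <= c].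

Let mbig : measurable big.
Proof.
rewrite (_ : big = (fun t => `|fin_ratio q r sigma t|) @^-1` `]2, +oo[); last first.
  by apply/seteqP; split => t /=; rewrite in_itv/= andbT.
rewrite -[X in measurable X]setTI.
apply: (_ : measurable_fun setT _) => //.
by apply: measurableT_comp => //; exact: measurable_fin_ratio.
Qed.

Let mnle c : measurable (nle c).
Proof.
rewrite (_ : nle c = (fun t : n.-tuple R => lpnorm r%:E (col_of_tuple t)) @^-1` `]-oo, c]).
  by rewrite -[X in measurable X]setTI; exact: mnorm.
by apply/seteqP; split => t /=; rewrite in_itv.
Qed.

Let indicZ (A : set (n.-tuple R)) : measurable A ->
  P.-integrable setT (EFin \o (fun w => \1_A (Z w) : R)).
Proof.
move=> mA; apply: (@bounded_integrable _ _ _ _ _ 1).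
  by apply: (measurableT_comp (measurable_indic mA)) => //.
by move=> w; rewrite indicE ger0_norm// lern1; case: (_ \in _).
Qed.

Let int_nle (c : R) : 0 < c <= 1 -> \int[P]_w (\1_(nle c) (Z w)) = c ^+ n.
Proof.
move=> c01; have := uniform_lpball_le r0 ZB c01.
set E := [set w | _] => PE.
have mE : measurable E.
  have mZ : measurable_fun setT (Z : T -> n.-tuple R) by exact: measurable_funP.
  by have := mZ measurableT _ (mnle c); rewrite setTI.
transitivity (fine (\int[P]_w (\1_E w)%:E)) => //.
rewrite integral_indic// setIT; exact: (congr1 fine PE).
Qed.

(** If the radius lies in [1 - dl, 1] and the ratio is at most 2, the Lipschitz bound gives an error
    of at most [eps]. The exceptional events cost at most [K * e] and [(1 - dl) ^+ n]. *)
Lemma radial_correction (phi : R -> R) (L K e eps : R) : bounded_lipschitz L phi ->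
  (forall x, 0 <= phi x <= 1) -> 0 < eps <= 1 ->
  (forall i, a i <= e) -> e <= 1 ->
  (\int[X]_t (\1_big t)%:E <= (K * e)%:E)%E ->
  `|\int[P]_w phi (radial_dev (Z w)) - \int[P]_w phi (fin_ratio_dev (Z w))| <=
  eps + (K + 2 * (L + 1) / eps) * e.
Proof.
move=> Lphi phi01 /andP[eps0 eps1] ae e1 Kb.
have L0 : 0 <= L := le_trans (normr_ge0 _) (Lphi.1 0).
have a0 := weight_ge0 q sigma.
have a2 := sum_weight_sqr q sigma0 n0.
have rho0 : 0 < rho := weights_sum_gt0 n0 a0 ae a2.
have er : 1 <= e * rho := weights_er a0 ae a2.
have ce : rho / n%:R <= e := weights_mean_le n0 ae.
have nR : 0 < n%:R :> R by rewrite ltr0n.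
have L1 : L + 1 != 0 by rewrite gt_eqF//; lra.
(* Makes [L * rho * 2 * dl] at most [eps]. It is of order [1 / rho], far above the natural scale
   [1 / n] of the radius because [rho / n <= e]. *)
pose dl := eps / (2 * (L + 1) * rho).
have den0 : 0 < 2 * (L + 1) * rho by rewrite !mulr_gt0//; lra.
have dl0 : 0 < dl by rewrite divr_gt0.
have rho1 : 1 <= rho by rewrite (le_trans er)// ler_piMl// ltW.
have dl1 : dl < 1.
  rewrite ltr_pdivrMr// mul1r (le_lt_trans eps1)//.
  apply: (@lt_le_trans _ _ (2 * (L + 1) * 1)); first by lra.
  by rewrite ler_wpM2l//; lra.
have sdl : 0 < 1 - dl <= 1 by apply/andP; split; lra.
(* The pointwise bound: [eps], plus the indicators of a large ratio, of a radius above 1 (an event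
   of probability zero) and of a radius below [1 - dl]. *)
pose h w : R := eps + (\1_big (Z w) + (1 - \1_(nle 1) (Z w) + \1_(nle (1 - dl)) (Z w))).
have ib := indicZ mbig; have i1 := indicZ (mnle 1); have i2 := indicZ (mnle (1 - dl)).
have ic : P.-integrable setT (EFin \o (fun=> 1 : R)) by exact: finite_measure_integrable_cst.
have ie : P.-integrable setT (EFin \o (fun=> eps : R)) by exact: finite_measure_integrable_cst.
have i11 : P.-integrable setT (EFin \o (fun w => 1 - \1_(nle 1) (Z w))).
  exact: (integrableB measurableT ic i1).
have i12 : P.-integrable setT (EFin \o (fun w => 1 - \1_(nle 1) (Z w) + \1_(nle (1 - dl)) (Z w))).
  exact: (integrableD measurableT i11 i2).
have ib12 : P.-integrable setT (EFin \o (fun w => \1_big (Z w) +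
    (1 - \1_(nle 1) (Z w) + \1_(nle (1 - dl)) (Z w)))).
  exact: (integrableD measurableT ib i12).
have ih : P.-integrable setT (EFin \o h) by exact: (integrableD measurableT ie ib12).
have mTZ : measurable_fun setT (fun w => radial_dev (Z w)).
  by apply: (measurableT_comp measurable_radial_dev).
have mYZ : measurable_fun setT (fun w => fin_ratio_dev (Z w)).
  by apply: (measurableT_comp mdev).
have itz := bounded_lipschitz_integrable P Lphi mTZ.
have iyz := bounded_lipschitz_integrable P Lphi mYZ.
apply: (le_trans (normr_RintegralB_le itz iyz ih _)).
  move=> w; rewrite /h; set t := Z w.
  have i01 A : 0 <= (\1_A t : R) by rewrite indicE.
  have i01' A : (\1_A t : R) <= 1 by rewrite indicE lern1; case: (_ \in _).
  have one : `|phi (radial_dev t) - phi (fin_ratio_dev t)| <= 1.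
    have /andP[? ?] := phi01 (radial_dev t); have /andP[? ?] := phi01 (fin_ratio_dev t).
    by rewrite ler_norml; apply/andP; split; lra.
  have := i01 big; have := i01' (nle 1); have := i01 (nle (1 - dl)) => b3 b2 b1.
  have [tb|tb] := ltP 2 `|fin_ratio q r sigma t|.
    have -> : \1_big t = 1 :> R by rewrite indicE mem_set.
    lra.
  have [t1|t1] := leP (lpnorm r%:E (col_of_tuple t)) 1; last first.
    have -> : \1_(nle 1) t = 0 :> R by rewrite indicE memNset//; apply/negP; rewrite -ltNge.
    lra.
  have [t2|t2] := leP (lpnorm r%:E (col_of_tuple t)) (1 - dl).
    have -> : \1_(nle (1 - dl)) t = 1 :> R by rewrite indicE mem_set.
    lra.
  apply: (@le_trans _ _ eps); last lra.
  apply: (le_trans (Lphi.2 _ _)).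
  rewrite /radial_dev /fin_ratio_dev -mulrBr opprB addrA subrK.
  set x := fin_ratio _ _ _ _ in tb *; set y := lpnorm _ _ in t1 t2 *.
  clearbody x y; rewrite (_ : x * y - x = x * (y - 1)); last by ring.
  rewrite !normrM (gtr0_norm rho0).
  have y1 : `|y - 1| <= dl by rewrite ler_norml; apply/andP; split; lra.
  have xy : `|x| * `|y - 1| <= 2 * dl by rewrite ler_pM.
  have rxy : rho * (`|x| * `|y - 1|) <= rho * (2 * dl) by rewrite ler_wpM2l// ltW.
  apply: (@le_trans _ _ (L * (rho * (2 * dl)))); first exact: (ler_wpM2l L0 rxy).
  have -> : L * (rho * (2 * dl)) = eps * (L / (L + 1)).
    by rewrite /dl; field; rewrite L1 ?(gt_eqF rho0) ?(gt_eqF eps0) ?(gt_eqF nR).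
  by rewrite ler_piMr ?(ltW eps0)// ler_pdivrMr; lra.
rewrite (RintegralD measurableT ie ib12) (RintegralD measurableT ib i12).
rewrite (RintegralD measurableT i11 i2) (RintegralB measurableT ic i1).
rewrite !Rintegral_cst1 int_nle ?ltr01 ?lexx// int_nle// expr1n subrr add0r lerD2l.
have bK : \int[P]_w (\1_big (Z w)) <= K * e.
  rewrite -lee_fin -EFin_Rintegral//; apply: le_trans Kb; rewrite le_eqVlt; apply/orP; left.
  apply/eqP; apply: (uniform_lpball_law r0 ZB (g := fun t => (\1_big t)%:E)).
  - move=> c t c0; have E : (tuple_scale c t \in big) = (t \in big).
      by apply/idP/idP => /set_mem tb; apply/mem_set; move: tb; rewrite /big/= fin_ratio_scale.
    exact: (congr1 (fun b : bool => (b%:R : R)%:E) E).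
  - by apply/measurable_EFinP; exact: measurable_indic.
  - by move=> t; rewrite lee_fin.
(* The chain is [(1 - dl)^n <= exp (- n dl) <= 1 / (n dl)], and the last term is a multiple of
   [rho / n]. *)
have pw : (1 - dl) ^+ n <= 2 * (L + 1) / eps * e.
  apply: (@le_trans _ _ (expR (- (n%:R * dl)))).
    rewrite -(mulrN n%:R dl) expRM_natl.
    by apply: lerXn2r; rewrite ?nnegrE ?expR_ge0//; [lra|exact: expR_ge1Dx].
  have nd : 0 < n%:R * dl by rewrite mulr_gt0.
  have -> : expR (- (n%:R * dl)) = (expR (n%:R * dl))^-1 by rewrite expRN.
  apply: (@le_trans _ _ (n%:R * dl)^-1).
    rewrite lef_pV2 ?posrE ?expR_gt0//.
    by apply: le_trans (expR_ge1Dx _); rewrite lerDr.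
  have -> : (n%:R * dl)^-1 = 2 * (L + 1) / eps * (rho / n%:R).
    by rewrite /dl; field; rewrite L1 ?(gt_eqF rho0) ?(gt_eqF eps0) ?(gt_eqF nR).
  by rewrite ler_wpM2l// divr_ge0// ?ltW// mulr_gt0//; lra.
by rewrite mulrDl lerD.
Qed.

End radial_correction.

(** [K] may depend on [eps], as it does in [radial_correction], where a factor [1 / eps] appears; so
    [eps] is fixed before [n] grows. *)
Lemma cvg_approx {R : realType} (u v e : R^nat) (l : R) :
  e @ \oo --> (0 : R) -> v @ \oo --> l ->
  (forall eps, 0 < eps <= 1 -> exists K, \forall n \near \oo, `|u n - v n| <= eps + K * e n) ->
  u @ \oo --> l.
Proof.
move=> e0 vl H; apply/cvgrPdist_le => eps eps0.
pose ep := Num.min 1 (eps / 3).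
have ep0 : 0 < ep <= 1 by rewrite lt_min ltr01 divr_gt0//= ge_min lexx.
have epe : ep <= eps / 3 by rewrite ge_min lexx orbT.
have [K HK] := H _ ep0.
have e3 : 0 < eps / 3 by rewrite divr_gt0.
have /cvgrPdist_le/(_ _ e3) Ke : K * e n @[n --> \oo] --> (0 : R).
  by rewrite -(mulr0 K); apply: cvgM => //; exact: cvg_cst.
move/cvgrPdist_le/(_ _ e3) : vl => vl.
near=> n.
have h1 : `|u n - v n| <= ep + K * e n by near: n.
have h2 : `|l - v n| <= eps / 3 by near: n.
have h3 : `|0 - K * e n| <= eps / 3 by near: n.
move: h1 h2 h3; rewrite sub0r normrN !ler_norml => /andP[? ?] /andP[? ?] /andP[? ?].
by apply/andP; split; lra.
Unshelve. all: by end_near. Qed.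

(** * Passage to the limit *)

Section limits.
Context {R : realType}.

Lemma normal_prob_scale_cvg (M : R) (phi : R -> R) (v : R^nat) (s2 : R) :
  bounded_lipschitz M phi -> 0 < s2 -> v @ \oo --> s2 ->
  \int[pgauss_prob 2%:E]_x phi (Num.sqrt (v n) * x) @[n --> \oo] -->
  \int[normal_prob 0 (Num.sqrt s2)]_x phi x.
Proof.
move=> Lphi s0 vs; have mphi := bounded_lipschitz_measurable Lphi.
rewrite (Rintegral_normal_prob _ mphi Lphi.1) ?sqrtr_gt0//.
apply: (@bounded_convergence _ _ _ (pgauss_prob 2%:E)
  (fun n x => phi (Num.sqrt (v n) * x)) (fun x => phi (Num.sqrt s2 * x)) M).
- by move=> n; apply: (measurableT_comp mphi); exact: measurable_funM.
- by move=> n x; exact: Lphi.1.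
- move=> x; have vx : Num.sqrt (v n) * x @[n --> \oo] --> Num.sqrt s2 * x.
    apply: cvgM; last exact: cvg_cst.
    exact: (continuous_cvg _ (@sqrt_continuous R s2) vs).
  have px := continuous_cvg _ (@bounded_lipschitz_continuous _ _ _ Lphi (Num.sqrt s2 * x)) vx.
  exact: px.
Qed.

Variables (q : R) (sigma : forall n : nat, 'I_n -> R).
Arguments sigma : clear implicits.
Hypotheses (q0 : 0 < q) (sigma0 : forall n i, 0 < sigma n i).
Arguments sigma0 : clear implicits.
Hypothesis noether_cvg : noether q (sigma n) @[n --> \oo] --> (0 : R).
Let e n : R := Num.sqrt (noether q (sigma n)).

Let e_cvg : e @ \oo --> (0 : R).
Proof.
have se := continuous_cvg _ (@sqrt_continuous R 0) noether_cvg.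
by rewrite sqrtr0 in se; exact: se.
Qed.

Let e_le1 : \forall n \near \oo, e n <= 1.
Proof. by apply: (cvgr_le 0) => //; exact: e_cvg. Qed.

(** Kept general in the law and in [f] and [g], so as to serve finite [p] and also [p = +oo], where
    [g] and [ka] are 0. *)
Lemma ratio_dev_spline_cvg (mu : probability R R) (f g : R -> R) (al ka s2 x0 k : R) :
  centered3 mu f -> centered3 mu g -> 0 <= al -> 0 <= ka -> 0 < s2 -> 0 < k ->
  ratio_var mu f g al ka (weight q (sigma n)) @[n --> \oo] --> s2 ->
  \int[iid mu n]_t spline3 ((ratio_dev f g al ka (weight q (sigma n)) t - x0) * k)
    @[n --> \oo] -->
  \int[normal_prob 0 (Num.sqrt s2)]_x spline3 ((x - x0) * k).
Proof.
move=> f3 g3 al0 ka0 s0 k0 vs.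
have [M [C [phi1 [phi2 tay]]]] := spline3_taylor2 x0 k0.
have [eta [D [eta0 D0 rat]]] := ratio_fun_taylor al0 ka0.
pose phi (x : R) := spline3 ((x - x0) * k).
(* The Taylor bound at [w = 0], [h = 1] has a nonnegative left-hand side. *)
have C0 : 0 <= C.
  case: tay => _ _ _ /(_ 0 1) t; have := le_trans (normr_ge0 _) t.
  by rewrite normr1 expr1n mulr1.
have [Lphi _ _ _] := tay.
apply: (cvg_approx e_cvg (normal_prob_scale_cvg Lphi s0 vs)) => eps /andP[eps0 _].
eexists; near=> n.
have n0 : (0 < n)%N by near: n; exists 1%N.
have e1 : e n <= 1 by near: n.
have := ratio_dev_clt f3 g3 al0 ka0 n0 (weight_ge0 q (sigma n)) (weight_le q (sigma n))
  (sum_weight_sqr q (sigma0 n) n0) e1 eta0 D0 rat C0 tay (fun x => spline3_itv _).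
move/le_trans; apply; apply: (ler_wpDl (ltW eps0)); exact: lexx.
Unshelve. all: by end_near. Qed.

Lemma radial_dev_spline_cvg (r s2 x0 k : R) (d : nat -> measure_display)
    (T : forall n : nat, measurableType (d n)) (P : forall n : nat, probability (T n) R)
    (Z : forall n : nat, {RV (P n) >-> n.-tuple R}) :
  0 < r -> (forall n, uniform_on (Z n) (lpball r%:E n)) -> 0 < s2 -> 0 < k ->
  ratio_var (pgauss_prob r%:E) (num_fun r%:E q) (den_fun r) q^-1 r^-1 (weight q (sigma n))
    @[n --> \oo] --> s2 ->
  \int[P n]_w spline3 ((radial_dev q r (sigma n) (Z n w) - x0) * k) @[n --> \oo] -->
  \int[normal_prob 0 (Num.sqrt s2)]_x spline3 ((x - x0) * k).
Proof.
move=> r0 ZB s0 k0 vs; have Er0 : (0 < r%:E)%E by rewrite lte_fin.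
have al0 : 0 <= q^-1 by rewrite invr_ge0 ltW.
have ka0 : 0 <= r^-1 by rewrite invr_ge0 ltW.
have f3 := centered3_num_fun Er0 q0; have g3 := centered3_den_fun r0.
have [M [C [phi1 [phi2 [Lphi _ _ _]]]]] := spline3_taylor2 x0 k0.
have [eta [D [eta0 D0 rat]]] := ratio_fun_taylor al0 ka0.
pose phi (x : R) := spline3 ((x - x0) * k).
have phi01 x : 0 <= phi x <= 1 by exact: spline3_itv.
have lim := ratio_dev_spline_cvg (x0 := x0) f3 g3 al0 ka0 s0 k0 vs.
apply: (cvg_approx e_cvg lim) => eps eps01.
eexists; near=> n.
have n0 : (0 < n)%N by near: n; exists 1%N.
have e1 : e n <= 1 by near: n.
have mphi := bounded_lipschitz_measurable Lphi.
have phi0 x : 0 <= phi x by have /andP[] := phi01 x.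
have <- := Rintegral_fin_ratio_dev q0 r0 (sigma0 n) n0 (ZB n) mphi phi0.
apply: (radial_correction q0 r0 (sigma0 n) n0 (ZB n) Lphi phi01 eps01
  (weight_le q (sigma n)) e1).
exact: (ratio_gt2_le f3 g3 n0 (weight_ge0 q (sigma n)) (weight_le q (sigma n))
  (sum_weight_sqr q (sigma0 n) n0) e1 eta0 rat).
Unshelve. all: by end_near. Qed.

End limits.

Lemma ratio_dev_den0 {R : realType} (f : R -> R) (al : R) n (a : 'I_n -> R) (t : n.-tuple R) :
  ratio_dev f (fun=> 0) al 0 a t = (\sum_j a j) * ((1 + num_dev f a t) `^ al - 1).
Proof. by rewrite /ratio_dev /ratio /ratio_fun oppr0 powRr0 mulr1. Qed.

Lemma centered3_zero {R : realType} (mu : probability R R) : centered3 mu (fun=> 0).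
Proof.
split => //; last exact: Rintegral_cst1.
apply: (@bounded_integrable _ _ _ _ _ 0) => [|x]; last by rewrite normr0 expr0n normr0.
exact: measurable_cst.
Qed.

Lemma measurable_lpnorm_diag {R : realType} (q : R) n (sigma : 'I_n -> R) : (forall i, 0 < sigma i) ->
  measurable_fun setT (fun t : n.-tuple R =>
    lpnorm q%:E (invmx (diag_mx (\row_i sigma i)) *m col_of_tuple t)).
Proof.
move=> sigma0; under eq_fun do rewrite lpnorm_invmx_diag//.
apply: (measurableT_comp (measurable_powR _)).
apply: measurable_sum => i; apply: measurable_funM => //.
apply: (measurableT_comp (measurable_powR _)); apply: measurableT_comp => //.
exact: measurable_tnth.
Qed.

(** Identifies the quantity in [ratio_var] with the square of the one whose limit is [G]. *)
Lemma sum_weight_sqr_mean {R : realType} (q : R) n (sigma : 'I_n -> R) :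
  (\sum_i weight q sigma i) ^+ 2 / n%:R =
  ((\sum_(i < n) sigma i `^ (- q)) /
    (Num.sqrt n%:R * (\sum_(i < n) sigma i `^ (- (2 * q))) `^ 2^-1)) ^+ 2.
Proof.
rewrite sum_weight; set S := \sum_(i < n) _; set Q := _ `^ 2^-1.
have -> : S / (Num.sqrt n%:R * Q) = S / Q * (Num.sqrt n%:R)^-1.
  by rewrite invfM mulrCA [LHS]mulrC.
by rewrite [RHS]exprMn exprVn sqr_sqrtr.
Qed.

Theorem theorem2 (R : realType) (p : \bar R) (q : R)
    (hp : (0 < p)%E) (hq : 0 < q)
    (sigma : forall n : nat, 'I_n -> R)
    (hsigma : forall (n : nat) (i : 'I_n), 0 < sigma n i)
    (F : \bar R) (hF0 : (0 <= F)%E)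
    (hF : ((\prod_(i < n) sigma n i) `^ n%:R^-1 *
           (n%:R^-1 * \sum_(i < n) sigma n i `^ (- q)) `^ q^-1)%:E
          @[n --> \oo] --> F)
    (h2 : (\prod_(i < n) sigma n i) `^ (2 * q / n%:R) *
          ((n%:R ^+ 2)^-1 * \sum_(i < n) sigma n i `^ (- (2 * q)))
          @[n --> \oo] --> (0 : R))
    (hNoether :
          (\big[Num.max/0]_(i < n) sigma n i `^ (- (2 * q))) /
          (\sum_(i < n) sigma n i `^ (- (2 * q)))
          @[n --> \oo] --> (0 : R))
    (G : R)
    (hG : (p < +oo)%E ->
          (\sum_(i < n) sigma n i `^ (- q)) /
          (Num.sqrt n%:R * (\sum_(i < n) sigma n i `^ (- (2 * q))) `^ 2^-1)
          @[n --> \oo] --> G)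
    (d : nat -> measure_display) (T : forall n : nat, measurableType (d n))
    (P : forall n : nat, probability (T n) R)
    (Z : forall n : nat, {RV (P n) >-> n.-tuple R})
    (hZ : forall n : nat, uniform_on (Z n) (lpball p n))
    (hpq : p <> q%:E \/ G < 1) :
  let M := pgauss_moment p q in
  let Sigma := fun n : nat => diag_mx (\row_i sigma n i) in
  let s2 := pgauss_var p q / (q ^+ 2 * M ^+ 2)
            - 2 * pgauss_cov p p q * G ^+ 2 / (q * M) * fine (p^-1)%E
            + G ^+ 2 * fine (p^-1)%E in
  cvg_in_distribution P
    (fun (n : nat) (w : T n) =>
       (\sum_(i < n) sigma n i `^ (- q)) /
       (\sum_(i < n) sigma n i `^ (- (2 * q))) `^ 2^-1 *
       (n%:R `^ fine (p^-1)%E *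
          lpnorm q%:E (invmx (Sigma n) *m col_of_tuple (Z n w)) /
          (M `^ q^-1 * (\sum_(i < n) sigma n i `^ (- q)) `^ q^-1)
        - 1))
    (normal_prob 0 (Num.sqrt s2)).
Proof.
move=> M Sigma s2.
have nc : noether q (sigma n) @[n --> \oo] --> (0 : R) by exact: hNoether.
apply: cvg_in_distribution_spline => [n|x0 k k0].
  apply: measurable_funM => //; apply: measurable_funB => //.
  apply: measurable_funM => //; apply: measurable_funM => //.
  exact: (measurableT_comp (measurable_lpnorm_diag q (hsigma n))).
case: p hp hG hZ hpq @M @s2 => [r||]; last by rewrite ltNge leNye.
- rewrite lte_fin => r0 /(_ (ltry _)) hGr hZr hpqr M s2.
  have kE : fine (r%:E^-1)%E = r^-1 by rewrite inver gt_eqF.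
  have Er0 : (0 < r%:E)%E by rewrite lte_fin.
  have M0 : 0 < M := pgauss_moment_gt0 Er0 hq.
  pose mean n := (\sum_i weight q (@sigma n) i) ^+ 2 / n%:R.
  have meanE n : mean n = ((\sum_(i < n) sigma n i `^ (- q)) /
      (Num.sqrt n%:R * (\sum_(i < n) sigma n i `^ (- (2 * q))) `^ 2^-1)) ^+ 2.
    exact: sum_weight_sqr_mean.
  have meanG : mean @ \oo --> G ^+ 2.
    by rewrite (funext meanE); exact: (cvgM hGr hGr).
  (* Cauchy-Schwarz on the weights bounds [G ^+ 2] by 1, as the convex combination in
     [limit_var_gt0] requires; the sign of [G] turns [G < 1] into [G ^+ 2 < 1]. *)
  have G0 : 0 <= G.
    apply: (cvgr_to_ge hGr); near=> n.
    by rewrite divr_ge0 ?mulr_ge0 ?sqrtr_ge0 ?powR_ge0//; apply: sumr_ge0 => i _; exact: powR_ge0.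
  have G1 : G ^+ 2 <= 1.
    apply: (cvgr_to_le meanG); near=> n.
    have n0 : (0 < n)%N by near: n; exists 1%N.
    by rewrite /mean ler_pdivrMr ?ltr0n// mul1r weights_sqr// sum_weight_sqr.
  (* The last term [G ^+ 2 / r] becomes [r^-1 ^+ 2 * G ^+ 2] times the second moment of [den_fun],
     which is [r]. *)
  have s2E : s2 = q^-1 ^+ 2 * \int[pgauss_prob r%:E]_x (num_fun r%:E q x ^+ 2)
     - 2 / q / r * G ^+ 2 * \int[pgauss_prob r%:E]_x (num_fun r%:E q x * den_fun r x)
     + r^-1 ^+ 2 * G ^+ 2 * \int[pgauss_prob r%:E]_x (den_fun r x ^+ 2).
    rewrite /s2 kE (pgauss_var_num Er0 hq) (pgauss_cov_num_den r0 hq) den_fun_sqr//.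
    rewrite -/M; field.
    by rewrite !gt_eqF.
  have s0 : 0 < s2.
    rewrite s2E; apply: limit_var_gt0 => //; first by rewrite sqr_ge0.
    case: hpqr => [rq|Gl]; [left; apply/eqP => rq'; apply: rq; by rewrite rq'|right].
    by rewrite -(expr1n _ 2) ltr_pXn2r ?nnegrE.
  have vs : ratio_var (pgauss_prob r%:E) (num_fun r%:E q) (den_fun r) q^-1 r^-1
      (weight q (@sigma n)) @[n --> \oo] --> s2.
    rewrite s2E /ratio_var; apply: cvgD; last first.
      by apply: cvgMl; apply: cvgMr; exact: meanG.
    apply: cvgB; first exact: cvg_cst.
    by apply: cvgMl; apply: cvgMr; exact: meanG.
  have lim := radial_dev_spline_cvg (x0 := x0) hq hsigma nc r0 hZr s0 k0 vs.
  (* For [n > 0] the statistic is exactly [radial_dev] at [Z n]; the degenerate case [n = 0] is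
     irrelevant to the limit. *)
  apply: cvg_trans lim; apply: near_eq_cvg; near=> n.
  have n0 : (0 < n)%N by near: n; exists 1%N.
  apply: eq_Rintegral => w _.
  by rewrite /radial_dev sum_weight -(fin_ratio_lpnorm hq r0 (hsigma n) n0) kE.
(* For the cube the product law transfers every test function, so there is no radius to correct, and
   the variance of the linear part is already constant in [n]. *)
- move=> p0 _ hZy _ M s2.
  have kE : fine ((+oo : \bar R)^-1)%E = 0 by rewrite invey.
  have M0 : 0 < M := pgauss_moment_gt0 p0 hq.
  have s2E : s2 = q^-1 ^+ 2 * \int[pgauss_prob +oo%E]_x (num_fun +oo%E q x ^+ 2).
    rewrite /s2 kE (pgauss_var_num p0 hq) -/M !mulr0 subr0 addr0; field.
    by rewrite !gt_eqF.
  have s0 : 0 < s2 by rewrite s2E mulr_gt0 ?exprn_gt0 ?invr_gt0// num_fun_sqr_gt0.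
  have al0 : 0 <= q^-1 by rewrite invr_ge0 ltW.
  have f3 := centered3_num_fun p0 hq.
  have g3 := @centered3_zero R (pgauss_prob +oo%E).
  have vs : ratio_var (pgauss_prob +oo%E) (num_fun +oo%E q) (fun=> 0) q^-1 0
      (weight q (@sigma n)) @[n --> \oo] --> s2.
    rewrite /ratio_var s2E; under eq_fun do rewrite expr0n !mulr0 !mul0r subr0 addr0.
    exact: cvg_cst.
  have lim := ratio_dev_spline_cvg (x0 := x0) hsigma nc f3 g3 al0 (lexx 0) s0 k0 vs.
  apply: cvg_trans lim; apply: near_eq_cvg; near=> n.
  have n0 : (0 < n)%N by near: n; exists 1%N.
  pose dev (t : n.-tuple R) := spline3
    ((ratio_dev (num_fun +oo%E q) (fun=> 0) q^-1 0 (weight q (@sigma n)) t - x0) * k).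
  transitivity (\int[P n]_w dev (Z n w)).
    congr fine; symmetry; apply: (uniform_cube_law (g := fun t => (dev t)%:E) (hZy n)).
      have [? [? [? [? [Lphi _ _ _]]]]] := spline3_taylor2 x0 k0.
      apply/measurable_EFinP; apply: (measurableT_comp (bounded_lipschitz_measurable Lphi)).
      apply: measurable_funM => //; apply: measurable_funB => //.
      exact: (measurable_ratio q^-1 0 f3 g3).
    by move=> t; rewrite lee_fin; have /andP[] := spline3_itv _ : 0 <= dev t <= 1.
  apply: eq_Rintegral => w _.
  by rewrite /dev ratio_dev_den0 sum_weight (num_dev_powR hq (hsigma n) p0 n0) kE powRr0 mul1r.
Unshelve. all: by end_near. Qed.
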